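(* Let $(\Omega,\mathcal{F},\mathbb{P})$ support a standard two-dimensional Brownian motion $W=(W^0,W^1)=\{W_x\}_{x\in\mathbb{R}_+}$ with natural filtration $\{\mathcal{F}_x\}_{x\in\mathbb{R}_+}$, and let $Y=\{Y_{t,x}\}_{(t,x)\in\mathbb{R}_+^2}$ be a spatially adapted continuous random field which is a.s. in $\mathrm{G}$ and satisfies $\mathbb{E}[\exp(\tfrac12\overline{X}_t)]<\infty$ for every $t\in\mathbb{R}_+$, where $\overline{X}_t:=\inf\{x>0:Y_{t,x}<0\}$. Let $X=\{X_t\}_{t\in\mathbb{R}_+}$ be the solution of the random initial value problem $x'=Y_{t,x}$, $x_0=0$, and define the price process $S=\{S_t\}_{t\in\mathbb{R}_+}$ by $S_t:=\exp(W^\rho_{X_t}-\tfrac12X_t)$, where $W^\rho:=\sqrt{1-\rho^2}\,W^0+\rho W^1$ for some fixed $\rho\in[-1,1]$. Then $S$ is a martingale with respect to the filtration $\{\mathcal{G}_t\}_{t\in\mathbb{R}_+}$, $\mathcal{G}_t:=\mathcal{F}_{X_t}$, and verifies $[\log S]=X$, where $[\cdot]$ denotes quadratic variation.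
   Context: $\mathbb{R}_+=[0,\infty)$. $\mathrm{G}\subset C(\mathbb{R}_+^2,\mathbb{R})$ is the set of continuous $g:\mathbb{R}_+^2\to\mathbb{R}$, $(t,x)\mapsto g(t,x)$, such that: (i) $g(0,0)\ge0$; (ii) $g(\cdot,x)$ is strictly increasing for each $x\in\mathbb{R}_+$; (iii) $\inf_{x\in\mathbb{R}_+}g(t,x)<0$ for all $t\in\mathbb{R}_+$; (iv) $\sup_{t\in\mathbb{R}_+}g(t,x)>0$ for all $x\in\mathbb{R}_+$. A continuous random field is a random element of $C(\mathbb{R}_+^2,\mathbb{R})$ (Borel $\sigma$-algebra of uniform convergence over compacts). It is spatially adapted if $Y_{t,x}$ is $\mathcal{F}_x$-measurable for each $(t,x)\in\mathbb{R}_+^2$. A process $X$ is the solution of the random initial value problem $x'=Y_{t,x}$, $x_0=0$ if almost surely $X_0=0$ and $X'_t=Y_{t,X_t}$ for all $t\in\mathbb{R}_+$; for $Y\in\mathrm{G}$ a.s. it exists, is unique up to indistinguishability, a.s. has paths that are bijections in $C^1_0(\mathbb{R}_+,\mathbb{R}_+)$, and satisfies $X_t\le\overline{X}_t$. $\mathcal{F}_{X_t}$ denotes the $\sigma$-algebra of events prior to the stopping time $X_t$ of the filtration $\{\mathcal{F}_x\}_{x\in\mathbb{R}_+}$. *)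

(* Defs.v *)
From mathcomp Require Import all_boot all_order all_algebra.
From mathcomp Require Import all_classical all_reals all_analysis.

Set Implicit Arguments.
Unset Strict Implicit.
Unset Printing Implicit Defensive.

Import Order.TTheory GRing.Theory Num.Theory.
Import numFieldNormedType.Exports.

Local Open Scope classical_set_scope.
Local Open Scope ring_scope.

(* Processes and fields indexed by R_+ (resp. R_+^2) are functions on R
   (resp. R * R), of which only the values on R_+ (resp. R_+^2) matter: every
   definition below is restricted to nonnegative indices.                   *)
Definition Rplus {R : realType} : set R := [set x | 0 <= x].

Definition Rplus2 {R : realType} : set (R * R) := Rplus `*` Rplus.

Definition classG {R : realType} (g : R * R -> R) : Prop :=
  [/\ {within Rplus2, continuous g},
      0 <= g (0, 0),
      (forall x, Rplus x -> forall s t, Rplus s -> Rplus t -> s < t ->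
         g (s, x) < g (t, x)),
      (forall t, Rplus t ->
         (ereal_inf [set (g (t, x))%:E | x in Rplus] < 0)%E) &
      (forall x, Rplus x ->
         (0 < ereal_sup [set (g (t, x))%:E | t in Rplus])%E)].

(* [f'(t) = l] for a function on R_+: the difference quotient only involves
   points of R_+, so this is the right derivative at [t = 0].               *)
Definition has_derivative_Rplus {R : realType} (f : R -> R) (t l : R) : Prop :=
  (f s - f t) / (s - t) @[s --> within Rplus (t^')] --> l.

Section processes.
Context (d : measure_display) (T : measurableType d) (R : realType).
Context (P : probability T R).

Local Notation sub_measurable F f :=
  (forall B, measurable B -> F (f @^-1` B)).

Definition filtration (F : R -> set (set T)) : Prop :=
  [/\ forall t, Rplus t -> sigma_algebra setT (F t),
      forall t, Rplus t -> F t `<=` measurable &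
      forall s t, Rplus s -> s <= t -> F s `<=` F t].

Definition raw_natural_filtration (W : R -> T -> R * R) (x : R)
    : set (set T) :=
  <<s [set A | exists y : R, [/\ 0 <= y, y <= x &
         exists2 B : set (R * R), measurable B & A = W y @^-1` B]] >>.

(* The natural filtration completed with the P-null events: solutions of the
   initial value problem are only determined almost surely, so the [X t] are
   not in general stopping times of the raw filtration.                     *)
Definition natural_filtration (W : R -> T -> R * R) (x : R) : set (set T) :=
  <<s raw_natural_filtration W x `|`
      [set N | measurable N /\ P N = 0%E] >>.

Definition increment (W : R -> T -> R * R) (x y : R) (w : T) : R * R :=
  W y w - W x w.

Definition brownian_motion2 (W : R -> T -> R * R) : Prop :=
  [/\ (forall x, Rplus x -> measurable_fun setT (W x)),
      {ae P, forall w, W 0 w = (0, 0)},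
      (forall w, {within Rplus, continuous (fun x => W x w)}),
      (forall x y, Rplus x -> x < y ->
         forall A B, raw_natural_filtration W x A -> measurable B ->
         P (A `&` increment W x y @^-1` B)
         = (P A * P (increment W x y @^-1` B))%E) &
      (forall x y, Rplus x -> x < y -> forall B, measurable B ->
         P (increment W x y @^-1` B)
         = (normal_prob 0 (Num.sqrt (y - x))
            \x normal_prob 0 (Num.sqrt (y - x)))%E B)].

(* The topology on functions [R * R -> R] used here is that of uniform
   convergence over the compact subsets of R_+^2; it induces on C(R_+^2, R)
   its usual topology.                                                      *)
Definition continuous_random_field (Y : T -> R * R -> R) : Prop :=
  (forall w, {within Rplus2, continuous (Y w)}) /\
  forall U : set {family compactly_in (@Rplus2 R), R * R -> R},
    <<s [set V | open V] >> U -> measurable [set w | U (Y w)].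

Definition spatially_adapted (F : R -> set (set T)) (Y : T -> R * R -> R)
    : Prop :=
  forall t x, Rplus t -> Rplus x -> sub_measurable (F x) (Y ^~ (t, x)).

Definition Xbar (Y : T -> R * R -> R) (t : R) (w : T) : \bar R :=
  ereal_inf [set x%:E | x in [set x | 0 < x /\ Y w (t, x) < 0]].

(* [X] is an R_+-valued process solving [x' = Y_{t,x}], [x_0 = 0]; the
   nonnegativity for all [w] is what makes [Y w (t, X t w)] and [W (X t w) w]
   meaningful.                                                              *)
Definition solves_rivp (Y : T -> R * R -> R) (X : R -> T -> R) : Prop :=
  [/\ (forall t, Rplus t -> measurable_fun setT (X t)),
      (forall t w, Rplus t -> Rplus (X t w)) &
      {ae P, forall w, X 0 w = 0 /\
         forall t, Rplus t ->
           has_derivative_Rplus (fun s => X s w) t (Y w (t, X t w))}].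

Definition prior_events (F : R -> set (set T)) (tau : T -> R) : set (set T) :=
  [set A | measurable A /\
     forall x, Rplus x -> F x (A `&` [set w | tau w <= x])].

Definition is_cond_expectation (G : set (set T)) (Z V : T -> R) : Prop :=
  [/\ sub_measurable G V, P.-integrable setT (EFin \o V) &
      forall A, G A ->
        (\int[P]_(w in A) (V w)%:E = \int[P]_(w in A) (Z w)%:E)%E].

Definition martingale (G : R -> set (set T)) (S : R -> T -> R) : Prop :=
  [/\ filtration G,
      forall t, Rplus t -> sub_measurable (G t) (S t),
      forall t, Rplus t -> P.-integrable setT (EFin \o S t) &
      forall s t, Rplus s -> s <= t -> is_cond_expectation (G s) (S t) (S s)].

Definition mesh (a : R) (s : seq R) : R :=
  \big[Num.max/0]_(0 <= i < size s)
     (nth a (a :: s) i.+1 - nth a (a :: s) i).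

Definition squared_increments (Z : R -> T -> R) (a : R) (s : seq R) (w : T)
    : R :=
  \sum_(0 <= i < size s)
     (Z (nth a (a :: s) i.+1) w - Z (nth a (a :: s) i) w) ^+ 2.

(* [Q] is the quadratic variation of [Z]: the continuous increasing process
   null at 0 such that, for each [t], the sums of squared increments along
   partitions of [0, t] tend to [Q t] in probability as the mesh tends to 0;
   this determines [Q] up to indistinguishability.                          *)
Definition is_quadratic_variation (Z Q : R -> T -> R) : Prop :=
  {ae P, forall w, [/\ Q 0 w = 0,
      {within Rplus, continuous (fun t => Q t w)} &
      forall s t, Rplus s -> s <= t -> Q s w <= Q t w]} /\
  forall t, Rplus t -> forall eps eta : R, 0 < eps -> 0 < eta ->
    exists2 delta : R, 0 < delta &
      forall s : seq R, itv_partition 0 t s -> mesh 0 s < delta ->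
        (P [set w | (eps <= `|squared_increments Z 0 s w - Q t w|)%R]
         < eta%:E)%E.

Definition Wrho (rho : R) (W : R -> T -> R * R) (x : R) (w : T) : R :=
  Num.sqrt (1 - rho ^+ 2) * (W x w).1 + rho * (W x w).2.

Definition price (rho : R) (W : R -> T -> R * R) (X : R -> T -> R)
    (t : R) (w : T) : R :=
  expR (Wrho rho W (X t w) w - X t w / 2).

End processes.

(* Main.v *)
(** [X] is nondecreasing in [t] and the slope field increases in time, so
    [X t > b] iff a rational staircase built from the sections [Y t u], [u <= b],
    climbs above [b] before time [t]; hence [X t] is a stopping time of the
    completed Brownian filtration.  Since [X t <= Xbar t], Novikov's condition
    holds for it: on grid discretizations of a stopping time [tau] the
    exponential [M^l] has mean [1]; for [l < 1] Young's inequality bounds [M^l]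
    by a small multiple of [M^1] plus [C e^(tau/2)], so the limit along finer
    grids gives [E M^l_tau = 1], and [l -> 1] gives [E M_tau = 1].  The
    martingale property is this identity for the stopping time equal to [X t]
    on [A] and to [X s] off [A].
    For the quadratic variation, squared increments minus the time elapsed are
    sums of martingale differences along discretized stopping times, small in
    L^2 when [W] oscillates by at most [eps] over each step; the exceptional
    paths are controlled by the modulus of continuity. *)

Require Import Defs.
From mathcomp Require Import all_boot all_order all_algebra.
From mathcomp Require Import all_classical all_reals all_analysis.
From mathcomp Require Import measurable_realfun lra ring.

Import Order.TTheory GRing.Theory Num.Theory.
Import numFieldNormedType.Exports.

Local Open Scope classical_set_scope.
Local Open Scope ring_scope.

Set Implicit Arguments.
Unset Strict Implicit.
Unset Printing Implicit Defensive.

(** * Continuity and one-sided derivatives on the half-line *)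

Section half_line.
Context {R : realType}.
Implicit Types (f g : R -> R) (t e : R).

(** Adaptedness of the field is only spatial: to place the event [b < X t] in the filtration at [b],
    the field may be read at heights up to [b] alone, but at any time. Hence a criterion at a fixed
    level, with rational times and fractions so that countably many conditions remain. Almost sure
    statements are absorbed by the completion of the filtration. Both halves share one device: a
    random time is rounded up to a finite grid, a functional of the path becomes a telescoping sum
    over a deterministic range, and each increment carries a weight known at its left endpoint, so
    that it has mean zero. The return to continuous time is by Fatou's lemma, which gives
    inequalities only. For the exponential, the missing inequality comes from Fatou's lemma applied
    to a majorant minus the martingale; that majorant is built for [l < 1], hence the separate limit
    [l -> 1]. For the quadratic variation an upper bound is enough, but the event of small
    oscillation depends on the whole path: the weights are truncated, which keeps them adapted, and
    agree with the original ones on that event. *)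

Lemma Rplus_continuous_near f t e : {within Rplus, continuous f} ->
  0 <= t -> 0 < e -> exists2 d, 0 < d &
  forall s, 0 <= s -> `|t - s| < d -> `|f t - f s| < e.
Proof.
move=> /subspace_continuousP fc t0 e0; have /cvgrPdist_lt/(_ e e0) := fc t t0.
rewrite near_withinE => /nbhs_ballP[r /= r0 H].
by exists r => // s s0 ts; exact: H.
Qed.

Lemma Rplus_continuous_cvg f t (u : nat -> R) :
  {within Rplus, continuous f} -> 0 <= t -> (forall n, 0 <= u n) ->
  u @ \oo --> t -> (fun n => f (u n)) @ \oo --> f t.
Proof.
move=> fc t0 u0 ut; apply/cvgrPdist_lt => e e0.
have [r r0 H] := Rplus_continuous_near fc t0 e0.
by move/cvgrPdist_lt : ut => /(_ r r0); apply: filterS => n; exact: H.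
Qed.

Lemma Rplus_continuous_comp f g :
  {within Rplus, continuous f} -> {within Rplus, continuous g} ->
  (forall t, 0 <= t -> 0 <= g t) -> {within Rplus, continuous (f \o g)}.
Proof.
move=> fc gc g0; apply/subspace_continuousP => t t0; apply/cvgrPdist_lt => e e0.
have [r r0 H] := Rplus_continuous_near fc (g0 t t0) e0.
have [s s0 K] := Rplus_continuous_near gc t0 r0.
rewrite near_withinE; apply/nbhs_ballP; exists s => // u tu u0.
by apply: H; [exact: g0|exact: K].
Qed.

Lemma has_derivative_Rplus_lin f t l : has_derivative_Rplus f t l ->
  forall e, 0 < e -> exists2 d, 0 < d &
  forall s, 0 <= s -> `|t - s| < d ->
    `|f s - f t - l * (s - t)| <= e * `|s - t|.
Proof.
move=> /cvgrPdist_lt H e e0; have := H e e0.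
rewrite near_withinE => /nbhs_ballP[d /= d0 {}H]; exists d => // s s0 ts.
have [->|st] := eqVneq s t; first by rewrite !subrr mulr0 subrr normr0 mulr0.
have := H s ts st s0 => /ltW; rewrite distrC => {}H.
rewrite -[X in `|X|](@mulfVK _ (s - t)) ?subr_eq0// normrM ler_pM2r ?normr_gt0 ?subr_eq0//.
by rewrite mulrBl mulfK ?subr_eq0.
Qed.

Lemma has_derivative_Rplus_is_derive f t l : 0 < t ->
  has_derivative_Rplus f t l -> is_derive t 1 f l.
Proof.
move=> t0 H.
have Hc : (h^-1 *: ((f \o shift t) (h *: 1) - f t)) @[h --> 0^'] --> l.
  apply/cvgrPdist_lt => e e0.
  have [d d0 {}H] := has_derivative_Rplus_lin H (divr_gt0 e0 (ltr0Sn R 1)).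
  (* The radius [t] keeps [h + t] in the half-line, where the one-sided derivative gives
     information. *)
  apply/nbhs_ballP; exists (Num.min d t); first by rewrite /= lt_min d0 t0.
  move=> h; rewrite /ball/= sub0r normrN lt_min => /andP[hd ht] h0.
  have ht0 : 0 <= h + t by move: ht; rewrite ltr_norml; lra.
  have := H (h + t) ht0; rewrite (_ : t - (h + t) = - h); last by ring.
  rewrite normrN addrK => /(_ hd) {}H.
  apply: (@le_lt_trans _ _ (e / 2)); last by lra.
  rewrite distrC -(@ler_pM2r _ `|h|) ?normr_gt0// -normrM (le_trans _ H)//.
  by rewrite mulrBl /GRing.scale/= mulr1 mulrAC mulVf// mul1r.
by split; [apply/cvg_ex; exists l|exact: cvg_lim].
Qed.

End half_line.

(* The points [(q_i, i b / n)] form a staircase below which a solution started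
   at [0] cannot stay: above time [q_i] the slope across the strip
   [[i b / n, (i + 1) b / n]] is at least [(b / n) / (q_(i+1) - q_i)], because
   [g] increases with time.                                                  *)
Definition staircase {R : realType} (g : R * R -> R) (b t : R) (q : seq rat)
    : Prop :=
  let n := (size q).-1 in
  let s i : R := ratr (nth 0 q i) in
  [/\ (0 < n)%N, 0 <= s 0%N, s n < t &
   forall i, (i < n)%N -> s i < s i.+1 /\
     forall l : rat, 0 <= l <= 1 ->
       b / n%:R <= (s i.+1 - s i) * g (s i, (i%:R + ratr l) * (b / n%:R))].

(** * Solutions of the initial value problem and staircases *)

Section initial_value_problem.
Context {R : realType} (g : R * R -> R) (x : R -> R).
Hypotheses (Gg : classG g) (x_ge0 : forall t, 0 <= t -> 0 <= x t)
  (x0 : x 0 = 0)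
  (xd : forall t, 0 <= t -> has_derivative_Rplus x t (g (t, x t))).

Let gmono u s t : 0 <= u -> 0 <= s -> s < t -> g (s, u) < g (t, u).
Proof.
by case: Gg => _ _ + _ _ => + u0 s0 st => ->//; rewrite /Rplus/=; lra.
Qed.

Lemma ivp_continuous : {within Rplus, continuous x}.
Proof.
apply/subspace_continuousP => t t0; apply/cvgrPdist_le => e e0.
have [d d0 H] := has_derivative_Rplus_lin (xd t0) ltr01.
pose l := g (t, x t).
rewrite near_withinE; apply/nbhs_ballP.
exists (Num.min d (e / (1 + `|l|))).
  by rewrite /= lt_min d0 divr_gt0// ltr_pwDl.
move=> s; rewrite /ball/= lt_min => /andP[sd].
rewrite ltr_pdivlMr ?ltr_pwDl// => se s0.
have := H s s0 sd; rewrite -/l mul1r => {}H.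
rewrite distrC -[x s - x t](subrK (l * (s - t))).
rewrite (le_trans (ler_normD _ _))// normrM.
rewrite (distrC s t) in H *; lra.
Qed.

Let xc := ivp_continuous.

Let xc_itv a b : 0 <= a -> {within `[a, b], continuous x}.
Proof.
move=> a0; apply: continuous_subspaceW xc => s /=.
by rewrite in_itv/= => /andP[as_ _]; rewrite /Rplus/=; lra.
Qed.

Let x_near t e (t0 : 0 <= t) (e0 : 0 < e) := Rplus_continuous_near xc t0 e0.

(** Barrier argument: at the last time [sg] where the path is at most [a], its value is exactly [a]
    and its slope [g (sg, a)] is below [g (t0, a) < 0], so it would dip below [a] right after [sg].
    This yields both the sign of the slope and the bound of the solution by [Xbar]. *)
Lemma ivp_le t0 a t : 0 < a -> 0 <= t -> t <= t0 -> g (t0, a) < 0 -> x t <= a.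
Proof.
move=> a0 tge0 tt0 ga0; rewrite leNgt; apply/negP => xta.
pose E := [set s | 0 <= s <= t /\ x s <= a].
have E0 : E 0 by rewrite /E/= lexx tge0 x0; split => //; lra.
have supE : has_sup E.
  by split; [exists 0|exists t => s [/andP[]]].
pose sg := sup E.
have sg0 : 0 <= sg by apply: sup_upper_bound.
have sgt : sg <= t by apply: ge_sup; [exists 0|move=> s [/andP[]]].
have xsg : x sg <= a.
  rewrite leNgt; apply/negP => xsga.
  have [d d0 H] := @x_near sg (x sg - a) sg0 (ltac:(lra)).
  have [s [/andP[s0 st] xsa] sgs] := sup_adherent d0 supE.
  have ssg : s <= sg.
    by apply: sup_upper_bound => //; split => //; rewrite s0.
  rewrite -/sg in sgs.
  have : `|sg - s| < d by rewrite ger0_norm; lra.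
  move=> /(H s s0); rewrite ltr_norml => /andP[_]; lra.
have {}sgt : sg < t.
  by rewrite lt_neqAle sgt andbT; apply/eqP => sgt'; move: xta; rewrite -sgt'; lra.
have right_notin s : sg < s -> s <= t -> a < x s.
  move=> sgs st; rewrite ltNge; apply/negP => xsa.
  have : s <= sg by apply: sup_upper_bound => //; split => //; apply/andP; split; lra.
  by lra.
have xsga : x sg = a.
  apply/eqP; rewrite eq_le xsg leNgt; apply/negP => xsga.
  have [d d0 H] := @x_near sg (a - x sg) sg0 (ltac:(lra)).
  pose s := Num.min t (sg + d / 2).
  have sgs : sg < s by rewrite lt_min sgt; lra.
  have st : s <= t by rewrite ge_min lexx.
  have sd : s <= sg + d / 2 by rewrite ge_min lexx orbT.
  have := right_notin s sgs st.
  have : `|sg - s| < d by rewrite distrC ger0_norm; lra.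
  move=> /(H s ltac:(lra)); rewrite ltr_norml => /andP[]; lra.
have lneg : g (sg, a) < 0.
  by apply: lt_trans ga0; apply: gmono => //; lra.
(* Half the slope as tolerance leaves the negative rate [g (sg, a) / 2] to the right of [sg]. *)
have [d d0 H] := has_derivative_Rplus_lin (xd sg0)
  (ltac:(rewrite xsga; lra) : 0 < - g (sg, x sg) / 2).
rewrite xsga in H.
pose s := Num.min t (sg + d / 2).
have sgs : sg < s by rewrite lt_min sgt; lra.
have st : s <= t by rewrite ge_min lexx.
have sd : s <= sg + d / 2 by rewrite ge_min lexx orbT.
have := right_notin s sgs st.
have : `|sg - s| < d by rewrite distrC ger0_norm; lra.
move=> /(H s ltac:(lra)); rewrite (ger0_norm (x := s - sg)); last by lra.
rewrite ler_norml => /andP[_].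
have : g (sg, a) * (s - sg) < 0 by rewrite nmulr_rlt0//; lra.
lra.
Qed.

(** A negative slope at [t] would put the path above [x t] just before [t], which [ivp_le] with
    barrier [x t] forbids. Barriers are positive, so [x t = 0] is treated apart, through
    [g (0, 0) >= 0] and monotonicity in time. *)
Lemma ivp_slope_ge0 t : 0 <= t -> 0 <= g (t, x t).
Proof.
move=> t0; rewrite leNgt; apply/negP => gneg.
have [t_eq0|tn0] := eqVneq t 0.
  by move: gneg; rewrite t_eq0 x0; case: Gg => _ + _ _ _; lra.
have {tn0}t0' : 0 < t by rewrite lt_neqAle eq_sym tn0.
have [xt0|xtn0] := eqVneq (x t) 0.
  have := @gmono 0 0 t (lexx _) (lexx _) t0'.
  by move: gneg; rewrite xt0; case: Gg => _ + _ _ _; lra.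
have xt0 : 0 < x t by rewrite lt_neqAle eq_sym xtn0 x_ge0.
have [d d0 H] := has_derivative_Rplus_lin (xd t0)
  (ltac:(lra) : 0 < - g (t, x t) / 2).
pose s := Num.max 0 (t - d / 2).
have s0 : 0 <= s by rewrite le_max lexx.
have st : s < t by rewrite gt_max t0'; lra.
have sd : t - d / 2 <= s by rewrite le_max lexx orbT.
have := ivp_le xt0 s0 (ltW st) gneg.
have : `|t - s| < d by rewrite ger0_norm; lra.
move=> /(H s s0); rewrite (distrC s) (ger0_norm (x := t - s)); last by lra.
rewrite ler_norml => /andP[+ _].
have : g (t, x t) * (t - s) < 0 by rewrite nmulr_rlt0//; lra.
lra.
Qed.

Let ivp_MVT a b : 0 <= a -> a < b ->
  exists2 c, a < c < b & x b - x a = g (c, x c) * (b - a).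
Proof.
move=> a0 ab.
have [c|c + ->] := @MVT R x (fun s => g (s, x s)) a b ab _ (xc_itv (b := b) a0).
  rewrite in_itv/= => /andP[ac cb].
  by apply: has_derivative_Rplus_is_derive; [lra|apply: xd; lra].
by rewrite in_itv/=; exists c.
Qed.

Lemma ivp_nondecreasing s t : 0 <= s -> s <= t -> x s <= x t.
Proof.
move=> s0; rewrite le_eqVlt => /predU1P[->//|st].
have [c /andP[sc ct]] := ivp_MVT s0 st.
have : 0 <= g (c, x c) * (t - s).
  by rewrite mulr_ge0 ?ivp_slope_ge0//; lra.
lra.
Qed.

(** If the path were flat on [[s, t]], the mean value theorem on each half would give two times of
    zero slope at the same height, against strict monotonicity in time. *)
Lemma ivp_increasing s t : 0 <= s -> s < t -> x s < x t.
Proof.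
move=> s0 st; rewrite lt_neqAle ivp_nondecreasing ?(ltW st)// andbT.
apply/eqP => xst.
have x_eq c : s <= c <= t -> x c = x s.
  move=> /andP[sc ct]; apply/eqP; rewrite eq_le (ivp_nondecreasing s0 sc) andbT.
  by rewrite xst ivp_nondecreasing//; lra.
pose m := (s + t) / 2.
have [c /andP[sc cm]] := @ivp_MVT s m s0 (ltac:(rewrite /m; lra)).
have [c' /andP[mc' ct]] := @ivp_MVT m t (ltac:(rewrite /m; lra)) (ltac:(rewrite /m; lra)).
have sm : s < m < t by rewrite /m; apply/andP; split; lra.
rewrite !x_eq; try by apply/andP; split; lra.
rewrite subrr => /esym/eqP; rewrite mulf_eq0 (_ : t - m == 0 = false) ?orbF; last first.
  by apply/negbTE/eqP; lra.
move=> /eqP gc' /esym/eqP; rewrite mulf_eq0 (_ : m - s == 0 = false) ?orbF; last first.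
  by apply/negbTE/eqP; lra.
move=> /eqP gc.
have := @gmono (x s) c c' (x_ge0 s0) (ltac:(lra)) (ltac:(lra)).
lra.
Qed.

Let g_near t u e : 0 <= t -> 0 <= u -> 0 < e -> exists2 d, 0 < d &
  forall s v, 0 <= s -> 0 <= v -> `|t - s| < d -> `|u - v| < d ->
  `|g (t, u) - g (s, v)| < e.
Proof.
move=> t0 u0 e0; case: Gg => + _ _ _ _ => /subspace_continuousP.
move=> /(_ (t, u) (conj t0 u0)) /cvgrPdist_lt/(_ e e0).
rewrite near_withinE => /nbhs_ballP[d /= d0 H]; exists d => // s v s0 v0 ts uv.
by apply: (H (s, v)); split.
Qed.

(** Were the path still below level [i.+1] at time [s i.+1], a mean value point [c] would have its
    height in strip [i] and a slope at least that of the same height at the earlier time [s i],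
    which forces a climb of [h]. *)
Lemma staircase_lt b t q : 0 < b -> staircase g b t q -> b < x t.
Proof.
move=> b0; pose n := (size q).-1; pose s i : R := ratr (nth 0 q i).
pose h := b / n%:R.
case; rewrite -/n => n0; rewrite -/(s _) => s0; rewrite -/(s _) => snt H.
have {}H i : (i < n)%N -> s i < s i.+1 /\ forall l : rat, 0 <= l <= 1 ->
  h <= (s i.+1 - s i) * g (s i, (i%:R + ratr l) * h) := H i.
have nR0 : (0 : R) < n%:R by rewrite ltr0n.
have h0 : 0 < h by rewrite divr_gt0.
have si0 i : (i <= n)%N -> 0 <= s i.
  elim: i => // i IH ilt; have [] := H i ilt; have := IH (ltnW ilt); lra.
have climb i : (i <= n)%N -> i%:R * h <= x (s i).
  elim: i => [_|i IH ilt]; first by rewrite mul0r x_ge0.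
  have {}IH := IH (ltnW ilt); have [si Hi] := H i ilt.
  have sige0 := si0 i (ltnW ilt).
  rewrite leNgt; apply/negP => xlt.
  have [c /andP[sc cs]] := ivp_MVT sige0 si.
  have c0 : 0 <= c by lra.
  have xc_ge : x (s i) <= x c by rewrite ivp_nondecreasing// ltW.
  have xc_lt : x c < i.+1%:R * h.
    by apply: le_lt_trans xlt; rewrite ivp_nondecreasing// ltW.
  (* The staircase condition speaks of rational fractions only; fractions [l] just above the
     relative height [r] of [x c] in its strip, and continuity of [g], carry it over to [x c]. *)
  have gle : h <= (s i.+1 - s i) * g (s i, x c).
    rewrite leNgt; apply/negP => glt.
    have ds0 : 0 < s i.+1 - s i by lra.
    have e0 : 0 < h / (s i.+1 - s i) - g (s i, x c).
      by rewrite subr_gt0 ltr_pdivlMr// mulrC.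
    have [d d0 Hd] := g_near sige0 (x_ge0 c0) e0.
    pose r := x c / h - i%:R.
    have xcr : x c = (i%:R + r) * h by rewrite /r addrC subrK divfK// gt_eqF.
    have r0 : 0 <= r by rewrite /r subr_ge0 ler_pdivlMr//; lra.
    have r1 : r < 1.
      by move: xc_lt; rewrite -natr1 addrC /r ltrBlDr ltr_pdivrMr.
    have : r < Num.min 1 (r + d / h).
      by rewrite lt_min r1 ltrDl divr_gt0.
    move=> /rat_in_itvoo[l]; rewrite in_itv/= => /andP[rl].
    rewrite lt_min => /andP[l1 ld].
    have l01 : 0 <= l <= 1.
      by rewrite -(ler0q R) -(ler_rat R l 1) rmorph1; apply/andP; split; lra.
    have := Hi l l01; rewrite -/h.
    have il0 : 0 <= (i%:R + ratr l) * h.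
      by apply: mulr_ge0; [apply: addr_ge0 => //; lra|exact: ltW].
    have := Hd (s i) ((i%:R + ratr l) * h) sige0 il0.
    rewrite subrr normr0 => /(_ d0).
    have -> : x c - (i%:R + ratr l) * h = - ((ratr l - r) * h) by rewrite xcr; ring.
    rewrite normrN ger0_norm; last by apply: mulr_ge0; lra.
    have -> : (ratr l - r) * h < d by rewrite -ltr_pdivlMr//; lra.
    move=> /(_ isT); rewrite ltr_norml => /andP[Hlo _].
    rewrite -ler_pdivrMl// mulrC; lra.
  have : g (s i, x c) <= g (c, x c) by rewrite ltW// gmono// x_ge0.
  rewrite -(@ler_pM2l _ (s i.+1 - s i)); last by lra.
  rewrite -natr1 mulrDl mul1r in xlt.
  move=> gg eqx; rewrite mulrC in eqx; lra.
apply: (@le_lt_trans _ _ (x (s n))); last by rewrite ivp_increasing// si0.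
by rewrite (le_trans _ (climb n (leqnn n)))// /h mulrC divfK// gt_eqF.
Qed.

(** A delay by [e] raises the slope strictly, and compactness of [[0, t]] makes the margin uniform.
    It absorbs the rounding of times and heights when a staircase is built along the path. *)
Lemma ivp_uniform_gap e t : 0 < e -> 0 <= t -> exists2 eta, 0 < eta &
  forall r s v, 0 <= r <= t -> 0 <= s -> 0 <= v -> `|r - s| < eta ->
    `|x r - v| < eta -> g (r, x r) < g (s + e, v).
Proof.
move=> e0 t0.
pose P (eta r : R) := forall s v, 0 <= s -> 0 <= v -> `|r - s| < eta ->
    `|x r - v| < eta -> g (r, x r) < g (s + e, v).
have local (r0 : R) : `[0, t]%classic r0 ->
    \forall r \near r0 & eta \near 0^'+, `[0, t]%classic r -> P eta r.
  rewrite /= in_itv/= => /andP[r00 r0t].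
  have xr0 := x_ge0 r00.
  have gap : 0 < (g (r0 + e, x r0) - g (r0, x r0)) / 2.
    by rewrite divr_gt0// subr_gt0 gmono//; lra.
  have [d1 d10 H1] := g_near (ltac:(lra) : 0 <= r0 + e) xr0 gap.
  have [d2 d20 H2] := g_near r00 xr0 gap.
  pose d := Num.min d1 d2 / 2.
  have d0 : 0 < d by rewrite divr_gt0// lt_min d10.
  have dd : d + d = Num.min d1 d2 by rewrite /d; lra.
  have dd1 : d + d <= d1 by rewrite dd ge_min lexx.
  have dd2 : d + d <= d2 by rewrite dd ge_min lexx orbT.
  have [d3 d30 H3] := x_near r00 d0.
  exists (ball r0 (Num.min d d3), [set eta | eta < d]).
    split => /=; first by apply: nbhsx_ballx; rewrite lt_min d0.
    exact: nbhs_right_lt.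
  move=> [r eta] /= [+ etad]; rewrite /ball/= lt_min => /andP[rd rd3].
  rewrite in_itv/= => /andP[r_ge0 rt] s v s0 v0 rs xv.
  have xrd := H3 _ r_ge0 rd3.
  have := H2 r (x r) r_ge0 (x_ge0 r_ge0) (ltac:(lra)) (ltac:(lra)).
  have r0s : `|r0 + e - (s + e)| < d1.
    rewrite (_ : _ - _ = (r0 - r) + (r - s)); last by ring.
    by apply: le_lt_trans (ler_normD _ _) _; lra.
  have x0v : `|x r0 - v| < d1.
    rewrite (_ : _ - _ = (x r0 - x r) + (x r - v)); last by ring.
    by apply: le_lt_trans (ler_normD _ _) _; lra.
  have := H1 (s + e) v (ltac:(lra)) v0 r0s x0v.
  by rewrite !ltr_norml; lra.
have /compact_near_coveringP/near_covering_withinP cov := @segment_compact R 0 t.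
have {}cov := cov _ _ _ _ local.
near (0 : R)^'+ => eta; exists eta; first by near: eta; exact: nbhs_right_gt.
move=> r s v rt.
have : `[0, t]%classic `<=` P eta by near: eta; exact: cov.
by apply; rewrite /= in_itv.
Unshelve. all: by end_near. Qed.

(** The staircase is the path delayed by about [e]: the path reaches level [i h] at [T i], and [q i]
    is a rational slightly after [T i + e]. The path climbs [h] over [[T i, T i.+1]] at a mean slope
    [g (c, x c)]; the delayed slope is larger at every height of the strip, and the delayed step
    lasts longer. *)
Lemma lt_staircase b t : 0 < b -> 0 <= t -> b < x t ->
  exists q, staircase g b t q.
Proof.
move=> b0 t0 bxt.
have [t' t'0t xt'] : exists2 t', 0 <= t' < t & x t' = b.
  have := @IVT R x 0 t b t0 (xc_itv (b := t) (lexx 0)).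
  rewrite x0 min_l ?x_ge0// max_r ?x_ge0// (ltW b0) (ltW bxt) => /(_ isT).
  move=> [t']; rewrite in_itv/= => /andP[t'0 t't] xt'; exists t' => //.
  rewrite t'0/= lt_neqAle t't andbT; apply/eqP => t'_eq.
  by move: bxt; rewrite -xt' t'_eq ltxx.
move: t'0t => /andP[t'0 t't].
(* One third of the spare time goes to the delay, one third to the choice of rationals, and one
   third keeps [q n < t]. *)
pose e := (t - t') / 3.
have e0 : 0 < e by rewrite /e; lra.
have [eta eta0 Heta] := ivp_uniform_gap e0 t'0.
(* Levels less than [m] apart are reached within time [eta] of each other; together with [h < eta]
   this puts each step within the range of [Heta]. *)
have [m m0 Hm] : exists2 m, 0 < m & forall r, 0 <= r <= t' ->
    m <= x (r + eta) - x r.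
  have shift_cont : {within `[0, t'], continuous (fun r => x (r + eta) - x r)}.
    apply/subspace_continuousP => r; rewrite /= in_itv/= => /andP[r0 rt].
    have e1 : 0 <= r + eta by lra.
    apply/cvgrPdist_lt => f f0; rewrite near_withinE; apply/nbhs_ballP.
    have [d1 d10 H1] := x_near r0 (ltac:(lra) : 0 < f / 2).
    have [d2 d20 H2] := x_near e1 (ltac:(lra) : 0 < f / 2).
    exists (Num.min d1 d2); first by rewrite /= lt_min d10.
    move=> s; rewrite /ball/= lt_min => /andP[s1 s2].
    rewrite in_itv/= => /andP[s0 st].
    have := H1 s s0 s1; have := H2 (s + eta) (ltac:(lra)).
    rewrite (_ : r + eta - (s + eta) = r - s); last by ring.
    move=> /(_ s2); rewrite /from_subspace/= !ltr_norml => /andP[? ?] /andP[? ?].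
    by apply/andP; split; lra.
  have [c] := EVT_min t'0 shift_cont.
  rewrite in_itv/= => /andP[c0 ct] Hc.
  exists (x (c + eta) - x c); first by rewrite subr_gt0 ivp_increasing//; lra.
  by move=> r rt; apply: Hc; rewrite in_itv.
have [n n0 nsmall] : exists2 n, (0 < n)%N & b / n%:R < Num.min m eta.
  have me0 : 0 < Num.min m eta by rewrite lt_min m0.
  pose n := (Num.truncn (b / Num.min m eta)).+1; exists n => //.
  rewrite ltr_pdivrMr ?ltr0n// mulrC -ltr_pdivrMr//.
  exact: truncnS_gt.
set h := b / n%:R in nsmall.
have nR0 : (0 : R) < n%:R by rewrite ltr0n.
have h0 : 0 < h by rewrite divr_gt0.
have nh : n%:R * h = b by rewrite /h mulrC divfK// gt_eqF.
move: nsmall; rewrite lt_min => /andP[hm heta].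
have level i : exists s, (i <= n)%N -> 0 <= s <= t' /\ x s = i%:R * h.
  have [ilen|_] := leqP i n; last by exists 0.
  have := @IVT R x 0 t' (i%:R * h) t'0 (xc_itv (b := t') (lexx 0)).
  rewrite x0 xt' min_l ?(ltW b0)// max_r ?(ltW b0)//.
  have ih : 0 <= i%:R * h <= b.
    by rewrite mulr_ge0 ?(ltW h0)//= -nh ler_pM2r// ler_nat.
  by move=> /(_ ih) [s]; rewrite in_itv/= => st xs; exists s.
have {level}[T HT] := choice level.
(* The window for [q i] is shifted by [i * k], which gives [q i.+1 - q i > T i.+1 - T i]; the shifts
   total [e]. *)
pose k := e / n.+1%:R.
have k0 : 0 < k by rewrite divr_gt0.
have rat_above i : exists q : rat,
    T i + e + i%:R * k < ratr q < T i + e + i.+1%:R * k.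
  have : T i + e + i%:R * k < T i + e + i.+1%:R * k.
    by rewrite ltrD2l ltr_pM2r// ltr_nat.
  by move=> /rat_in_itvoo[q]; rewrite in_itv/=; exists q.
have {rat_above}[q Hq] := choice rat_above.
exists (mkseq q n.+1); rewrite /staircase size_mkseq -[n.+1.-1]/n.
have nthq i : (i <= n)%N -> nth 0 (mkseq q n.+1) i = q i.
  by move=> ilen; rewrite nth_mkseq.
split => //.
- rewrite nthq//; have [/andP[T0 _] _] := HT 0%N (leq0n _).
  by have /andP[+ _] := Hq 0%N; rewrite mul0r; lra.
- rewrite nthq//; have [/andP[_ Tn] _] := HT n (leqnn _).
  have /andP[_ qn] := Hq n; apply: (lt_le_trans qn).
  have -> : n.+1%:R * k = e by rewrite /k mulrC divfK.
  by rewrite /e; lra.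
- move=> i ilt; rewrite !nthq//; last exact: ltnW.
  have [/andP[Ti0 Tit] xTi] := HT i (ltnW ilt).
  have [/andP[TSi0 TSit] xTSi] := HT i.+1 ilt.
  have /andP[qi qi'] := Hq i; have /andP[qSi _] := Hq i.+1.
  have TT : T i < T i.+1.
    rewrite ltNge; apply/negP => /(ivp_nondecreasing TSi0).
    by rewrite xTi xTSi ler_pM2r// ler_nat ltnn.
  have Teta : T i.+1 < T i + eta.
    rewrite ltNge; apply/negP => Tge.
    have := ivp_nondecreasing (ltac:(lra) : 0 <= T i + eta) Tge.
    have := Hm (T i); rewrite Ti0 Tit => /(_ isT).
    rewrite xTi xTSi -natr1 mulrDl mul1r; lra.
  split; first by lra.
  move=> l /andP[l0 l1]; rewrite -/h.
  have lr0 : (0 : R) <= ratr l by rewrite ler0q.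
  have lr1 : ratr l <= 1 :> R by rewrite -(rmorph1 (@ratr R)) ler_rat.
  have [c /andP[Tc cT]] := ivp_MVT Ti0 TT.
  have c0 : 0 <= c by lra.
  have xTc : x (T i) <= x c by rewrite ivp_nondecreasing// ltW.
  have xcT : x c <= x (T i.+1) by rewrite ivp_nondecreasing// ltW.
  rewrite xTi xTSi -natr1 mulrDl mul1r => hslope.
  set v := (i%:R + ratr l) * h.
  have v_lo : i%:R * h <= v by rewrite /v ler_pM2r// lerDl.
  have v_hi : v <= i%:R * h + h by rewrite /v mulrDl lerD2l ler_piMl// ltW.
  rewrite xTi in xTc; rewrite xTSi -natr1 mulrDl mul1r in xcT.
  have ih0 : 0 <= i%:R * h by rewrite mulr_ge0// ltW.
  have g1 : g (c, x c) < g (T i + e, v).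
    apply: Heta => //; first by apply/andP; split; lra.
    - by lra.
    - by rewrite ger0_norm; lra.
    - by rewrite ltr_norml; apply/andP; split; lra.
  have ik0 : 0 <= i%:R * k by rewrite mulr_ge0// ltW.
  have g2 : g (T i + e, v) <= g (ratr (q i), v).
    by rewrite ltW// gmono//; lra.
  have slope : (T i.+1 - T i) * g (c, x c) = h by rewrite mulrC; lra.
  rewrite -[leLHS]slope; apply: ler_pM; [lra|exact: ivp_slope_ge0|lra|lra].
Qed.

Lemma ivp_lt_staircaseP b t : 0 < b -> 0 <= t ->
  b < x t <-> exists q, staircase g b t q.
Proof.
by move=> b0 t0; split=> [|[q]]; [exact: lt_staircase|exact: staircase_lt].
Qed.

End initial_value_problem.

Arguments ivp_continuous {R g x} xd.

(** * Densities and the Laplace transform of the normal law *)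

Section density.
Local Open Scope ereal_scope.
Context d (T : measurableType d) (R : realType).
Variables (mu nu : {measure set T -> \bar R}) (g : T -> R).
Hypotheses (mg : measurable_fun setT g) (g0 : forall x, (0 <= g x)%R)
  (nuE : forall A, measurable A -> nu A = \int[mu]_(x in A) (g x)%:E).
Import HBNNSimple.

Let integral_density_nnsfun (h : {nnsfun T >-> R}) :
  \int[nu]_x (h x)%:E = \int[mu]_x ((h x)%:E * (g x)%:E).
Proof.
under [LHS]eq_integral do rewrite fimfunE -fsumEFin//.
rewrite [LHS]ge0_integral_fsum//; last 2 first.
  - by move=> r; exact/measurable_EFinP/measurableT_comp.
  - by move=> n x _; rewrite EFinM nnfun_muleindic_ge0.
under [RHS]eq_integral.
  move=> x _; rewrite fimfunE -fsumEFin// ge0_mule_fsuml; last first.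
    by move=> r; rewrite EFinM nnfun_muleindic_ge0.
  over.
rewrite [RHS]ge0_integral_fsum//; last 2 first.
  - move=> r; apply: emeasurable_funM; last exact/measurable_EFinP.
    exact/measurable_EFinP/measurableT_comp.
  - by move=> n x _; rewrite EFinM mule_ge0 ?nnfun_muleindic_ge0// lee_fin.
apply: eq_fsbigr => r _.
rewrite integralZl_indic_nnsfun// integral_indic// setIT nuE//.
under [RHS]eq_integral do rewrite EFinM -muleA.
have mi : measurable_fun setT (fun x => (\1_(h @^-1` [set r]) x)%:E * (g x)%:E).
  by apply: emeasurable_funM; exact/measurable_EFinP.
have [r0|r0] := ltP r 0%R.
  rewrite (preimage_nnfun0 h r0) integral_set0 mule0 integral0_eq// => x _.
  by rewrite indic0 mul0e mule0.
rewrite ge0_integralZl//; last by move=> x _; rewrite mule_ge0// lee_fin.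
congr (_ * _); rewrite integral_mkcond; apply: eq_integral => x _.
rewrite patchE indicE; case: ifPn => _; by rewrite ?mul1e ?mul0e.
Qed.

Lemma ge0_integral_density (f : T -> \bar R) : measurable_fun setT f ->
  (forall x, 0 <= f x) -> \int[nu]_x f x = \int[mu]_x (f x * (g x)%:E).
Proof.
move=> mf f0; pose f_ := nnsfun_approx measurableT mf.
have fE x : limn (fun n => (f_ n x)%:E) = f x.
  by apply/cvg_lim => //; apply: cvg_nnsfun_approx => // y _; exact: f0.
transitivity (limn (fun n => \int[nu]_x (f_ n x)%:E)).
  rewrite -monotone_convergence//.
  - by apply: eq_integral => x _; rewrite fE.
  - by move=> n; exact/measurable_EFinP.
  - by move=> n x _; rewrite lee_fin.
  - by move=> x _ m n mn; rewrite lee_fin; exact/lefP/nd_nnsfun_approx.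
under eq_fun do rewrite integral_density_nnsfun.
rewrite -monotone_convergence//; last 3 first.
- move=> n; apply: emeasurable_funM; exact/measurable_EFinP.
- by move=> n x _; rewrite mule_ge0// lee_fin.
- move=> x _ m n mn; rewrite lee_wpmul2r ?lee_fin//.
  exact/lefP/nd_nnsfun_approx.
apply: eq_integral => x _; rewrite -fE muleC -limeMl//; last first.
  by apply/cvg_ex; exists (f x); apply: cvg_nnsfun_approx => // y _; exact: f0.
by under eq_fun do rewrite muleC.
Qed.

End density.

Lemma normal_mgf {R : realType} (s l : R) : s != 0 ->
  (\int[normal_prob 0 s]_z (expR (l * z))%:E = (expR (l ^+ 2 * s ^+ 2 / 2))%:E)%E.
Proof.
move=> s0.
rewrite (@ge0_integral_density _ _ _ lebesgue_measure (normal_prob 0 s)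
  (normal_pdf 0 s)); first last.
- by move=> x; rewrite lee_fin expR_ge0.
- apply/measurable_EFinP/measurableT_comp => //.
- by [].
- by move=> x; exact: normal_pdf_ge0.
- exact: measurable_normal_pdf.
(* Completing the square turns the tilted density into a normal density of mean [l * s ^+ 2]. *)
have shiftE z : expR (l * z) * normal_pdf 0 s z =
    expR (l ^+ 2 * s ^+ 2 / 2) * normal_pdf (l * s ^+ 2) s z.
  rewrite !normal_pdfE//= /normal_fun mulrCA [RHS]mulrCA; congr (_ * _).
  by rewrite -!expRD; congr expR; field.
under eq_integral do rewrite -EFinM shiftE EFinM.
rewrite ge0_integralZl//; last 2 first.
- by apply/measurable_EFinP; exact: measurable_normal_pdf.
- by move=> x _; rewrite lee_fin normal_pdf_ge0.
by rewrite integral_normal_pdf mule1.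
Qed.

(** * Products of independent variables *)

Section independent_product.
Context d (T : measurableType d) (R : realType) (P : probability T R).
Variables (U xi : T -> R).
Hypotheses (mU : measurable_fun setT U) (mxi : measurable_fun setT xi).
Hypothesis indep : forall A B : set R, measurable A -> measurable B ->
  P (U @^-1` A `&` xi @^-1` B) = (P (U @^-1` A) * P (xi @^-1` B))%E.

Let X : {mfun T >-> R} := mfun_Sub (mem_set mU).
Let Z : {mfun T >-> R} := mfun_Sub (mem_set mxi).
Let mXZ : measurable_fun setT (fun w => (U w, xi w)).
Proof. exact: measurable_fun_pair. Qed.
Let XZ : {mfun T >-> (R * R)%type} := mfun_Sub (mem_set mXZ).

(** Rectangles determine a measure on the plane, so independence identifies the joint law and
    Fubini's theorem becomes available. *)
Let joint_law (A : set (R * R)) : measurable A ->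
  (distribution P X \x distribution P Z)%E A = distribution P XZ A.
Proof.
by apply: product_measure_unique => B C mB mC; rewrite /= -indep.
Qed.

Local Open Scope ereal_scope.

Lemma ge0_integral_indep_mul (f g : R -> R) :
  measurable_fun setT f -> measurable_fun setT g ->
  (forall x, 0 <= f x)%R -> (forall x, 0 <= g x)%R ->
  \int[P]_w (f (U w) * g (xi w))%:E =
  \int[P]_w (f (U w))%:E * \int[P]_w (g (xi w))%:E.
Proof.
move=> mf mg f0 g0.
pose h (z : R * R) := (f z.1 * g z.2)%:E.
have mh : measurable_fun setT h.
  by apply/measurable_EFinP/measurable_funM; exact: measurableT_comp.
have h0 z : 0 <= h z by rewrite lee_fin mulr_ge0.
transitivity (\int[distribution P XZ]_z h z); first by rewrite ge0_integral_distribution.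
rewrite (eq_measure_integral (distribution P X \x distribution P Z)); last first.
  by move=> A mA _; exact/esym/joint_law.
rewrite fubini_tonelli1// /fubini_F /h /=.
under eq_integral do under eq_integral do rewrite EFinM.
under eq_integral.
  move=> x _; rewrite ge0_integralZl//; last 3 first.
  - exact/measurable_EFinP.
  - by move=> y _; rewrite lee_fin.
  - by rewrite lee_fin.
  over.
rewrite ge0_integralZr//; last 3 first.
- exact/measurable_EFinP.
- by move=> x _; rewrite lee_fin.
- by apply: integral_ge0 => y _; rewrite lee_fin.
congr (_ * _).
- by rewrite ge0_integral_distribution//; exact/measurable_EFinP.
- by rewrite ge0_integral_distribution//; exact/measurable_EFinP.
Qed.

Lemma integrable_indep_mul (g : R -> R) : measurable_fun setT g ->
  P.-integrable setT (EFin \o U) -> P.-integrable setT (EFin \o (g \o xi)) ->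
  P.-integrable setT (EFin \o (fun w => U w * g (xi w))%R).
Proof.
move=> mg /integrableP[_ iU] /integrableP[_ ig]; apply/integrableP; split.
  apply/measurable_EFinP/measurable_funM => //; exact: measurableT_comp.
under eq_integral do rewrite /= normrM.
rewrite (@ge0_integral_indep_mul (fun x => `|x|%R) (fun x => `|g x|%R))//; last first.
  exact: measurableT_comp.
by rewrite lte_mul_pinfty ?integral_ge0// ge0_fin_numE// integral_ge0.
Qed.

Lemma Rintegral_indep_mul (g : R -> R) : measurable_fun setT g ->
  P.-integrable setT (EFin \o U) -> P.-integrable setT (EFin \o (g \o xi)) ->
  (\int[P]_w (U w * g (xi w)) = \int[P]_w U w * \int[P]_w g (xi w))%R.
Proof.
move=> mg iU ig; have iUg := integrable_indep_mul mg iU ig.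
pose h (z : R * R) := (z.1 * g z.2)%:E.
have mh : measurable_fun setT h.
  apply/measurable_EFinP/measurable_funM => //; exact: measurableT_comp.
have ih : (distribution P X \x distribution P Z).-integrable setT h.
  apply/integrableP; split => //.
  rewrite (eq_measure_integral (distribution P XZ)); last first.
    by move=> A mA _; exact: joint_law.
  rewrite ge0_integral_distribution//; last exact: measurableT_comp.
  by move/integrableP : iUg => [].
rewrite /Rintegral.
have -> : \int[P]_w (U w * g (xi w))%:E = \int[distribution P XZ]_z h z.
  by rewrite integral_distribution.
rewrite (eq_measure_integral (distribution P X \x distribution P Z)); last first.
  by move=> A mA _; exact/esym/joint_law.
rewrite -integral12_prod_meas1// /fubini_F /h /=.
have ig' : (distribution P Z).-integrable setT (EFin \o g).
  by apply: integrable_pushforward => //; exact/measurable_EFinP.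
have -> : \int[P]_w (g (xi w))%:E = \int[distribution P Z]_y (g y)%:E.
  by rewrite integral_distribution//; exact/measurable_EFinP.
under eq_integral.
  move=> x _; under eq_integral do rewrite EFinM.
  rewrite integralZl// -[X in _ * X]fineK; last exact: integrable_fin_num.
  over.
rewrite integralZr//; last first.
  by apply: integrable_pushforward => //; exact/measurable_EFinP.
rewrite (_ : \int[distribution P X]_x x%:E = \int[P]_w (U w)%:E); last first.
  by rewrite integral_distribution.
by rewrite fineM// integrable_fin_num.
Qed.

End independent_product.

Lemma measure_eq_negligible d (T : measurableType d) (R : realType)
    (mu : {measure set T -> \bar R}) (A B : set T) :
  measurable A -> measurable B ->
  mu.-negligible (A `\` B) -> mu.-negligible (B `\` A) -> mu A = mu B.
Proof.
move=> mA mB nAB nBA.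
rewrite (measureDI mu mA mB) (measureDI mu mB mA) (setIC B).
by rewrite !(measure_negligible _ nAB, measure_negligible _ nBA)//; exact: measurableD.
Qed.

(** * The completed Brownian filtration *)

Section natural_filtration.
Context d (T : measurableType d) (R : realType) (P : probability T R).
Variable W : R -> T -> R * R.
Hypothesis hW : brownian_motion2 P W.

Local Notation F := (natural_filtration P W).
Local Notation FT x := (g_sigma_algebraType (raw_natural_filtration W x `|`
  [set N | measurable N /\ P N = 0%E])).

Lemma raw_natural_filtration_measurable x :
  raw_natural_filtration W x `<=` measurable.
Proof.
apply: smallest_sub; first exact: sigma_algebra_measurable.
move=> _ [y [y0 _ [B mB ->]]]; rewrite -[X in measurable X]setTI.
by case: hW => mW _ _ _ _; exact: mW.
Qed.

Lemma natural_filtration_measurable x : F x `<=` measurable.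
Proof.
apply: smallest_sub; first exact: sigma_algebra_measurable.
by move=> A [/raw_natural_filtration_measurable//|[]].
Qed.

Lemma natural_filtration_nondecreasing x y : x <= y -> F x `<=` F y.
Proof.
move=> xy; apply: sub_sigma_algebra2; apply: setSU.
apply: sub_sigma_algebra2 => A [z [z0 zx mA]]; exists z; split => //.
exact: le_trans xy.
Qed.

Lemma natural_filtration_null x N : measurable N -> P N = 0%E -> F x N.
Proof. by move=> mN N0; apply: sub_sigma_algebra; right. Qed.

Lemma natural_filtrationI x A B : F x A -> F x B -> F x (A `&` B).
Proof. by move=> FA FB; exact: (@measurableI _ (FT x)). Qed.

Lemma natural_filtrationU x A B : F x A -> F x B -> F x (A `|` B).
Proof. by move=> FA FB; exact: (@measurableU _ (FT x)). Qed.

Lemma natural_filtrationD x A B : F x A -> F x B -> F x (A `\` B).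
Proof. by move=> FA FB; exact: (@measurableD _ (FT x)). Qed.

(** Completeness in usable form: this is how almost sure properties of the solution enter statements
    of measurability. *)
Lemma natural_filtration_negligible x A B : F x A -> measurable B ->
  P.-negligible (A `\` B) -> P.-negligible (B `\` A) -> F x B.
Proof.
move=> FA mB nAB nBA; have mA := natural_filtration_measurable FA.
have -> : B = (A `\` (A `\` B)) `|` (B `\` A).
  rewrite setDD; apply/seteqP; split => [w Bw|w [[]|[]]]//.
  by have [Aw|nAw] := pselect (A w); [left|right].
apply: natural_filtrationU; first apply: natural_filtrationD => //.
- apply: natural_filtration_null; [exact: measurableD|].
  by apply/measure_negligible => //; exact: measurableD.
- apply: natural_filtration_null; [exact: measurableD|].
  by apply/measure_negligible => //; exact: measurableD.
Qed.

(** The events that agree almost surely with a raw event form a sigma-algebra containing the null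
    events, hence all of [F x]. Independence of increments, assumed for the raw filtration, thereby
    passes to the completed one. *)
Lemma natural_filtration_approx x A : F x A ->
  exists A', [/\ raw_natural_filtration W x A', P.-negligible (A `\` A') &
    P.-negligible (A' `\` A)].
Proof.
have rawP := smallest_sigma_algebra setT [set A | exists y : R,
  [/\ 0 <= y, y <= x & exists2 B, measurable B & A = W y @^-1` B]].
move: A; apply: smallest_sub.
  split.
  - exists set0; rewrite !set0D; split=> //; try exact: negligible_set0.
    by case: rawP.
  - move=> A [A' [rA' n1 n2]]; exists (setT `\` A'); split.
    + by case: rawP => _ + _; exact.
    + by apply: negligibleS n2 => w [[_ nA] nn]; split => //; apply: contrapT => nA'; apply: nn.
    + by apply: negligibleS n1 => w [[_ nA] nn]; split => //; apply: contrapT => nA'; apply: nn.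
  - move=> A_ HA; have {HA}[A' HA'] := choice HA.
    exists (\bigcup_n A' n); split.
    + by case: rawP => _ _; apply => n; case: (HA' n).
    + apply: (@negligibleS _ _ _ _ (\bigcup_n (A_ n `\` A' n))).
        move=> w [[n _ An] nn]; exists n => //; split => // A'n.
        by apply: nn; exists n.
      by apply: negligible_bigcup => n; case: (HA' n).
    + apply: (@negligibleS _ _ _ _ (\bigcup_n (A' n `\` A_ n))).
        move=> w [[n _ An] nn]; exists n => //; split => // A'n.
        by apply: nn; exists n.
      by apply: negligible_bigcup => n; case: (HA' n).
move=> A [rA|[mA A0]].
  by exists A; split => //; rewrite setDv; exact: negligible_set0.
exists set0; split; first by case: rawP.
  by rewrite setD0; exact/negligibleP.
by rewrite set0D; exact: negligible_set0.
Qed.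

Lemma natural_filtration_comp_measurable d' (T' : measurableType d') x
    (f : T -> T') :
  measurable_fun [set: FT x] (f : FT x -> T') -> measurable_fun setT f.
Proof.
move=> mf _ B mB; rewrite setTI; apply: (@natural_filtration_measurable x).
by rewrite -[X in F x X]setTI; exact: mf.
Qed.

Lemma natural_filtration_le_measurable d' (T' : measurableType d') x y
    (f : T -> T') : x <= y ->
  measurable_fun [set: FT x] (f : FT x -> T') ->
  measurable_fun [set: FT y] (f : FT y -> T').
Proof.
move=> xy mf _ B mB; rewrite setTI; apply: (natural_filtration_nondecreasing xy).
by rewrite -[X in F x X]setTI; exact: mf.
Qed.

Lemma natural_filtration_indep_increment x y A B : 0 <= x -> x < y ->
  F x A -> measurable B ->
  P (A `&` increment W x y @^-1` B) = (P A * P (increment W x y @^-1` B))%E.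
Proof.
move=> x0 xy FA mB; have [A' [rA' n1 n2]] := natural_filtration_approx FA.
have mA := natural_filtration_measurable FA.
have mA' := raw_natural_filtration_measurable rA'.
have mI : measurable (increment W x y @^-1` B).
  rewrite -[X in measurable X]setTI; case: hW => mW _ _ _ _.
  have mx := mW x x0; have my := mW y (ltW (le_lt_trans x0 xy)).
  suff: measurable_fun setT (increment W x y) by apply.
  move/measurable_fun_pairP : mx => [mx1 mx2].
  move/measurable_fun_pairP : my => [my1 my2].
  by apply/measurable_fun_pairP; split; exact: measurable_funB.
have -> : P (A `&` increment W x y @^-1` B) = P (A' `&` increment W x y @^-1` B).
  apply: measure_eq_negligible; [exact: measurableI|exact: measurableI|..].
  - by apply: negligibleS n1 => w [[Aw Bw] nn]; split => // A'w; exact: nn.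
  - by apply: negligibleS n2 => w [[Aw Bw] nn]; split => // A'w; exact: nn.
have -> : P A = P A' by exact: measure_eq_negligible.
by case: hW => _ _ _ /(_ x y x0 xy A' B rA' mB) -> _.
Qed.

End natural_filtration.

(** * The correlated Brownian motion [Wrho] *)

Section Wrho.
Context d (T : measurableType d) (R : realType) (P : probability T R).
Variable W : R -> T -> R * R.
Hypothesis hW : brownian_motion2 P W.
Variable rho : R.
Hypothesis hrho : -1 <= rho <= 1.

Local Notation F := (natural_filtration P W).
Local Notation FT x := (g_sigma_algebraType (raw_natural_filtration W x `|`
  [set N | measurable N /\ P N = 0%E])).
Local Notation V := (Wrho rho W).

Lemma Wrho_adapted x y : 0 <= y -> y <= x ->
  measurable_fun [set: FT x] (V y : FT x -> R).
Proof.
move=> y0 yx.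
have mW : measurable_fun [set: FT x] (W y : FT x -> R * R).
  move=> _ B mB; rewrite setTI; apply: sub_sigma_algebra; left.
  by apply: sub_sigma_algebra; exists y; split => //; exists B.
move/measurable_fun_pairP : mW => [m1 m2].
by apply: measurable_funD; apply: measurable_funM.
Qed.

Lemma measurable_Wrho x : 0 <= x -> measurable_fun setT (V x).
Proof.
by move=> x0; exact: (natural_filtration_comp_measurable hW (Wrho_adapted x0 (lexx x))).
Qed.

Lemma Wrho_continuous w : {within Rplus, continuous (fun x => V x w)}.
Proof.
case: hW => _ _ /(_ w) /subspace_continuousP cW _ _.
apply/subspace_continuousP => x x0; have cWx := cW x x0.
apply: cvgD; apply: cvgM; first exact: cvg_cst.
- exact: (cvg_comp _ _ cWx (@cvg_fst _ _ _ _ _)).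
- exact: cvg_cst.
- exact: (cvg_comp _ _ cWx (@cvg_snd _ _ _ _ _)).
Qed.

Lemma Wrho0 : {ae P, forall w, V 0 w = 0}.
Proof.
case: hW => _ + _ _ _; apply: filterS => w W0.
by rewrite /Wrho W0/= !mulr0 addr0.
Qed.

Lemma Wrho_indep_increment x y A B : 0 <= x -> x < y -> F x A -> measurable B ->
  P (A `&` (fun w => V y w - V x w) @^-1` B) =
  (P A * P ((fun w => V y w - V x w)%R @^-1` B))%E.
Proof.
move=> x0 xy FA mB.
pose f (z : R * R) := Num.sqrt (1 - rho ^+ 2) * z.1 + rho * z.2.
have -> : (fun w => V y w - V x w) @^-1` B = increment W x y @^-1` (f @^-1` B).
  rewrite -comp_preimage.
  congr (fun g => g @^-1` B); apply/funext => w; rewrite /Wrho /f /increment /=.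
  by rewrite !mulrBr opprD addrACA.
have mf : measurable_fun setT f.
  by apply: measurable_funD; apply: measurable_funM.
apply: natural_filtration_indep_increment => //.
by rewrite -[X in measurable X]setTI; exact: mf.
Qed.

(** Fubini's theorem leaves two one-dimensional normal transforms, whose exponents add up to the
    stated one because [(1 - rho ^+ 2) + rho ^+ 2 = 1]. *)
Lemma Wrho_increment_mgf x y l : 0 <= x -> x < y ->
  (\int[P]_w (expR (l * (V y w - V x w))%R)%:E =
   (expR (l ^+ 2 * (y - x) / 2)%R)%:E)%E.
Proof.
move=> x0 xy; pose s := Num.sqrt (y - x); pose c := Num.sqrt (1 - rho ^+ 2).
have s0 : s != 0 by rewrite gt_eqF// sqrtr_gt0 subr_gt0.
have s2 : s ^+ 2 = y - x by rewrite sqr_sqrtr// subr_ge0 ltW.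
have c2 : c ^+ 2 = 1 - rho ^+ 2.
  by rewrite sqr_sqrtr//; case/andP: (hrho) => ? ?; nra.
pose R' : measurableType _ := measurableTypeR R.
pose f (z : R' * R') := (expR (l * (c * z.1 + rho * z.2)))%:E.
have mf : measurable_fun setT f.
  apply/measurable_EFinP/measurableT_comp => //; apply: measurable_funM => //.
  by apply: measurable_funD; apply: measurable_funM.
pose inc : T -> (R' * R')%type := increment W x y.
have minc : measurable_fun setT inc.
  case: hW => mW _ _ _ _.
  have /measurable_fun_pairP[mx1 mx2] := mW x x0.
  have /measurable_fun_pairP[my1 my2] := mW y (ltW (le_lt_trans x0 xy)).
  by apply/measurable_fun_pairP; split; exact: measurable_funB.
pose I : {mfun T >-> (R' * R')%type} := mfun_Sub (mem_set minc).
transitivity (\int[distribution P I]_z f z)%E.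
  rewrite ge0_integral_distribution//.
    apply: eq_integral => w _; rewrite /f /= /increment /= /Wrho; congr (expR _)%:E.
    by rewrite -/c; ring.
  by move=> z; rewrite lee_fin expR_ge0.
rewrite (eq_measure_integral (normal_prob 0 s \x normal_prob 0 s)%E); last first.
  by move=> A mA _; case: hW => _ _ _ _ /(_ x y x0 xy A mA).
rewrite fubini_tonelli1//; last by move=> z; rewrite lee_fin expR_ge0.
rewrite /fubini_F /f /=.
have mexp (k : R) : measurable_fun setT (fun z : R' => (expR (k * z))%:E).
  by apply/measurable_EFinP/measurableT_comp => //; exact: measurable_funM.
under eq_integral.
  move=> a _; under eq_integral do rewrite mulrDr expRD !mulrA EFinM.
  rewrite ge0_integralZl//.
  rewrite normal_mgf//.
  over.
rewrite ge0_integralZr//.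
rewrite normal_mgf// -EFinM -expRD -s2; congr (expR _)%:E.
by rewrite !exprMn c2; field.
Qed.

End Wrho.

Arguments Wrho_continuous {d T R P W} hW rho w.

(** Stands in for a limit [l -> 0], both in the computation of moments and in the two limits of
    Novikov's criterion. *)
Lemma small_multiples_eq0 {R : realFieldType} (a C : R) : 0 <= C -> 0 <= a ->
  (forall l, 0 < l -> l < 1 -> a <= l * C) -> a = 0.
Proof.
move=> C0 a0 H; apply/eqP; rewrite eq_le a0 andbT leNgt; apply/negP => {}a0.
(* This [l] is at most [1 / 2], and [l * C] is at most [a / 2]. *)
have l0 : 0 < a / (2 * (C + a)) by rewrite divr_gt0//; lra.
have l1 : a / (2 * (C + a)) < 1 by rewrite ltr_pdivrMr; lra.
have := H _ l0 l1; rewrite mulrAC ler_pdivlMr; nra.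
Qed.

(** * Exponential inequalities *)

Section exp_bounds.
Context {R : realType}.
Implicit Types u : R.

Lemma expR_sub1Dx_le u : expR u - 1 - u <= u ^+ 2 * expR `|u|.
Proof.
have h1 : expR u - 1 <= u * expR u.
  have := expR_ge1Dx (- u); rewrite expRN => H.
  have e0 := expR_gt0 u.
  have : (1 - u) * expR u <= (expR u)^-1 * expR u by rewrite ler_pM2r.
  by rewrite mulVf ?gt_eqF//; lra.
have [u0|u0] := leP 0 u.
  rewrite ger0_norm//.
  have : u * (expR u - 1) <= u * (u * expR u) by rewrite ler_wpM2l.
  by rewrite expr2 -mulrA; lra.
have e1 := expR_ge1Dx u.
have e2 : 1 <= expR `|u| by rewrite -[leLHS]expR0 ler_expR.
have : u * expR u - u <= u ^+ 2 by nra.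
have : u ^+ 2 <= u ^+ 2 * expR `|u| by rewrite ler_peMr// sqr_ge0.
lra.
Qed.

(** The derivative of the remainder is [expR u - 1 - u], bounded by [expR_sub1Dx_le]; the mean value
    theorem adds one factor [u]. *)
Lemma expR_taylor2_le u :
  `|expR u - 1 - u - u ^+ 2 / 2| <= `|u| ^+ 3 * expR `|u|.
Proof.
pose phi (v : R) := expR v - 1 - v - v ^+ 2 / 2.
have dphi (v : R) : is_derive v 1 phi (expR v - 1 - v).
  by apply: is_derive_eq; rewrite /GRing.scale/= ; field.
have cphi (a b : R) : {within `[a, b], continuous phi}.
  by apply: derivable_within_continuous => v _; exact: ex_derive.
have phi0 : phi 0 = 0 by rewrite /phi expR0; ring.
have bnd c : `|c| <= `|u| -> `|u * (expR c - 1 - c)| <= `|u| ^+ 3 * expR `|u|.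
  move=> cu; rewrite normrM (ger0_norm (x := expR c - 1 - c)); last first.
    by have := expR_ge1Dx c; lra.
  rewrite exprS -mulrA ler_wpM2l//; apply: (le_trans (expR_sub1Dx_le c)).
  rewrite -(normrX 2 u) (ger0_norm (sqr_ge0 u)) ler_pM ?sqr_ge0 ?expR_ge0 ?ler_expR//.
  by rewrite -(ger0_norm (sqr_ge0 c)) -(ger0_norm (sqr_ge0 u)) !normrX ler_pXn2r ?nnegrE.
rewrite -/(phi u).
have [u0|u0|<-] := ltgtP 0 u; last 1 first.
- by rewrite phi0 normr0 mulr_ge0// ?expR_ge0// exprn_ge0.
- have [c] := MVT u0 (fun v _ => dphi v) (cphi _ _).
  rewrite in_itv/= phi0 !subr0 => /andP[c0 cu] ->.
  by rewrite mulrC bnd// !gtr0_norm// ltW.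
- have [c] := MVT u0 (fun v _ => dphi v) (cphi _ _).
  rewrite in_itv/= phi0 !sub0r => /andP[c0 cu] /eqP.
  rewrite mulrN eqr_opp => /eqP ->.
  by rewrite mulrC bnd// !ltr0_norm// ?lerN2 ltW.
Qed.

(** The fourth power of [u / 4 <= expR (u / 4)], with [256 = 4 ^ 4]. *)
Lemma expr4_le_expR u : 0 <= u -> u ^+ 4 <= 256 * expR u.
Proof.
move=> u0; have : u / 4 <= expR (u / 4) by have := expR_ge1Dx (u / 4); lra.
move=> /(lerXn2r 4 _ _) => H.
have := H _ (expR_ge0 _); rewrite nnegrE => /(_ ltac:(lra)).
rewrite -expRM_natr divfK// (_ : (u / 4) ^+ 4 = u ^+ 4 / 256); last by field.
lra.
Qed.

Lemma expR_norm_le u : expR `|u| <= expR u + expR (- u).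
Proof.
have [u0|u0] := leP 0 u.
- by rewrite ger0_norm// lerDl expR_ge0.
- by rewrite ltr0_norm// lerDr expR_ge0.
Qed.

End exp_bounds.

Section real_integrable.
Context d (T : measurableType d) (R : realType) (P : {measure set T -> \bar R}).
Implicit Types f g : T -> R.

Local Notation integrable f := (P.-integrable setT (EFin \o f)).

Lemma integrable_le_norm f g : measurable_fun setT f ->
  integrable g -> (forall w, `|f w| <= g w) -> integrable f.
Proof.
move=> mf ig fg; apply: (le_integrable _ _ _ ig) => //.
  exact/measurable_EFinP.
move=> w _ /=; rewrite lee_fin (le_trans (fg w))//; exact: ler_norm.
Qed.

Lemma integrable_measurable f : integrable f -> measurable_fun setT f.
Proof. by move=> /measurable_int/measurable_EFinP. Qed.

Lemma integrableZ_EFin k f : integrable f -> integrable (fun w => k * f w).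
Proof. by move=> /(integrableZl measurableT k). Qed.

Lemma integrableD_EFin f g : integrable f -> integrable g ->
  integrable (fun w => f w + g w).
Proof. by move=> i1 i2; have := integrableD measurableT i1 i2. Qed.

Lemma integrableB_EFin f g : integrable f -> integrable g ->
  integrable (fun w => f w - g w).
Proof. by move=> i1 i2; have := integrableB measurableT i1 i2. Qed.

End real_integrable.

(** * Moments of a standard Gaussian variable from its Laplace transform *)

Section moments_from_mgf.
Context d (T : measurableType d) (R : realType) (P : probability T R).
Variable eta : T -> R.
Hypothesis meta : measurable_fun setT eta.
Hypothesis mgf : forall l : R,
  (\int[P]_w (expR (l * eta w))%:E = (expR (l ^+ 2 / 2))%:E)%E.

Local Notation integrable f := (P.-integrable setT (EFin \o f)).

Lemma integrable_expR_mgf l : integrable (fun w => expR (l * eta w)).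
Proof.
apply/integrableP; split.
  by apply/measurable_EFinP/measurableT_comp => //; exact: measurable_funM.
under eq_integral do rewrite /= ger0_norm ?expR_ge0//.
by rewrite mgf ltry.
Qed.

Let Rmgf l : \int[P]_w (expR (l * eta w)) = expR (l ^+ 2 / 2).
Proof. by rewrite /Rintegral mgf. Qed.

Let integrable_cst (k : R) : integrable (fun=> k).
Proof. exact: finite_measure_integrable_cst. Qed.

(** A common integrable majorant, up to constants, of the fourth power and of the Taylor remainder.
    The factor 2 leaves one exponential to absorb the powers of [eta] and one for the exponential in
    the remainder. *)
Let D w := expR (2 * eta w) + expR (- 2 * eta w).

Let iD : integrable D.
Proof. by apply: integrableD_EFin; exact: integrable_expR_mgf. Qed.

Let expR_norm_leD w : expR `|eta w| <= D w.
Proof.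
have /(le_trans _) := expR_norm_le (2 * eta w).
rewrite -mulNr; apply; rewrite ler_expR normrM ger0_norm//.
by have := normr_ge0 (eta w); lra.
Qed.

Let pow4_leD w : eta w ^+ 4 <= 256 * D w.
Proof.
have := expr4_le_expR (normr_ge0 (eta w)); rewrite -normrX ger0_norm; last first.
  by rewrite (_ : 4 = 2 * 2)%N// exprM sqr_ge0.
have := expR_norm_leD w; lra.
Qed.

Let cube_leD w : `|eta w| ^+ 3 * expR `|eta w| <= 257 * D w.
Proof.
have := expR_norm_le (2 * eta w); rewrite -mulNr -/(D w) normrM (ger0_norm (x := 2))//.
rewrite (_ : 2 * _ = `|eta w| * 2%:R) ?expRM_natr; last by rewrite mulrC.
have := expr4_le_expR (normr_ge0 (eta w)).
have : 1 <= expR `|eta w| by rewrite -[leLHS]expR0 ler_expR.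
set a := `|eta w|; have a0 : 0 <= a by exact: normr_ge0.
have a3 : a ^+ 3 <= 1 + a ^+ 4.
  have [a1|a1] := leP a 1.
    have : a ^+ 3 <= 1 by rewrite exprn_ile1.
    have : 0 <= a ^+ 4 by rewrite exprn_ge0.
    lra.
  have : a ^+ 3 <= a ^+ 4 by rewrite ler_weXn2l// ltW.
  lra.
move=> e1 a4 eD.
have : a ^+ 3 * expR a <= (257 * expR a) * expR a by rewrite ler_wpM2r ?expR_ge0//; lra.
by rewrite -mulrA -expr2; lra.
Qed.

Let m4 : measurable_fun setT (fun w => eta w ^+ 4).
Proof. exact: measurable_funX. Qed.

Lemma integrable_expr4 : integrable (fun w => eta w ^+ 4).
Proof.
apply: integrable_le_norm (integrableZ_EFin 256 iD) _ => // w.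
rewrite ger0_norm//; by rewrite (_ : 4 = 2 * 2)%N// exprM sqr_ge0.
Qed.

Lemma integrable_sqr : integrable (fun w => eta w ^+ 2).
Proof.
apply: integrable_le_norm (integrableD_EFin (integrable_cst 1) integrable_expr4) _.
  exact: measurable_funX.
move=> w; rewrite ger0_norm ?sqr_ge0// (_ : 4 = 2 * 2)%N// exprM.
by have := sqr_ge0 (eta w ^+ 2 - 1); have := sqr_ge0 (eta w); nra.
Qed.

Lemma integrable_id : integrable eta.
Proof.
apply: integrable_le_norm (integrableD_EFin (integrable_cst 1) integrable_sqr) _ => //.
move=> w; rewrite -(real_normK (num_real (eta w))).
by have := sqr_ge0 (`|eta w| - 1); have := sqr_ge0 (`|eta w|); nra.
Qed.

Let taylor_mgf l : `|l| <= 1 ->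
  `|expR (l ^+ 2 / 2) - 1 - l * (\int[P]_w eta w) - l ^+ 2 / 2 * (\int[P]_w (eta w ^+ 2))|
  <= `|l| ^+ 3 * (\int[P]_w (257 * D w)).
Proof.
move=> l1.
have i1 := integrable_expR_mgf l.
have i2 := integrable_cst 1.
have i3 := integrableZ_EFin l integrable_id.
have i4 := integrableZ_EFin (l ^+ 2 / 2) integrable_sqr.
have i12 := integrableB_EFin i1 i2.
have i123 := integrableB_EFin i12 i3.
have i1234 := integrableB_EFin i123 i4.
have i5 := integrableZ_EFin (`|l| ^+ 3) (integrableZ_EFin 257 iD).
have <- : \int[P]_w (expR (l * eta w) - 1 - l * eta w - l ^+ 2 / 2 * eta w ^+ 2) =
   expR (l ^+ 2 / 2) - 1 - l * (\int[P]_w eta w) - l ^+ 2 / 2 * (\int[P]_w (eta w ^+ 2)).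
  rewrite !RintegralB//  !RintegralZl// ?Rmgf ?Rintegral_cst//.
  - by rewrite [X in 1 * fine X](_ : _ = 1%E) ?mulr1//; exact: probability_setT.
  - exact: integrable_sqr.
  - exact: integrable_id.
rewrite -RintegralZl//; last exact: integrableZ_EFin.
apply: (le_trans (le_normr_Rintegral _ _)) => //.
apply: le_Rintegral => //.
  exact: integrable_norm.
move=> w _.
have := expR_taylor2_le (l * eta w); rewrite exprMn [X in _ - X]mulrAC => /le_trans; apply.
rewrite normrM exprMn -mulrA ler_wpM2l ?exprn_ge0//.
apply: le_trans (cube_leD w); rewrite ler_wpM2l ?exprn_ge0// ler_expR.
by rewrite ler_piMl.
Qed.

Let K := \int[P]_w (257 * D w).

Let K0 : 0 <= K.
Proof.
apply: Rintegral_ge0 => w _; rewrite mulr_ge0//.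
by rewrite addr_ge0 ?expR_ge0.
Qed.

(** The expansions at [l] and [- l] share their even terms, so their difference bounds [l] times the
    mean by [l ^+ 3 * K]; it remains to divide by [l] and let it shrink. *)
Lemma Rintegral_id_mgf : \int[P]_w eta w = 0.
Proof.
apply/normr0_eq0; apply: (small_multiples_eq0 K0) => // l l0 /ltW l1.
have := @taylor_mgf l; have := @taylor_mgf (- l).
rewrite normrN (gtr0_norm l0) sqrrN -/K !ler_norml.
move=> /(_ l1)/andP[H1 H2] /(_ l1)/andP[H3 H4].
have l3 : l ^+ 3 * K <= l * (l * K).
  rewrite (_ : l ^+ 3 * K = l * (l * (l * K))); last by ring.
  by rewrite ler_pM2l// ler_piMl// mulr_ge0// ltW.
have Hm : `|l * \int[P]_w eta w| <= l * (l * K).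
  by rewrite ler_norml; apply/andP; split; lra.
by move: Hm; rewrite normrM (gtr0_norm l0) (ler_pM2l l0) ler_norml.
Qed.

(** With mean zero, the quadratic term of the expansion is compared with that of
    [expR (l ^+ 2 / 2)]; all other terms are of order at least [l ^+ 3]. *)
Lemma Rintegral_sqr_mgf : \int[P]_w (eta w ^+ 2) = 1.
Proof.
apply/eqP; rewrite -subr_eq0 -normr_eq0; apply/eqP.
have C0 : 0 <= 2 * K + expR 1 by rewrite addr_ge0 ?expR_ge0// mulr_ge0.
apply: (small_multiples_eq0 C0) => // l l0 /ltW l1.
have := @taylor_mgf l; have := @taylor_mgf (- l).
rewrite normrN (gtr0_norm l0) sqrrN -/K Rintegral_id_mgf !ler_norml.
move=> /(_ l1)/andP[H1 H2] _.
set v := \int[P]_w _ in H1 H2 *.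
have l2 : l ^+ 2 <= 1 by rewrite exprn_ile1// ltW.
have l20 : 0 < l ^+ 2 by rewrite exprn_gt0.
have := expR_sub1Dx_le (l ^+ 2 / 2); have := expR_ge1Dx (l ^+ 2 / 2).
have eh : expR `|l ^+ 2 / 2| <= expR 1.
  by rewrite ler_expR ger0_norm; lra.
have e0 := expR_ge0 `|l ^+ 2 / 2|.
have l43 : (l ^+ 2 / 2) ^+ 2 * expR `|l ^+ 2 / 2| <= l ^+ 3 / 4 * expR 1.
  apply: ler_pM => //; first exact: sqr_ge0.
  rewrite (_ : (l ^+ 2 / 2) ^+ 2 = l ^+ 3 / 4 * l); last by field.
  by rewrite ler_piMr// mulr_ge0// exprn_ge0// ltW.
move=> A1 A2.
have l3 : l ^+ 2 * (l * (2 * K + expR 1)) = 2 * (l ^+ 3 * K) + l ^+ 3 * expR 1 by ring.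
have l3e : 0 <= l ^+ 3 * expR 1 by rewrite mulr_ge0 ?expR_ge0// exprn_ge0// ltW.
have Hv : `|l ^+ 2 * (v - 1)| <= l ^+ 2 * (l * (2 * K + expR 1)).
  by rewrite ler_norml; apply/andP; split; lra.
by move: Hv; rewrite normrM (gtr0_norm l20) (ler_pM2l l20) ler_norml.
Qed.

(** [512 = 256 * 2]: the majorant [256 * D] consists of two exponentials, each of mean [expR 2]. *)
Lemma Rintegral_expr4_mgf_le :
  \int[P]_w (eta w ^+ 4) <= 512 * expR 2.
Proof.
have iD2 := integrableZ_EFin 256 iD.
apply: (le_trans (le_Rintegral measurableT integrable_expr4 iD2 _)).
  by move=> w _; exact: pow4_leD.
rewrite RintegralZl// RintegralD//; [|exact: integrable_expR_mgf..].
by rewrite !Rmgf sqrrN (_ : 2 ^+ 2 / 2 = 2 :> R); [lra|field].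
Qed.

End moments_from_mgf.

(** * Rounding of times to a finite grid *)

Section grid.
Context {R : realType}.
Implicit Types (h t : R) (N l : nat).

(* This is [N] when all the grid points [l h], [l < N], are below [t]. *)
Definition grid_index N h t : nat := find (fun l => t <= l%:R * h) (iota 0 N).

Lemma grid_index_le N h t : (grid_index N h t <= N)%N.
Proof. by rewrite (leq_trans (find_size _ _))// size_iota. Qed.

(** When [t] is a stopping time, comparing its rounded index with [l] is thereby decided at time
    [l h]: this makes the weights of the discrete sums adapted. *)
Lemma grid_index_lt N h t l : 0 <= h -> (l < N)%N ->
  (l < grid_index N h t)%N = (l%:R * h < t).
Proof.
move=> h0 lN; apply/idP/idP => [lf|].
  by have := before_find 0%N lf; rewrite nth_iota// add0n ltNge => ->.
rewrite ltNge ltnNge; apply: contra => fl.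
have fN : (grid_index N h t < N)%N by exact: leq_ltn_trans lN.
have /(nth_find 0%N) : has (fun l => t <= l%:R * h) (iota 0 N).
  by rewrite has_find size_iota.
rewrite nth_iota// add0n => /le_trans; apply.
by rewrite ler_wpM2r// ler_nat.
Qed.

Lemma grid_index_ub N h t : 0 <= h -> 0 <= t ->
  (grid_index N h t)%:R * h <= t + h.
Proof.
move=> h0 t0; case E: (grid_index N h t) => [|l]; first by rewrite mul0r addr_ge0.
have lN : (l < N)%N by rewrite (leq_trans _ (grid_index_le N h t))// E.
have := grid_index_lt t h0 lN; rewrite E ltnSn => /esym/ltW.
by rewrite -natr1 mulrDl mul1r lerD2r.
Qed.

Lemma grid_index_lb N h t : 0 <= h -> t <= N%:R * h ->
  t <= (grid_index N h t)%:R * h.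
Proof.
move=> h0 tN; have := grid_index_le N h t.
rewrite leq_eqVlt => /predU1P[->//|fN].
by rewrite leNgt -(grid_index_lt _ h0 fN) ltnn.
Qed.

(** With the random endpoint moved into an indicator, the range of summation is deterministic and
    expectations can be taken term by term. *)
Lemma telescope_lt (V : zmodType) (f : nat -> V) a N : (a <= N)%N ->
  f a - f 0%N = \sum_(l < N) (if (l < a)%N then f l.+1 - f l else 0).
Proof.
move=> aN; rewrite -big_mkcond/= -(big_ord_widen N (fun l => f l.+1 - f l) aN).
rewrite -(big_mkord xpredT (fun l => f l.+1 - f l)).
by rewrite telescope_sumr.
Qed.

End grid.

Lemma cvgn_harmonic_dist {R : realType} (u : nat -> R) (l c : R) m : 0 <= c ->
  (forall k, (m <= k)%N -> `|l - u k| <= c * k.+1%:R^-1) -> u @ \oo --> l.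
Proof.
move=> c0 H; apply/cvgrPdist_lt => e e0.
near=> k.
apply: (le_lt_trans (H k _)); first by near: k; exists m.
have k0 : (0 : R) < k.+1%:R by rewrite ltr0n.
rewrite ltr_pdivrMr// mulrC -ltr_pdivrMr//.
near: k; exists (Num.truncn (c / e)) => // k /= ck.
by apply: (lt_le_trans (truncnS_gt _)); rewrite ler_nat ltnS.
Unshelve. all: by end_near. Qed.

(** * Processes evaluated at random times *)

Section subordination.
Context d (T : measurableType d) (R : realType).

Lemma measurable_set_le (f g : T -> R) : measurable_fun setT f ->
  measurable_fun setT g -> measurable [set w | f w <= g w].
Proof.
by move=> mf mg; rewrite -[X in measurable X]setTI; exact: measurable_fun_le.
Qed.

Lemma measurable_set_lt (f g : T -> R) : measurable_fun setT f ->
  measurable_fun setT g -> measurable [set w | f w < g w].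
Proof.
move=> mf mg; rewrite (_ : [set w | _] = ~` [set w | g w <= f w]).
  exact/measurableC/measurable_set_le.
by apply/seteqP; split => w /=; rewrite ltNge => /negP.
Qed.

Lemma measurable_fun_nat_index (k : T -> nat) (g : nat -> T -> R) :
  (forall j, measurable [set w | k w = j]) ->
  (forall j, measurable_fun setT (g j)) ->
  measurable_fun setT (fun w => g (k w) w).
Proof.
move=> mk mg _ B mB; rewrite setTI.
have -> : (fun w => g (k w) w) @^-1` B =
    \bigcup_j ([set w | k w = j] `&` (g j @^-1` B)).
  apply/seteqP; split => [w Bw|w [j _ [/= <-]]]//.
  by exists (k w).
apply: bigcupT_measurable => j; apply: measurableI => //.
by rewrite -[X in measurable X]setTI; exact: mg.
Qed.

(** [tau] is approximated from below by multiples of [1 / (n + 1)], so that only times not exceeding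
    some value of [tau] are sampled. For [tau] bounded by [x], the result is then measurable with
    respect to the events up to [x]. *)
Lemma measurable_subordinate (V : R -> T -> R) (tau : T -> R) :
  (forall w, {within Rplus, continuous (fun y => V y w)}) ->
  measurable_fun setT tau -> (forall w, 0 <= tau w) ->
  (forall y, 0 <= y -> (exists w, y <= tau w) -> measurable_fun setT (V y)) ->
  measurable_fun setT (fun w => V (tau w) w).
Proof.
move=> cV mtau tau0 mV.
pose k n w := Num.truncn (tau w * n.+1%:R).
pose q n w : R := (k n w)%:R * n.+1%:R^-1.
have n0 n : (0 : R) < n.+1%:R by rewrite ltr0n.
have tn0 n w : 0 <= tau w * n.+1%:R by rewrite mulr_ge0.
have q0 n w : 0 <= q n w by rewrite mulr_ge0.
have qtau n w : q n w <= tau w.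
  by rewrite /q ler_pdivrMr// truncn_le.
have tauq n w : tau w <= q n w + n.+1%:R^-1.
  rewrite /q -[X in _ + X]mul1r -mulrDl ler_pdivlMr// natr1.
  by rewrite ltW// truncnS_gt.
apply: (@measurable_fun_cvg _ _ _ _ (fun n w => V (q n w) w)); last first.
  move=> w _; apply: (Rplus_continuous_cvg (cV w)) => //.
  apply: (@cvgn_harmonic_dist _ _ _ 1 0) => // n _.
  by rewrite mul1r ger0_norm ?subr_ge0// lerBlDl.
move=> n.
(* The default [cst 0] covers times beyond the range of [tau], which the index [k n] never
   selects. *)
pose g j : T -> R := if pselect (exists w, j%:R * n.+1%:R^-1 <= tau w)
  then V (j%:R * n.+1%:R^-1) else cst 0.
rewrite (_ : (fun w => V (q n w) w) = (fun w => g (k n w) w)); last first.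
  apply/funext => w; rewrite /g; case: pselect => // nex; exfalso.
  by apply: nex; exists w; exact: qtau.
apply: measurable_fun_nat_index.
  move=> j; rewrite (_ : [set w | _] =
    [set w | j%:R <= tau w * n.+1%:R] `&` [set w | tau w * n.+1%:R < j.+1%:R]).
    have mt : measurable_fun setT (fun w => tau w * n.+1%:R) by exact: measurable_funM.
    by apply: measurableI; [exact: measurable_set_le|exact: measurable_set_lt].
  apply/seteqP; split => w /=.
    by move=> <-; split; [rewrite truncn_le// |exact: truncnS_gt].
  move=> [jl jr]; apply/eqP; by rewrite /k truncn_eq// jl.
move=> j; rewrite /g; case: pselect => // ex; exact: mV.
Qed.

End subordination.

Lemma fatou_le d (T : measurableType d) (R : realType)
    (mu : {measure set T -> \bar R}) (f : nat -> T -> R) (g : T -> R)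
    (c : nat -> R) (l : R) :
  (forall n, measurable_fun setT (f n)) -> (forall n w, 0 <= f n w) ->
  (forall w, (fun n => f n w) @ \oo --> g w) ->
  (forall n, (\int[mu]_w (f n w)%:E <= (c n)%:E)%E) -> c @ \oo --> l ->
  (\int[mu]_w (g w)%:E <= l%:E)%E.
Proof.
move=> mf f0 fg fc cl.
have H := @fatou _ _ _ mu setT measurableT (fun n w => (f n w)%:E)
  (fun n => (measurable_EFinP _ _).2 (mf n)) (fun n w _ => f0 n w).
have -> : (\int[mu]_w (g w)%:E = \int[mu]_w limn_einf (fun n => (f n w)%:E))%E.
  apply: eq_integral => w _; apply/esym.
  have : (fun n => (f n w)%:E) @ \oo --> (g w)%:E.
    by apply: cvg_EFin; [exact: nearW|exact: fg].
  by move=> /cvg_limn_einf_sup[].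
apply: (le_trans H); apply/lee_addgt0Pr => e e0.
rewrite limn_einf_lim; apply: lime_le; first exact: is_cvg_einfs.
have : \forall n \near \oo, c n < l + e.
  by move/cvgrPdist_lt : cl => /(_ e e0); apply: filterS => n; rewrite ltr_norml; lra.
apply: filterS => n cn; rewrite -EFinD.
apply: le_trans (le_trans (fc n) _); last by rewrite lee_fin ltW.
by apply: ereal_inf_lbound; exists n => /=.
Qed.

Section Rintegral_sums.
Context d (T : measurableType d) (R : realType) (P : {measure set T -> \bar R}).

Local Notation integrable f := (P.-integrable setT (EFin \o f)).

Lemma integrable_sum_EFin N (g : nat -> T -> R) :
  (forall l, (l < N)%N -> integrable (g l)) ->
  integrable (fun w => \sum_(l < N) g l w).
Proof.
elim: N => [_|N IH ig].
  by under eq_fun do rewrite big_ord0; exact: integrable0.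
under eq_fun do rewrite big_ord_recr/=.
by apply: integrableD_EFin; [apply: IH => l lN; apply: ig; exact: ltnW|exact: ig].
Qed.

Lemma Rintegral_sum N (g : nat -> T -> R) :
  (forall l, (l < N)%N -> integrable (g l)) ->
  \int[P]_w (\sum_(l < N) g l w) = \sum_(l < N) \int[P]_w g l w.
Proof.
elim: N => [_|N IH ig].
  by rewrite big_ord0; under eq_Rintegral do rewrite big_ord0; rewrite /Rintegral integral0.
rewrite big_ord_recr/= -IH => [|l lN]; last by apply: ig; exact: ltnW.
under eq_Rintegral do rewrite big_ord_recr/=.
rewrite RintegralD//; last exact: ig.
by apply: integrable_sum_EFin => l lN; apply: ig; exact: ltnW.
Qed.

Lemma Rintegral_ae_eq (f g : T -> R) : measurable_fun setT f ->
  measurable_fun setT g -> {ae P, forall w, f w = g w} ->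
  \int[P]_w f w = \int[P]_w g w.
Proof.
move=> mf mg fg; congr fine; apply: ae_eq_integral => //; [exact/measurable_EFinP..|].
by apply: filterS fg => w -> _.
Qed.

Lemma integrable_ae_eq (f g : T -> R) : measurable_fun setT f ->
  measurable_fun setT g -> {ae P, forall w, f w = g w} ->
  integrable f -> integrable g.
Proof.
move=> mf mg fg /integrableP[_ fi]; apply/integrableP.
split; first exact/measurable_EFinP.
apply: le_lt_trans fi; apply: ae_ge0_le_integral => //.
- by do 2 apply: measurableT_comp => //.
- by do 2 apply: measurableT_comp => //.
- by apply: filterS fg => w fgw _ /=; rewrite fgw.
Qed.

Lemma EFin_Rintegral (f : T -> R) : integrable f ->
  ((\int[P]_w f w)%:E = \int[P]_w (f w)%:E)%E.
Proof. by move=> fi; rewrite fineK// integrable_fin_num. Qed.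

Lemma ge0_integrable_le (f : T -> R) (c : R) : measurable_fun setT f ->
  (forall w, 0 <= f w) -> (\int[P]_w (f w)%:E <= c%:E)%E ->
  integrable f /\ \int[P]_w f w <= c.
Proof.
move=> mf f0 fc.
have fi : integrable f.
  apply/integrableP; split; first exact/measurable_EFinP.
  under eq_integral do rewrite /= ger0_norm//.
  exact: le_lt_trans fc (ltry _).
by split => //; rewrite -lee_fin EFin_Rintegral.
Qed.

End Rintegral_sums.

Section stopping.
Context d (T : measurableType d) (R : realType).

Definition stopping_time (F : R -> set (set T)) (tau : T -> R) : Prop :=
  [/\ measurable_fun setT tau, forall w, 0 <= tau w &
      forall x, 0 <= x -> F x [set w | tau w <= x]].

End stopping.

(** * The exponential martingale along a grid *)

Section exponential_martingale.
Context d (T : measurableType d) (R : realType) (P : probability T R).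
Variable W : R -> T -> R * R.
Hypothesis hW : brownian_motion2 P W.
Variable rho : R.
Hypothesis hrho : -1 <= rho <= 1.

Local Notation F := (natural_filtration P W).
Local Notation FT x := (g_sigma_algebraType (raw_natural_filtration W x `|`
  [set N | measurable N /\ P N = 0%E])).
Local Notation V := (Wrho rho W).
Local Notation integrable f := (P.-integrable setT (EFin \o f)).

Lemma Wrho_increment_indep_mul x y (U : T -> R) (g : R -> R) :
  0 <= x -> x < y -> measurable_fun [set: FT x] (U : FT x -> R) ->
  integrable U -> measurable_fun setT g ->
  integrable (fun w => g (V y w - V x w)) ->
  integrable (fun w => U w * g (V y w - V x w)) /\
  \int[P]_w (U w * g (V y w - V x w)) =
  \int[P]_w U w * \int[P]_w g (V y w - V x w).
Proof.
move=> x0 xy mU iU mg ig.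
have mU' := natural_filtration_comp_measurable hW mU.
have mxi : measurable_fun setT (fun w => V y w - V x w).
  by apply: measurable_funB; apply: (measurable_Wrho hW) => //; lra.
have ind (A B : set R) : measurable A -> measurable B ->
    P (U @^-1` A `&` (fun w => V y w - V x w) @^-1` B) =
    (P (U @^-1` A) * P ((fun w => V y w - V x w)%R @^-1` B))%E.
  move=> mA mB; apply: (Wrho_indep_increment hW) => //.
  by rewrite -[X in F x X]setTI; exact: mU.
split; first exact: integrable_indep_mul.
exact: Rintegral_indep_mul.
Qed.

(** The exponential martingale of [l * Wrho]; the price is its value with [l = 1] at the random time
    [X t]. *)
Definition expmart (l x : R) (w : T) : R := expR (l * V x w - l ^+ 2 / 2 * x).

Lemma expmart_adapted l x y : 0 <= y -> y <= x ->
  measurable_fun [set: FT x] (expmart l y : FT x -> R).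
Proof.
move=> y0 yx; apply: measurableT_comp => //; apply: measurable_funB => //.
by apply: measurable_funM => //; exact: Wrho_adapted.
Qed.

Lemma measurable_expmart l x : 0 <= x -> measurable_fun setT (expmart l x).
Proof.
by move=> x0; exact: (natural_filtration_comp_measurable hW (expmart_adapted l x0 (lexx x))).
Qed.

Let gexp l (h z : R) := expR (l * z - l ^+ 2 / 2 * h).

Let mgexp l h : measurable_fun setT (gexp l h).
Proof.
by apply: measurableT_comp => //; apply: measurable_funB => //; exact: measurable_funM.
Qed.

Let gexp_mean l x y : 0 <= x -> x < y ->
  integrable (fun w => gexp l (y - x) (V y w - V x w)) /\
  \int[P]_w gexp l (y - x) (V y w - V x w) = 1.
Proof.
move=> x0 xy.
have mxi : measurable_fun setT (fun w => V y w - V x w).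
  by apply: measurable_funB; apply: (measurable_Wrho hW) => //; lra.
have E : (\int[P]_w (gexp l (y - x) (V y w - V x w))%:E = 1)%E.
  under eq_integral do rewrite /gexp expRD mulrC EFinM.
  rewrite ge0_integralZl//.
  - by rewrite (Wrho_increment_mgf hW)// -EFinM -expRD mulrAC addNr expR0.
  - apply/measurable_EFinP/measurableT_comp => //; exact: measurable_funM.
have := @ge0_integrable_le _ _ _ P (fun w => gexp l (y - x) (V y w - V x w)) 1.
case=> //; first exact: measurableT_comp.
- by move=> w; exact: expR_ge0.
- by rewrite E.
- by move=> i _; split => //; rewrite /Rintegral E.
Qed.

Lemma expmart_split l x y w :
  expmart l y w = expmart l x w * gexp l (y - x) (V y w - V x w).
Proof. by rewrite /expmart /gexp -expRD; congr expR; ring. Qed.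

Lemma expmart_mean l x : 0 <= x ->
  integrable (expmart l x) /\ \int[P]_w expmart l x w = 1.
Proof.
have m0 : measurable_fun setT (expmart l 0) by exact: measurable_expmart.
have ae0 : {ae P, forall w, expmart l 0 w = 1}.
  have := Wrho0 hW rho; apply: filterS => w V0.
  by rewrite /expmart V0 !mulr0 subr0 expR0.
rewrite le_eqVlt => /predU1P[<-|x0].
  split.
    apply: (@integrable_ae_eq _ _ _ P (cst 1)) => //.
      by apply: filterS ae0 => w ->.
    exact: finite_measure_integrable_cst.
  rewrite (@Rintegral_ae_eq _ _ _ P _ (cst 1))// Rintegral_cst// mul1r.
  by rewrite [X in fine X](_ : _ = 1%E)//; exact: probability_setT.
have [i E] := gexp_mean l (lexx 0) x0.
have mx := measurable_expmart l (ltW x0).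
have ae1 : {ae P, forall w, gexp l (x - 0) (V x w - V 0 w) = expmart l x w}.
  by apply: filterS ae0 => w e0; rewrite (expmart_split l 0) e0 mul1r.
have mg := integrable_measurable i.
split; first exact: (integrable_ae_eq mg).
by rewrite -E; apply: Rintegral_ae_eq => //; apply: filterS ae1 => w ->.
Qed.

Lemma expmart_increment l x y (U : T -> R) : 0 <= x -> x < y ->
  measurable_fun [set: FT x] (U : FT x -> R) -> (forall w, `|U w| <= 1) ->
  [/\ integrable (fun w => U w * expmart l x w),
      integrable (fun w => U w * expmart l y w) &
      \int[P]_w (U w * expmart l y w) = \int[P]_w (U w * expmart l x w)].
Proof.
move=> x0 xy mU U1; have [ix _] := expmart_mean l x0.
have mx := expmart_adapted l x0 (lexx x).
have mUx : measurable_fun [set: FT x] ((fun w => U w * expmart l x w) : FT x -> R).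
  exact: measurable_funM.
have iUx : integrable (fun w => U w * expmart l x w).
  apply: integrable_le_norm ix _.
    exact: (natural_filtration_comp_measurable hW mUx).
  by move=> w; rewrite normrM [`|expmart _ _ _|]ger0_norm ?expR_ge0// ler_piMl// expR_ge0.
have [ig Eg] := gexp_mean l x0 xy.
have [i E] := Wrho_increment_indep_mul x0 xy mUx iUx (mgexp l (y - x)) ig.
have eqf : (fun w => U w * expmart l x w * gexp l (y - x) (V y w - V x w)) =
    (fun w => U w * expmart l y w).
  by apply/funext => w; rewrite (expmart_split l x y) mulrA.
rewrite eqf in i; rewrite eqf Eg mulr1 in E.
by split.
Qed.

(** The value at the rounded time is the initial value plus the increments over [[j h, (j + 1) h]]
    weighted by the indicator of [j h < tau], known at [j h]; each has mean zero by
    [expmart_increment]. The cutoff [N] keeps the sum finite however large [tau] is. *)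
Lemma expmart_grid_stopping l tau N h : stopping_time F tau -> 0 < h ->
  integrable (fun w => expmart l ((grid_index N h (tau w))%:R * h) w) /\
  \int[P]_w expmart l ((grid_index N h (tau w))%:R * h) w = 1.
Proof.
move=> [mtau tau0 Ftau] h0.
pose U (j : nat) (w : T) : R := (j%:R * h < tau w)%R%:R.
have jh0 j : 0 <= j%:R * h by rewrite mulr_ge0// ltW.
have jhS j : j%:R * h < j.+1%:R * h by rewrite ltr_pM2r// ltr_nat.
have mU j : measurable_fun [set: FT (j%:R * h)] (U j : FT (j%:R * h) -> R).
  rewrite (_ : U j = \1_(~` [set w | tau w <= j%:R * h])); last first.
    apply/funext => w; rewrite /U indicE; congr (nat_of_bool _)%:R.
    by rewrite ltNge; apply/idP/idP => [/negP H|/set_mem/negP//]; exact/mem_set.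
  apply: measurable_indic; apply: measurableC; exact: Ftau.
have U1 j w : `|U j w| <= 1 by rewrite /U; case: ltP; rewrite ?normr0 ?normr1.
have Hincr j := expmart_increment l (jh0 j) (jhS j) (mU j) (U1 j).
pose g j w := U j w * expmart l (j.+1%:R * h) w - U j w * expmart l (j%:R * h) w.
have ig j : integrable (g j).
  by case: (Hincr j) => i1 i2 _; exact: integrableB_EFin.
have Eg j : \int[P]_w g j w = 0.
  by case: (Hincr j) => i1 i2 E; rewrite RintegralB// E subrr.
have [i0 E0] := expmart_mean l (lexx 0).
have -> : (fun w => expmart l ((grid_index N h (tau w))%:R * h) w) =
    (fun w => expmart l 0 w + \sum_(j < N) g j w).
  apply/funext => w.
  have := telescope_lt (fun j => expmart l (j%:R * h) w)
    (grid_index_le N h (tau w)).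
  rewrite mul0r => /(canRL (subrK _)) ->; rewrite addrC; congr (_ + _).
  apply: eq_bigr => j _; rewrite (grid_index_lt _ (ltW h0))// /g /U.
  by case: ltP => _; rewrite ?mul1r ?mul0r ?subrr.
have is_ : integrable (fun w => \sum_(j < N) g j w) by exact: integrable_sum_EFin.
split; first exact: integrableD_EFin.
by rewrite RintegralD// E0 Rintegral_sum// big1 ?addr0.
Qed.

End exponential_martingale.

(** The tangent to the exponential at the mean [m] lies below its graph at [u] and at [v]. *)
Lemma expR_convex {R : realType} (l u v : R) : 0 <= l <= 1 ->
  expR (l * u + (1 - l) * v) <= l * expR u + (1 - l) * expR v.
Proof.
move=> /andP[l0 l1]; set m := l * u + _.
have tangent (z : R) : expR m * (1 + (z - m)) <= expR z.
  have -> : expR z = expR m * expR (z - m) by rewrite -expRD addrC subrK.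
  rewrite ler_wpM2l ?expR_ge0//.
  exact: expR_ge1Dx.
have := ler_wpM2l l0 (tangent u).
have := ler_wpM2l (ltac:(lra) : 0 <= 1 - l) (tangent v).
have : l * (expR m * (1 + (u - m))) + (1 - l) * (expR m * (1 + (v - m))) = expR m.
  by rewrite /m; ring.
lra.
Qed.

Section grid_approximation.
Context {R : realType}.

(** Mesh [1 / (k + 1)] with [(k + 1) ^ 2] steps: the horizon [k + 1] grows too, so that unbounded
    times are approximated. *)
Definition grid_approx (t : R) (k : nat) : R :=
  (grid_index (k.+1 ^ 2) k.+1%:R^-1 t)%:R * k.+1%:R^-1.

Let k0 (k : nat) : (0 : R) < k.+1%:R^-1. Proof. by rewrite invr_gt0 ltr0n. Qed.

Lemma grid_approx_ge0 t k : 0 <= grid_approx t k.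
Proof. by rewrite mulr_ge0// ltW. Qed.

Lemma grid_approx_le t k : 0 <= t -> grid_approx t k <= t + 1.
Proof.
move=> t0; apply: (le_trans (grid_index_ub _ (ltW (k0 k)) t0)).
by rewrite lerD2l invf_le1// ?ler1n ?ltr0n.
Qed.

Lemma grid_approx_cvg t : 0 <= t -> grid_approx t @ \oo --> t.
Proof.
move=> t0; apply: (@cvgn_harmonic_dist _ _ _ 1 (Num.truncn t)) => // k tk.
have lek : t <= k.+1%:R.
  by rewrite ltW// (lt_le_trans (truncnS_gt t))// ler_nat ltnS.
have := grid_index_ub (k.+1 ^ 2) (ltW (k0 k)) t0.
have := @grid_index_lb _ (k.+1 ^ 2) _ t (ltW (k0 k)).
rewrite natrX expr2 mulfK ?pnatr_eq0// -/(grid_approx t k) => /(_ lek).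
rewrite mul1r ler_norml; have := k0 k; set h := _^-1 => h0 lo hi; apply/andP; split; lra.
Qed.

End grid_approximation.

(** * Novikov's criterion *)

Section novikov.
Context d (T : measurableType d) (R : realType) (P : probability T R).
Variable W : R -> T -> R * R.
Hypothesis hW : brownian_motion2 P W.
Variable rho : R.
Hypothesis hrho : -1 <= rho <= 1.

Local Notation F := (natural_filtration P W).
Local Notation V := (Wrho rho W).
Local Notation M := (expmart W rho).
Local Notation integrable f := (P.-integrable setT (EFin \o f)).

Lemma expmart_continuous l w : {within Rplus, continuous (fun x => M l x w)}.
Proof.
apply/subspace_continuousP => x x0.
have /subspace_continuousP/(_ x x0) cV := Wrho_continuous hW rho w.
apply: (cvg_comp _ expR); last exact: continuous_expR.
apply: cvgB; apply: cvgM; [exact: cvg_cst|exact: cV|exact: cvg_cst|].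
exact: cvg_within.
Qed.
Arguments expmart_continuous : clear implicits.

Lemma measurable_expmart_subordinate l (tau : T -> R) :
  measurable_fun setT tau -> (forall w, 0 <= tau w) ->
  measurable_fun setT (fun w => M l (tau w) w).
Proof.
move=> mtau tau0; apply: measurable_subordinate => //.
- by move=> w; exact: (expmart_continuous l w).
- by move=> y y0 _; exact: (measurable_expmart hW).
Qed.

Variable tau : T -> R.
Hypothesis stau : stopping_time F tau.

Let mtau : measurable_fun setT tau. Proof. by case: stau. Qed.
Let tau0 w : 0 <= tau w. Proof. by case: stau. Qed.

Let q k w := grid_approx (tau w) k.

Let Mq_mean l k : integrable (fun w => M l (q k w) w) /\
  \int[P]_w M l (q k w) w = 1.
Proof.
by apply: (expmart_grid_stopping hW).
Qed.

Let Mq_cvg l w : (fun k => M l (q k w) w) @ \oo --> M l (tau w) w.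
Proof.
apply: (Rplus_continuous_cvg (f := fun x => M l x w)) => //.
- exact: (expmart_continuous l w).
- by move=> k; exact: grid_approx_ge0.
- exact: grid_approx_cvg.
Qed.

Lemma expmart_stopped_le1 l : integrable (fun w => M l (tau w) w) /\
  \int[P]_w M l (tau w) w <= 1.
Proof.
apply: ge0_integrable_le.
- exact: measurable_expmart_subordinate.
- by move=> w; exact: expR_ge0.
apply: (@fatou_le _ _ _ P (fun k w => M l (q k w) w) _ (fun=> 1)).
- by move=> k; case: (Mq_mean l k) => /integrable_measurable.
- by move=> k w; exact: expR_ge0.
- exact: Mq_cvg.
- by move=> k; case: (Mq_mean l k) => i <-; rewrite EFin_Rintegral.
- exact: cvg_cst.
Qed.

Hypothesis exp_tau : (\int[P]_w (expR (tau w / 2))%:E < +oo)%E.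

Let iexp_tau : integrable (fun w => expR (tau w / 2)).
Proof.
apply/integrableP; split.
  by apply/measurable_EFinP/measurableT_comp => //; exact: measurable_funM.
by under eq_integral do rewrite /= ger0_norm ?expR_ge0//.
Qed.

(** This is [expR ((tau w + 1) / 2)]: a rounded time exceeds [tau] by at most one mesh, hence by at
    most 1. *)
Let D w := expR (1 / 2) * expR (tau w / 2).

Let iD : integrable D. Proof. exact: integrableZ_EFin. Qed.

(* Young's inequality: the factor in front of the martingale with parameter
   [1] can be made arbitrarily small, which gives the uniform integrability
   of the martingales with parameter [l < 1].                               *)
Let expmart_young l c x w t : 0 < l < 1 -> 0 <= x ->
  x <= t + 1 ->
  M l x w <= l * expR (- c) * M 1 x w
    + (1 - l) * expR (l * c / (1 - l)) * (expR (1 / 2) * expR (t / 2)).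
Proof.
move=> /andP[l0 l1] x0 xt.
(* [c] cancels in [l * u + (1 - l) * v], and this exponent exceeds that of [M l] by
   [(1 - l) * (t + 1 - l * x) / 2], which is nonnegative. *)
pose u := V x w - x / 2 - c; pose v := l * c / (1 - l) + (t + 1) / 2.
have l1' : 1 - l != 0 by rewrite gt_eqF// subr_gt0.
apply: (@le_trans _ _ (expR (l * u + (1 - l) * v))).
  rewrite ler_expR /u /v.
  have -> : l * (V x w - x / 2 - c) + (1 - l) * (l * c / (1 - l) + (t + 1) / 2) =
      l * V x w - l * (x / 2) + (1 - l) * ((t + 1) / 2) by field.
  have : (1 - l) * (l * (x / 2)) <= (1 - l) * ((t + 1) / 2).
    rewrite ler_pM2l ?subr_gt0//; nra.
  nra.
apply: (le_trans (expR_convex _ _ _)); first by apply/andP; split; lra.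
rewrite /u /v /expmart !mul1r expr1n -!mulrA -!expRD lerD// ler_wpM2l ?ler_expR; lra.
Qed.

Let Rint_M1 k : \int[P]_w M 1 (q k w) w = 1. Proof. by case: (Mq_mean 1 k). Qed.

(** Fatou's lemma for the nonnegative [A * M 1 + B * D - M l] at the grid times, where both
    martingales have mean 1: in the limit the [D] terms cancel and the mean of [M l] at [tau] is
    bounded from below. *)
Let expmart_stopped_lb l c : 0 < l < 1 ->
  1 - l * expR (- c) <= \int[P]_w M l (tau w) w.
Proof.
move=> l01; set A := l * expR (- c); set B := (1 - l) * expR (l * c / (1 - l)).
have A0 : 0 <= A by rewrite mulr_ge0 ?expR_ge0//; lra.
have [iZ Z1] := expmart_stopped_le1 1.
have [iY Y1] := expmart_stopped_le1 l.
pose f k w := A * M 1 (q k w) w + B * D w - M l (q k w) w.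
pose g w := A * M 1 (tau w) w + B * D w - M l (tau w) w.
have if_ k : integrable (f k).
  apply: integrableB_EFin; last by case: (Mq_mean l k).
  by apply: integrableD_EFin; apply: integrableZ_EFin => //; case: (Mq_mean 1 k).
have Ef k : \int[P]_w f k w = A + B * (\int[P]_w D w) - 1.
  have [i1 E1] := Mq_mean 1 k; have [i2 E2] := Mq_mean l k.
  have i3 := integrableZ_EFin A i1; have i4 := integrableZ_EFin B iD.
  rewrite RintegralB//; last exact: integrableD_EFin.
  by rewrite RintegralD// !RintegralZl// E1 E2 mulr1.
have ig : integrable g.
  apply: integrableB_EFin => //.
  by apply: integrableD_EFin; exact: integrableZ_EFin.
have : (\int[P]_w (g w)%:E <= (A + B * (\int[P]_w D w) - 1)%:E)%E.
  apply: (@fatou_le _ _ _ P f _ (fun=> A + B * (\int[P]_w D w) - 1)).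
  - by move=> k; exact: integrable_measurable.
  - move=> k w; rewrite subr_ge0; apply: expmart_young => //.
      exact: grid_approx_ge0.
    exact: grid_approx_le.
  - move=> w; apply: cvgB; last exact: Mq_cvg.
    apply: cvgD; last exact: cvg_cst.
    by apply: cvgM; [exact: cvg_cst|exact: Mq_cvg].
  - by move=> k; rewrite -(Ef k) EFin_Rintegral.
  - exact: cvg_cst.
rewrite -EFin_Rintegral// lee_fin.
have i3 := integrableZ_EFin A iZ; have i4 := integrableZ_EFin B iD.
rewrite RintegralB//; last exact: integrableD_EFin.
rewrite RintegralD// !RintegralZl//.
have : 0 <= A * (\int[P]_w M 1 (tau w) w).
  by rewrite mulr_ge0// Rintegral_ge0// => w _; exact: expR_ge0.
lra.
Qed.

Let expmart_stopped_eq1 l : 0 < l < 1 -> \int[P]_w M l (tau w) w = 1.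
Proof.
move=> l01; have [iY Y1] := expmart_stopped_le1 l.
suff : 1 - \int[P]_w M l (tau w) w = 0 by lra.
apply: (@small_multiples_eq0 _ _ 1) => //; first by lra.
(* The choice [c = - ln e] turns the defect [l * expR (- c)] into [l * e]. *)
move=> e e0 e1; have := expmart_stopped_lb (- ln e) l01.
rewrite opprK lnK ?posrE//.
have : l * e <= e by rewrite ler_piMl//; [exact: ltW|lra].
lra.
Qed.

(** Convexity, with weight [1 - s] on the exponent of [M 1] and [s] on [tau / 2], majorizes
    [M (1 - s)], the exponent having [s ^+ 2 * tau / 2] to spare. Taking means bounds 1 by [1 - s]
    times the mean of [M 1] plus [s] times that of [expR (tau / 2)], so the defect is of order
    [s]. *)
Theorem novikov : integrable (fun w => M 1 (tau w) w) /\
  \int[P]_w M 1 (tau w) w = 1.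
Proof.
have [iZ Z1] := expmart_stopped_le1 1; split => //.
have E0 : 0 <= \int[P]_w expR (tau w / 2).
  by apply: Rintegral_ge0 => w _; exact: expR_ge0.
suff : 1 - \int[P]_w M 1 (tau w) w = 0 by lra.
apply: (@small_multiples_eq0 _ _ (\int[P]_w expR (tau w / 2))) => //; first by lra.
move=> s s0 s1; have l01 : 0 < 1 - s < 1 by apply/andP; split; lra.
have [iY _] := expmart_stopped_le1 (1 - s).
have i1 := integrableZ_EFin (1 - s) iZ; have i2 := integrableZ_EFin s iexp_tau.
have i12 := integrableD_EFin i1 i2.
have : \int[P]_w M (1 - s) (tau w) w <=
    \int[P]_w ((1 - s) * M 1 (tau w) w + s * expR (tau w / 2)).
  apply: le_Rintegral => // w _.
  have := @expR_convex R (1 - s) (V (tau w) w - tau w / 2) (tau w / 2)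
    (ltac:(apply/andP; split; lra)).
  rewrite (_ : 1 - (1 - s) = s); last by ring.
  rewrite (_ : expR (V (tau w) w - tau w / 2) = M 1 (tau w) w); last first.
    by rewrite /expmart; congr expR; field.
  move=> H; apply: le_trans H; rewrite ler_expR -subr_ge0.
  set v := V _ _; rewrite (_ : _ - _ = s ^+ 2 * tau w / 2); last by field.
  by apply: divr_ge0 => //; apply: mulr_ge0; rewrite ?sqr_ge0.
rewrite expmart_stopped_eq1// RintegralD// !RintegralZl//.
have Z0 : 0 <= \int[P]_w M 1 (tau w) w.
  by apply: Rintegral_ge0 => w _; exact: expR_ge0.
nra.
Qed.

End novikov.

Arguments expmart_continuous {d T R P W} hW rho l w.

(** A discrete Ito formula for the compensated square of the increment since index [a]: each step
    contributes its own compensated square and a cross term with the past. *)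
Lemma grid_square_telescope {R : comPzRingType} (f : nat -> R) (h : R) a b N :
  (a <= b)%N -> (b <= N)%N ->
  (f b - f a) ^+ 2 - (b%:R - a%:R) * h =
  \sum_(l < N) (if (l < b)%N && ~~ (l < a)%N then
    (f l.+1 - f l) ^+ 2 - h + 2 * (f l.+1 - f l) * (f l - f a) else 0).
Proof.
move=> ab bN; pose G l := (f l - f a) ^+ 2 - (l%:R - a%:R) * h.
have Ga : G a = 0 by rewrite /G !subrr; ring.
transitivity ((G b - G 0%N) - (G a - G 0%N)); first by rewrite Ga /G; ring.
rewrite (telescope_lt G bN) (telescope_lt G (leq_trans ab bN)) -sumrB.
apply: eq_bigr => l _.
have GS : G l.+1 - G l = (f l.+1 - f l) ^+ 2 - h + 2 * (f l.+1 - f l) * (f l - f a).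
  by rewrite /G -natr1; ring.
case: ltnP => [lb|bl] /=; case: ltnP => [la|al] /=; rewrite ?GS ?subrr ?subr0//.
by have := leq_trans la (leq_trans ab bl); rewrite ltnn.
Qed.

(** * Moments of Brownian increments *)

Section increment_moments.
Context d (T : measurableType d) (R : realType) (P : probability T R).
Variable W : R -> T -> R * R.
Hypothesis hW : brownian_motion2 P W.
Variable rho : R.
Hypothesis hrho : -1 <= rho <= 1.

Local Notation V := (Wrho rho W).
Local Notation integrable f := (P.-integrable setT (EFin \o f)).

(** Bounds the mean of [(eta ^+ 2 - 1) ^+ 2 <= eta ^+ 4 + 1] for a standard normal [eta]. *)
Definition increment_cst : R := 512 * expR 2 + 1.

Lemma increment_cst_ge0 : 0 <= increment_cst.
Proof.
by apply: addr_ge0; [apply: mulr_ge0; [exact: ler0n|exact: expR_ge0]|exact: ler01].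
Qed.

Lemma Wrho_increment_moments x y : 0 <= x -> x < y ->
  [/\ integrable (fun w => V y w - V x w) /\ \int[P]_w (V y w - V x w) = 0,
      integrable (fun w => (V y w - V x w) ^+ 2) /\
        \int[P]_w ((V y w - V x w) ^+ 2) = y - x &
      integrable (fun w => ((V y w - V x w) ^+ 2 - (y - x)) ^+ 2) /\
        \int[P]_w (((V y w - V x w) ^+ 2 - (y - x)) ^+ 2)
          <= increment_cst * (y - x) ^+ 2].
Proof.
move=> x0 xy; set xi := fun w => V y w - V x w.
have mxi : measurable_fun setT xi.
  by apply: measurable_funB; apply: (measurable_Wrho hW) => //; lra.
pose s := Num.sqrt (y - x).
have s0 : s != 0 by rewrite gt_eqF// sqrtr_gt0 subr_gt0.
have s2 : s ^+ 2 = y - x by rewrite sqr_sqrtr// subr_ge0 ltW.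
pose eta w := s^-1 * xi w.
have meta : measurable_fun setT eta by exact: measurable_funM.
have mgf l : (\int[P]_w (expR (l * eta w))%:E = (expR (l ^+ 2 / 2)%R)%:E)%E.
  under eq_integral do rewrite mulrA.
  rewrite (Wrho_increment_mgf hW)// -s2; congr (expR _)%:E; by field.
have i1 := integrable_id meta mgf; have E1 := Rintegral_id_mgf meta mgf.
have i2 := integrable_sqr meta mgf; have E2 := Rintegral_sqr_mgf meta mgf.
have i4 := integrable_expr4 meta mgf; have E4 := Rintegral_expr4_mgf_le meta mgf.
have xiE w : xi w = s * eta w by rewrite /eta mulVKf.
have xi2E w : xi w ^+ 2 = s ^+ 2 * eta w ^+ 2 by rewrite xiE exprMn.
have ic : integrable (fun=> 1 : R) by exact: finite_measure_integrable_cst.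
split.
- have -> : xi = (fun w => s * eta w) by apply/funext.
  by split; [exact: integrableZ_EFin|rewrite RintegralZl// E1 mulr0].
- have -> : (fun w => xi w ^+ 2) = (fun w => s ^+ 2 * eta w ^+ 2) by apply/funext.
  by split; [exact: integrableZ_EFin|rewrite RintegralZl// E2 mulr1].
- have E w : (xi w ^+ 2 - (y - x)) ^+ 2 = s ^+ 4 * (eta w ^+ 2 - 1) ^+ 2.
    by rewrite xi2E -s2; ring.
  have -> : (fun w => (xi w ^+ 2 - (y - x)) ^+ 2) =
      (fun w => s ^+ 4 * (eta w ^+ 2 - 1) ^+ 2) by apply/funext.
  have i41 := integrableD_EFin i4 ic.
  have le41 w : (eta w ^+ 2 - 1) ^+ 2 <= eta w ^+ 4 + 1.
    by have := sqr_ge0 (eta w); rewrite (_ : eta w ^+ 4 = (eta w ^+ 2) ^+ 2); [nra|ring].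
  have im : integrable (fun w => (eta w ^+ 2 - 1) ^+ 2).
    apply: integrable_le_norm i41 _.
      by apply: measurable_funX; apply: measurable_funB => //; exact: measurable_funX.
    by move=> w; rewrite ger0_norm ?sqr_ge0.
  split; first exact: integrableZ_EFin.
  rewrite RintegralZl// -s2 (_ : s ^+ 4 = (s ^+ 2) ^+ 2); last by ring.
  rewrite mulrC ler_wpM2r ?sqr_ge0//.
  apply: (le_trans (le_Rintegral measurableT im i41 (fun w _ => le41 w))).
  rewrite RintegralD// Rintegral_cst// mul1r.
  by rewrite [X in fine X](_ : _ = 1%E) ?lerD//; exact: probability_setT.
Qed.

End increment_moments.

(** * Compensated squares along a grid *)

Section discrete_quadratic_variation.
Context d (T : measurableType d) (R : realType) (P : probability T R).
Variable W : R -> T -> R * R.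
Hypothesis hW : brownian_motion2 P W.
Variable rho : R.
Hypothesis hrho : -1 <= rho <= 1.

Local Notation F := (natural_filtration P W).
Local Notation FT x := (g_sigma_algebraType (raw_natural_filtration W x `|`
  [set N | measurable N /\ P N = 0%E])).
Local Notation V := (Wrho rho W).
Local Notation integrable f := (P.-integrable setT (EFin \o f)).

Variable h : R.
Hypothesis h0 : 0 < h.

Let t (l : nat) : R := l%:R * h.
Let t0 l : 0 <= t l. Proof. by rewrite mulr_ge0// ltW. Qed.
Let tS l : t l < t l.+1. Proof. by rewrite ltr_pM2r// ltr_nat. Qed.
Let tSB l : t l.+1 - t l = h. Proof. by rewrite /t -natr1; ring. Qed.
Let t_le l m : (l <= m)%N -> t l <= t m.
Proof. by move=> lm; rewrite ler_wpM2r ?ler_nat// ltW. Qed.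

Let xi l w := V (t l.+1) w - V (t l) w.

(* A martingale difference: [c] and [H] are known at time [t l]. *)
Let dif (c H : nat -> T -> R) l w :=
  c l w * (xi l w ^+ 2 - h) + 2 * (H l w * xi l w).

Section martingale_differences.
Variables (c H : nat -> T -> R) (e : R).
Hypotheses (mc : forall l, measurable_fun [set: FT (t l)] (c l : FT (t l) -> R))
  (mH : forall l, measurable_fun [set: FT (t l)] (H l : FT (t l) -> R))
  (c1 : forall l w, `|c l w| <= 1) (He : forall l w, `|H l w| <= e).

Let mxi l m : (l < m)%N -> measurable_fun [set: FT (t m)] (xi l : FT (t m) -> R).
Proof.
move=> lm; apply: measurable_funB; apply: Wrho_adapted => //; apply: t_le => //.
exact: ltnW.
Qed.

Let mdif l m : (l < m)%N ->
  measurable_fun [set: FT (t m)] (dif c H l : FT (t m) -> R).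
Proof.
move=> lm; have lm' := t_le (ltnW lm).
have mc' := natural_filtration_le_measurable lm' (mc (l := l)).
have mH' := natural_filtration_le_measurable lm' (mH (l := l)).
have mx := mxi lm.
apply: measurable_funD; first apply: measurable_funM => //.
  by apply: measurable_funB => //; exact: measurable_funX.
by apply: measurable_funM => //; exact: measurable_funM.
Qed.

Let S m w := \sum_(l < m) dif c H l w.

Let mS m : measurable_fun [set: FT (t m)] (S m : FT (t m) -> R).
Proof.
rewrite /S; apply: measurable_sum => l.
exact: mdif.
Qed.

Let B := 2 * (increment_cst R * h ^+ 2) + 8 * e ^+ 2 * h.

(** The differences are orthogonal: [xi m] and [xi m ^+ 2 - h] have mean zero and are independent of
    what is known at [t m], so the cross terms vanish and each step adds at most [B]. The two terms
    of [B] come from bounding the square of a sum by twice the sum of the squares, with weights at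
    most 1 and [e]. *)
Lemma martingale_differences_sqr m :
  integrable (fun w => S m w ^+ 2) /\ \int[P]_w (S m w ^+ 2) <= m%:R * B.
Proof.
elim: m => [|m [iS ES]].
  rewrite /S; under eq_fun do rewrite big_ord0 expr0n/=.
  split; first exact: integrable0.
  by rewrite Rintegral_cst// !mul0r.
have [[i1 E1] [i2 E2] [i4 E4]] := Wrho_increment_moments hW hrho (t0 m) (tS m).
rewrite tSB in E2 i4 E4.
have mSm := @mS m.
have mSm' := natural_filtration_comp_measurable hW mSm.
have mc' := natural_filtration_comp_measurable hW (mc (l := m)).
have mH' := natural_filtration_comp_measurable hW (mH (l := m)).
have ic : integrable (fun=> 1 : R) by exact: finite_measure_integrable_cst.
have iS1 : integrable (S m).
  apply: integrable_le_norm (integrableD_EFin ic iS) _ => // w.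
  rewrite -(real_normK (num_real (S m w))).
  by have := sqr_ge0 (`|S m w| - 1); have := sqr_ge0 (`|S m w|); nra.
have iSc : integrable (fun w => S m w * c m w).
  apply: integrable_le_norm (integrable_norm iS1) _; first exact: measurable_funM.
  by move=> w; rewrite normrM ler_piMr.
have iSH : integrable (fun w => S m w * H m w).
  apply: integrable_le_norm (integrableZ_EFin e (integrable_norm iS1)) _.
    exact: measurable_funM.
  by move=> w; rewrite normrM mulrC ler_wpM2r.
have mX1 : measurable_fun setT (fun z : R => z ^+ 2 - h).
  by apply: measurable_funB => //; exact: measurable_funX.
have mid : measurable_fun setT (id : R -> R) by exact: measurable_id.
have i21 : integrable (fun w => xi m w ^+ 2 - h).
  by apply: integrableB_EFin => //; exact: finite_measure_integrable_cst.
have E21 : \int[P]_w (xi m w ^+ 2 - h) = 0.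
  rewrite RintegralB//; last exact: finite_measure_integrable_cst.
  rewrite E2 Rintegral_cst// [X in fine X](_ : _ = 1%E) ?mulr1 ?subrr//.
  exact: probability_setT.
have [j1 F1] := Wrho_increment_indep_mul hW (t0 m) (tS m)
  (measurable_funM mSm (mc (l := m))) iSc mX1 i21.
have [j2 F2] := Wrho_increment_indep_mul (g := id) hW (t0 m) (tS m)
  (measurable_funM mSm (mH (l := m))) iSH mid i1.
rewrite E21 mulr0 in F1; rewrite E1 mulr0 in F2.
have jc := integrableD_EFin (integrableZ_EFin 2 j1) (integrableZ_EFin 4 j2).
have Ec : \int[P]_w (2 * (S m w * c m w * (xi m w ^+ 2 - h)) +
    4 * (S m w * H m w * xi m w)) = 0.
  by rewrite RintegralD ?RintegralZl ?F1 ?F2 ?mulr0 ?addr0//; exact: integrableZ_EFin.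
have mdm : measurable_fun setT (dif c H m).
  exact: (natural_filtration_comp_measurable hW (mdif (ltnSn m))).
have dle w : dif c H m w ^+ 2 <=
    2 * (xi m w ^+ 2 - h) ^+ 2 + 8 * e ^+ 2 * xi m w ^+ 2.
  have c2 : c m w ^+ 2 <= 1.
    by rewrite -(real_normK (num_real (c m w))) exprn_ile1.
  have H2 : H m w ^+ 2 <= e ^+ 2.
    rewrite -(real_normK (num_real (H m w))) lerXn2r// nnegrE.
    exact: le_trans (He m w).
  have s1 := sqr_ge0 (c m w * (xi m w ^+ 2 - h) - 2 * (H m w * xi m w)).
  have p1 : c m w ^+ 2 * (xi m w ^+ 2 - h) ^+ 2 <= (xi m w ^+ 2 - h) ^+ 2.
    by rewrite ler_piMl// sqr_ge0.
  have p2 : H m w ^+ 2 * xi m w ^+ 2 <= e ^+ 2 * xi m w ^+ 2.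
    by rewrite ler_wpM2r// sqr_ge0.
  rewrite /dif; set A := c m w * _ in s1 *; set D := H m w * xi m w in s1 *.
  have -> : (A + 2 * D) ^+ 2 = 2 * A ^+ 2 + 8 * D ^+ 2 - (A - 2 * D) ^+ 2 by ring.
  rewrite /A /D !exprMn in s1 *; lra.
have id2' := integrableD_EFin (integrableZ_EFin 2 i4) (integrableZ_EFin (8 * e ^+ 2) i2).
have id2 : integrable (fun w => dif c H m w ^+ 2).
  apply: integrable_le_norm id2' _; first exact: measurable_funX.
  by move=> w; rewrite ger0_norm ?sqr_ge0.
have Ed2 : \int[P]_w (dif c H m w ^+ 2) <= B.
  apply: (le_trans (le_Rintegral measurableT id2 id2' (fun w _ => dle w))).
  rewrite RintegralD//; [|exact: integrableZ_EFin..].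
  by rewrite !RintegralZl// E2 lerD2r ler_pM2l.
have sqrE w : S m.+1 w ^+ 2 = S m w ^+ 2 + (2 * (S m w * c m w * (xi m w ^+ 2 - h)) +
    4 * (S m w * H m w * xi m w)) + dif c H m w ^+ 2.
  by rewrite /S big_ord_recr/= -/(S m w) /dif; ring.
under eq_fun do rewrite sqrE.
have iSj := integrableD_EFin iS jc.
split; first exact: integrableD_EFin.
rewrite RintegralD// RintegralD// Ec addr0 -natr1 mulrDl mul1r.
exact: lerD.
Qed.

End martingale_differences.

Section grid_squared_increments.
Variables (tau : nat -> T -> R) (n N : nat) (e : R).
Hypotheses (stau : forall i, stopping_time F (tau i))
  (tau_le : forall i w, (i < n)%N -> tau i w <= tau i.+1 w).

Let a i w := grid_index N h (tau i w).

Definition grid_compensated_square i w : R :=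
  (V ((a i.+1 w)%:R * h) w - V ((a i w)%:R * h) w) ^+ 2
  - ((a i.+1 w)%:R - (a i w)%:R) * h.

Let b i l (w : T) : R := (t l < tau i w)%R%:R.

Let mb i l : measurable_fun [set: FT (t l)] (b i l : FT (t l) -> R).
Proof.
rewrite (_ : b i l = \1_(~` [set w | tau i w <= t l])); last first.
  apply/funext => w; rewrite /b indicE; congr (nat_of_bool _)%:R.
  by rewrite ltNge; apply/idP/idP => [/negP H|/set_mem/negP//]; exact/mem_set.
by apply: measurable_indic; apply: measurableC; case: (stau i) => _ _; exact.
Qed.

(** Indicator that grid step [l] starts in the [i]-th random interval [tau i <= t l < tau i.+1]; for
    fixed [l] at most one index [i < n] qualifies. *)
Let beta i l w := b i.+1 l w * (1 - b i l w).

Let betaE i l w : (i < n)%N -> beta i l w = b i.+1 l w - b i l w.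
Proof.
move=> /(tau_le w) tt; rewrite /beta /b.
by case: ltP => ?; case: ltP => ?; rewrite /=; lra.
Qed.

Let c l w := \sum_(i < n) beta i l w.
(** This is the increment of [V] since the grid point that opens the current interval, spelled as a
    sum of past increments so that every factor is visibly known at time [t l]. *)
Let H0 l w := \sum_(i < n) beta i l w * \sum_(j < l) ((1 - b i j w) * xi j w).
(** The oscillation bound holds on [G] only, and [G] may depend on the whole path. Truncation at [e]
    gives an adapted weight that is bounded everywhere and equals [H0] on [G]. *)
Let H l w := if `|H0 l w| <= e then H0 l w else 0.

Let mbeta i l : measurable_fun [set: FT (t l)] (beta i l : FT (t l) -> R).
Proof. by apply: measurable_funM => //; apply: measurable_funB. Qed.

Let mc l : measurable_fun [set: FT (t l)] (c l : FT (t l) -> R).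
Proof. by apply: measurable_sum => i. Qed.

Let mH0 l : measurable_fun [set: FT (t l)] (H0 l : FT (t l) -> R).
Proof.
apply: measurable_sum => i; apply: measurable_funM => //.
apply: measurable_sum => j; have jl := t_le (ltnW (ltn_ord j)).
apply: measurable_funM.
  apply: measurable_funB => //.
  exact: (natural_filtration_le_measurable jl (@mb i j)).
apply: measurable_funB; apply: Wrho_adapted => //.
exact: t_le.
Qed.

Let mH l : measurable_fun [set: FT (t l)] (H l : FT (t l) -> R).
Proof.
apply: measurable_fun_ifT => //.
by apply: measurable_fun_ler => //; apply: measurableT_comp.
Qed.

Let c_bound l w : 0 <= c l w <= 1.
Proof.
have -> : c l w = \sum_(i < n) (b i.+1 l w - b i l w).
  by apply: eq_bigr => i _; exact: betaE.
rewrite -(big_mkord xpredT (fun i => b i.+1 l w - b i l w)) telescope_sumr//.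
have tt : tau 0 w <= tau n w.
  have : forall m, (m <= n)%N -> tau 0 w <= tau m w.
    elim=> // m IH mn; apply: (le_trans (IH (ltnW mn))); exact: tau_le.
  exact.
by rewrite /b; case: ltP => ?; case: ltP => ? /=; apply/andP; split; lra.
Qed.

Let beta_ge0 i l w : (i < n)%N -> 0 <= beta i l w.
Proof.
move=> ilt; rewrite betaE// /b; have := tau_le w ilt.
by case: ltP => ?; case: ltP => ? /=; lra.
Qed.

Let b_index i l w : (l < N)%N -> b i l w = (l < a i w)%N%:R.
Proof. by move=> lN; rewrite /a grid_index_lt// ltW. Qed.

Let sum_from_index i l w : (l < N)%N ->
  beta i l w * \sum_(j < l) ((1 - b i j w) * xi j w) =
  beta i l w * (V (t l) w - V (t (a i w)) w).
Proof.
move=> lN; rewrite /beta (b_index i w lN); case: (ltnP l (a i w)) => [|al].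
  by rewrite subrr mulr0 !mul0r.
congr (_ * _); pose f j := V (t j) w.
rewrite -[RHS]/(f l - f (a i w)).
have -> : f l - f (a i w) = (f l - f 0%N) - (f (a i w) - f 0%N) by ring.
rewrite (telescope_lt f (leqnn l)) (telescope_lt f al) -sumrB.
apply: eq_bigr => j _; have jN : (j < N)%N := ltn_trans (ltn_ord j) lN.
rewrite ltn_ord (b_index i w jN) /xi -/(f _) -/(f _).
by case: ltnP => _ /=; rewrite ?subrr ?mul0r// !subr0 mul1r.
Qed.

(** The discrete Ito formula in each random interval, then an exchange of sums: step [l] collects
    the contribution of the interval it starts in. *)
Lemma grid_compensated_sumE w :
  \sum_(i < n) grid_compensated_square i w =
  \sum_(l < N) (c l w * (xi l w ^+ 2 - h) + 2 * (H0 l w * xi l w)).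
Proof.
have index_le i : (i < n)%N -> (a i w <= a i.+1 w)%N.
  move=> ilt; rewrite leqNgt; apply/negP => lt.
  have aN : (a i.+1 w < N)%N := leq_trans lt (grid_index_le _ _ _).
  have := grid_index_lt (tau i w) (ltW h0) aN; rewrite -/(a i w) lt.
  move=> /esym/lt_le_trans/(_ (tau_le w ilt)).
  by rewrite -(grid_index_lt _ (ltW h0) aN) -/(a i.+1 w) ltnn.
pose f j := V (t j) w.
transitivity (\sum_(i < n) \sum_(l < N)
    (beta i l w * (xi l w ^+ 2 - h) + 2 * (beta i l w * (f l - f (a i w)) * xi l w))).
  apply: eq_bigr => i _; rewrite /grid_compensated_square.
  rewrite -/(t _) -/(t _) -/(f _) -/(f _).
  rewrite (grid_square_telescope f h (index_le i (ltn_ord i)) (grid_index_le _ _ _)).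
  apply: eq_bigr => l _; rewrite /beta !b_index// /xi -/(f _) -/(f _).
  by case: ltnP => _ /=; case: ltnP => _ /=; ring.
rewrite exchange_big/=; apply: eq_bigr => l _.
rewrite big_split/= /c mulr_suml; congr (_ + _).
rewrite -mulr_sumr -mulr_suml; congr (_ * (_ * _)).
by apply: eq_bigr => i _; rewrite sum_from_index.
Qed.

Lemma measurable_grid_compensated_sum :
  measurable_fun setT (fun w => \sum_(i < n) grid_compensated_square i w).
Proof.
under eq_fun do rewrite grid_compensated_sumE.
apply: measurable_sum => l.
have mxi' : measurable_fun setT (xi l).
  by apply: measurable_funB; exact: (measurable_Wrho hW).
have mc' := natural_filtration_comp_measurable hW (@mc l).
have mH' := natural_filtration_comp_measurable hW (@mH0 l).
apply: measurable_funD; apply: measurable_funM => //.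
  by apply: measurable_funB => //; exact: measurable_funX.
exact: measurable_funM.
Qed.

Variable G : set T.
Hypotheses (mG : measurable G) (e0 : 0 <= e)
  (osc : forall w i u v, G w -> (i < n)%N -> tau i w <= u <= tau i.+1 w ->
    tau i w <= v <= tau i.+1 w -> `|V u w - V v w| <= e).

(** The [beta] sum to at most 1, and where one is nonzero both [t l] and the first grid point at or
    after [tau i] lie in the interval, so that the oscillation hypothesis applies to them. *)
Let H0_bound l w : G w -> (l < N)%N -> `|H0 l w| <= e.
Proof.
move=> Gw lN; apply: (le_trans (ler_norm_sum _ _ _)).
have /andP[c0 c1] := c_bound l w.
apply: (@le_trans _ _ (\sum_(i < n) beta i l w * e)); last first.
  by rewrite -mulr_suml ler_piMl.
apply: ler_sum => i _; rewrite sum_from_index// normrM ger0_norm ?beta_ge0//.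
rewrite /beta (b_index i w lN) /b; case: (ltnP l (a i w)) => al /=.
  by rewrite subrr mulr0 !mul0r.
case: ltP => [lt|_] /=; last by rewrite !mul0r.
rewrite ler_wpM2l ?subr0 ?mulr1//.
have aN : (a i w < N)%N := leq_ltn_trans al lN.
have tau_a : tau i w <= t (a i w).
  by rewrite leNgt -(grid_index_lt _ (ltW h0) aN) -/(a i w) ltnn.
have al' := t_le al.
by apply: (osc Gw (ltn_ord i)); apply/andP; split; lra.
Qed.

Lemma grid_compensated_sum_sqr :
  (\int[P]_w (\1_G w * (\sum_(i < n) grid_compensated_square i w) ^+ 2)%:E
   <= (N%:R * (2 * (increment_cst R * h ^+ 2) + 8 * e ^+ 2 * h))%:E)%E.
Proof.
have c1 l w : `|c l w| <= 1.
  by have /andP[c0 c1] := c_bound l w; rewrite ger0_norm.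
have He l w : `|H l w| <= e by rewrite /H; case: ifPn => //; rewrite normr0.
have [iS ES] := martingale_differences_sqr mc mH c1 He N.
rewrite -lee_fin EFin_Rintegral// in ES; apply: le_trans ES.
apply: ge0_le_integral => //.
- by move=> w _; rewrite lee_fin mulr_ge0// sqr_ge0.
- apply/measurable_EFinP; apply: measurable_funM; first exact: measurable_indic.
  apply: measurable_funX.
  exact: measurable_grid_compensated_sum.
- exact/measurable_EFinP/(integrable_measurable iS).
- move=> w _; rewrite lee_fin indicE; have [/set_mem Gw|_] := boolP (w \in G).
    rewrite mul1r grid_compensated_sumE.
    rewrite le_eqVlt; apply/orP; left; apply/eqP; congr (_ ^+ 2).
    by apply: eq_bigr => l _; rewrite /dif /H H0_bound.
  by rewrite mul0r sqr_ge0.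
Qed.

End grid_squared_increments.

End discrete_quadratic_variation.

Lemma Rplus_uniform_continuous {R : realType} (f : R -> R) (t e : R) :
  {within Rplus, continuous f} -> 0 <= t -> 0 < e ->
  exists2 r, 0 < r & forall u v, 0 <= u <= t -> 0 <= v -> `|u - v| < r ->
    `|f u - f v| < e.
Proof.
move=> fc t0 e0.
pose Q (r u : R) := forall v, 0 <= v -> `|u - v| < r -> `|f u - f v| < e.
have local (u0 : R) : `[0, t]%classic u0 ->
    \forall u \near u0 & r \near 0^'+, `[0, t]%classic u -> Q r u.
  rewrite /= in_itv/= => /andP[u00 u0t].
  have [r0 r00 H] := Rplus_continuous_near fc u00 (ltac:(lra) : 0 < e / 2).
  exists (ball u0 (r0 / 2), [set r | r < r0 / 2]).
    split => /=; first by apply: nbhsx_ballx; lra.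
    by apply: nbhs_right_lt; lra.
  move=> [u r] /= [u0u rr0]; rewrite in_itv/= => /andP[u_ge0 ut] v v0 uv.
  rewrite /ball/= in u0u.
  have := H u u_ge0 (ltac:(lra)).
  have u0v : `|u0 - v| < r0.
    rewrite (_ : u0 - v = (u0 - u) + (u - v)); last by ring.
    by apply: le_lt_trans (ler_normD _ _) _; lra.
  by have := H v v0 u0v; rewrite !ltr_norml; lra.
have /compact_near_coveringP/near_covering_withinP cov := @segment_compact R 0 t.
have {}cov := cov _ _ _ _ local.
near (0 : R)^'+ => r; exists r; first by near: r; exact: nbhs_right_gt.
move=> u v ut; have : `[0, t]%classic `<=` Q r by near: r; exact: cov.
by apply; rewrite /= in_itv.
Unshelve. all: by end_near. Qed.

(** * Events of small probability *)

Section small_events.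
Context d (T : measurableType d) (R : realType) (P : probability T R).

Lemma decreasing_events_small (E : nat -> set T) (eta : R) :
  (forall m, measurable (E m)) -> (forall m n, (m <= n)%N -> E n `<=` E m) ->
  \bigcap_m E m = set0 -> 0 < eta -> exists m, (P (E m) < eta%:E)%E.
Proof.
move=> mE niE E0 eta0.
have H : P \o E @ \oo --> P (\bigcap_m E m).
  apply: nonincreasing_cvg_mu => //.
  - by rewrite (le_lt_trans (probability_le1 P (mE 0%N)))// ltry.
  - by rewrite E0.
  - by move=> m n mn; apply/subsetPset; exact: niE.
rewrite E0 measure0 in H.
have /fine_cvgP[_ /cvgrPdist_lt/(_ eta eta0)[m _ Hm]] := H.
exists m; have := Hm m (leqnn m); rewrite /= sub0r normrN.
rewrite -lte_fin ger0_norm ?fine_ge0// fineK//.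
by apply: fin_num_measure.
Qed.

(** The bad events [E m], where two times closer than [1 / (m + 1)] have values more than [e] apart,
    decrease to the empty set by uniform continuity of each path. Countably many times make them
    measurable, and continuity recovers all pairs. *)
Lemma uniform_continuity_event (U : R -> T -> R) (t e eta : R) :
  (forall s, 0 <= s -> measurable_fun setT (U s)) ->
  (forall w, {within Rplus, continuous (fun s => U s w)}) ->
  0 <= t -> 0 < e -> 0 < eta ->
  exists2 r, 0 < r & exists B, [/\ measurable B, (P B < eta%:E)%E &
    forall w u v, ~ B w -> 0 <= u <= t -> 0 <= v <= t -> `|u - v| < r ->
      `|U u w - U v w| <= e].
Proof.
move=> mU cU t0 e0 eta0.
(* Clipped rationals form a countable dense set of times in [[0, t]] that contains the endpoint [t]
   even when [t] is irrational. *)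
pose clip (q : rat) : R := Num.min t (Num.max 0 (ratr q)).
have clip01 q : 0 <= clip q <= t.
  by rewrite /clip le_min t0 le_max lexx/= ge_min lexx.
have clip_dist q u : 0 <= u <= t -> `|clip q - u| <= `|ratr q - u|.
  move=> /andP[u0 ut]; rewrite /clip.
  have := ler_norm (ratr q - u); have := ler_norm (- (ratr q - u)); rewrite normrN.
  rewrite [in X in X -> _ -> _]opprB; set a := ratr q => h1 h2; rewrite ler_norml.
  case: (leP 0 a) => a0; [case: (leP t a) => ta|case: (leP t 0) => ta];
    by apply/andP; split; lra.
pose E m : set T := \bigcup_p \bigcup_q (if `|clip p - clip q| < m.+1%:R^-1
  then [set w | e < `|U (clip p) w - U (clip q) w|] else set0).
have mE m : measurable (E m).
  apply: bigcupT_measurable_rat => p; apply: bigcupT_measurable_rat => q.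
  case: ifP => // _; apply: measurable_set_lt => //.
  have /andP[p0 _] := clip01 p; have /andP[q0 _] := clip01 q.
  by apply: measurableT_comp => //; apply: measurable_funB; exact: mU.
have niE m n : (m <= n)%N -> E n `<=` E m.
  move=> mn w [p _ [q _]]; case: ifP => // pq eU.
  exists p => //; exists q => //; rewrite ifT// (lt_le_trans pq)//.
  by rewrite lef_pV2 ?posrE ?ltr0n// ler_nat.
have E0 : \bigcap_m E m = set0.
  rewrite -subset0 => w Ew.
  have [r r0 H] := Rplus_uniform_continuous (cU w) t0 e0.
  have [p _ [q _]] := Ew (Num.truncn r^-1) I.
  case: ifP => // pq /=; rewrite ltNge => /negP; apply.
  have /andP[q0 _] := clip01 q.
  apply/ltW/H => //; apply: (lt_trans pq).
  by rewrite -[ltRHS]invrK ltf_pV2 ?posrE ?ltr0n ?invr_gt0// truncnS_gt.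
have [m Pm] := decreasing_events_small mE niE E0 eta0.
exists m.+1%:R^-1; first by rewrite invr_gt0 ltr0n.
exists (E m); split => // w u v nE ut vt uv.
rewrite leNgt; apply/negP => eU; apply: nE; rewrite /E.
move: uv; move: (m.+1%:R^-1) => dm uv.
have /andP[u0 _] := ut; have /andP[v0 _] := vt.
(* Half of the excess over [e] is spent on each replacement of a time by a clipped rational. *)
have g0 : 0 < (`|U u w - U v w| - e) / 2 by lra.
have [r1 r10 H1] := Rplus_continuous_near (cU w) u0 g0.
have [r2 r20 H2] := Rplus_continuous_near (cU w) v0 g0.
pose r := Num.min (Num.min r1 r2) ((dm - `|u - v|) / 2).
have r0 : 0 < r by rewrite !lt_min r10 r20; lra.
have [rr1 rr2 rr3] : [/\ r <= r1, r <= r2 & r <= (dm - `|u - v|) / 2].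
  by split; rewrite /r !ge_min lexx ?orbT.
have approx z : exists q : rat, z < ratr q < z + r.
  have : z < z + r by rewrite ltrDl.
  by move=> /rat_in_itvoo[q]; rewrite in_itv/=; exists q.
have close z q : 0 <= z <= t -> z < ratr q < z + r -> `|z - clip q| < r.
  move=> zt zq; rewrite distrC; apply: le_lt_trans (clip_dist q z zt) _.
  by rewrite ger0_norm; lra.
have [p pu] := approx u; have [q qv] := approx v.
have cp := close u p ut pu; have cq := close v q vt qv.
have /andP[p0 _] := clip01 p; have /andP[q0 _] := clip01 q.
exists p => //; exists q => //; rewrite ifT.
  have := H1 _ p0 (ltac:(lra)); have := H2 _ q0 (ltac:(lra)).
  rewrite /= => d2 d1; have : `|U u w - U v w| <= `|U u w - U (clip p) w| +
      `|U (clip p) w - U (clip q) w| + `|U v w - U (clip q) w|.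
    rewrite [X in _ <= _ + X]distrC.
    rewrite (_ : U u w - U v w = (U u w - U (clip p) w) +
      (U (clip p) w - U (clip q) w) + (U (clip q) w - U v w)); last by ring.
    by apply: (le_trans (ler_normD _ _)); rewrite lerD2r ler_normD.
  lra.
have : `|clip p - clip q| <= `|u - clip p| + `|u - v| + `|v - clip q|.
  rewrite (distrC u).
  rewrite (_ : clip p - clip q = (clip p - u) + (u - v) + (v - clip q)); last by ring.
  by apply: (le_trans (ler_normD _ _)); rewrite lerD2r ler_normD.
lra.
Qed.

End small_events.

Lemma partition_increasing {R : realType} (t : R) s i : itv_partition 0 t s -> (i < size s)%N ->
  [/\ 0 <= nth 0 (0 :: s) i, nth 0 (0 :: s) i < nth 0 (0 :: s) i.+1,
      nth 0 (0 :: s) i.+1 <= t &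
      nth 0 (0 :: s) i.+1 - nth 0 (0 :: s) i <= mesh 0 s].
Proof.
move=> Hp is_; have [ps lst] := Hp.
split.
- rewrite (set_nth_default t) /=; last by rewrite ltnS ltnW.
  by apply: itv_partition_nth_ge => //; rewrite ltnS ltnW.
- by have /pathP/(_ i is_) := ps.
- rewrite (set_nth_default t) /=; last by rewrite ltnS.
  have := @itv_partition_nth_le _ _ 0 t s i.+1; rewrite ltnS => /(_ is_ Hp).
  by rewrite /=.
- rewrite /mesh.
  apply: (@le_bigmax_seq _ _ _ _ _ i xpredT
    (fun i => nth 0 (0 :: s) i.+1 - nth 0 (0 :: s) i)) => //.
  by rewrite mem_index_iota.
Qed.

(** Past the end of the partition [nth] returns 0, so the claim covers every index and [X] at the
    [i]-th point is a stopping time for all [i]. *)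
Lemma partition_ge0 {R : realType} (t : R) s i : 0 <= t ->
  itv_partition 0 t s -> 0 <= nth 0 (0 :: s) i.
Proof.
move=> t0 sp; have [ilt|ige] := ltnP i (size s).
  by case: (partition_increasing sp ilt).
case: (ltngtP i (size s)) ige => // [ni|->] _; first by rewrite nth_default.
by rewrite (itv_partition_nth_size _ sp).
Qed.

Lemma measurable_squared_increments d (T : measurableType d) (R : realType)
    (Z : R -> T -> R) (t : R) s :
  (forall t, 0 <= t -> measurable_fun setT (Z t)) -> 0 <= t ->
  itv_partition 0 t s -> measurable_fun setT (squared_increments Z 0 s).
Proof.
move=> mZ t0 sp; rewrite /squared_increments; under eq_fun do rewrite big_mkord.
apply: measurable_sum => i; apply: measurable_funX.
by apply: measurable_funB; apply: mZ; exact: partition_ge0 sp.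
Qed.

(** * Quadratic variation along a continuous time change *)

Section quadratic_variation.
Context d (T : measurableType d) (R : realType) (P : probability T R).
Variable W : R -> T -> R * R.
Hypothesis hW : brownian_motion2 P W.
Variable rho : R.
Hypothesis hrho : -1 <= rho <= 1.

Local Notation F := (natural_filtration P W).
Local Notation V := (Wrho rho W).

Section stopped_squares.
Variables (tau : nat -> T -> R) (n K : nat) (e : R).
Hypotheses (stau : forall i, stopping_time F (tau i))
  (tau_le : forall i w, (i < n)%N -> tau i w <= tau i.+1 w).
Variable G : set T.
Hypotheses (mG : measurable G) (e0 : 0 <= e)
  (tauK : forall w i, G w -> (i <= n)%N -> tau i w <= K%:R)
  (osc : forall w i u v, G w -> (i < n)%N -> tau i w <= u <= tau i.+1 w ->
    tau i w <= v <= tau i.+1 w -> `|V u w - V v w| <= e).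

Definition compensated_square i w : R :=
  (V (tau i.+1 w) w - V (tau i w) w) ^+ 2 - (tau i.+1 w - tau i w).

Let h (k : nat) : R := k.+1%:R^-1.
Let h0 k : 0 < h k. Proof. by rewrite invr_gt0 ltr0n. Qed.
Let q i k w := (grid_index (K * k.+1) (h k) (tau i w))%:R * h k.

Let q_cvg w i : G w -> (i <= n)%N -> (fun k => q i k w) @ \oo --> tau i w.
Proof.
move=> Gw iN; have t0 : 0 <= tau i w by case: (stau i).
apply: (@cvgn_harmonic_dist _ _ _ 1 0) => // k _.
have := grid_index_ub (K * k.+1) (ltW (h0 k)) t0.
have := @grid_index_lb _ (K * k.+1) _ (tau i w) (ltW (h0 k)).
rewrite natrM mulfK ?pnatr_eq0// => /(_ (tauK Gw iN)).
rewrite -/(q i k w) mul1r -/(h k) ler_norml => lo hi; have := h0 k => hk.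
by move: hk lo hi; move: (h k) (q i k w) (tau i w) => ? ? ? ? ? ?; apply/andP; split; lra.
Qed.

(** On [G] the stopping times stay below [K], the horizon of a grid with [K * k.+1] steps of length
    [1 / (k + 1)]; off [G], where the rounded times may fail to converge, the indicator removes the
    sum. *)
Let f k w : R := \1_G w *
  (\sum_(i < n) grid_compensated_square W rho (h k) tau (K * k.+1) i w) ^+ 2.

Let f_cvg w : (fun k => f k w) @ \oo -->
  \1_G w * (\sum_(i < n) compensated_square i w) ^+ 2.
Proof.
rewrite /f indicE; have [/set_mem Gw|_] := boolP (w \in G); last first.
  by under eq_fun do rewrite mul0r; rewrite mul0r; exact: cvg_cst.
apply: cvgM; first exact: cvg_cst.
have cS : (fun k => \sum_(i < n) grid_compensated_square W rho (h k) tau (K * k.+1) i w)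
    @ \oo --> \sum_(i < n) compensated_square i w.
  apply: cvg_big => [|i _]; first exact: add_continuous.
  have Vq j : (j <= n)%N -> (fun k => V (q j k w) w) @ \oo --> V (tau j w) w.
    move=> jn; apply: (Rplus_continuous_cvg (f := fun x => V x w)).
    - exact: (Wrho_continuous hW rho w).
    - by case: (stau j).
    - by move=> k; rewrite /q mulr_ge0// ltW.
    - exact: q_cvg.
  rewrite /grid_compensated_square /compensated_square.
  under eq_fun do rewrite mulrBl.
  have in_ := ltn_ord i.
  apply: cvgB; last by apply: cvgB; apply: q_cvg => //; exact: ltnW.
  rewrite expr2; under eq_fun do rewrite expr2.
  by apply: cvgM; apply: cvgB; apply: Vq => //; exact: ltnW.
rewrite expr2; under eq_fun do rewrite expr2.
exact: cvgM.
Qed.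

(** Fatou's lemma along the grids: the discrete bound, with number of steps times mesh equal to [K],
    tends to [8 K e^2], since the term with [increment_cst] keeps a factor [h k]. *)
Lemma compensated_sum_sqr :
  (\int[P]_w (\1_G w * (\sum_(i < n) compensated_square i w) ^+ 2)%:E
    <= (8 * K%:R * e ^+ 2)%:E)%E.
Proof.
pose c k : R := (K * k.+1)%:R * (2 * (increment_cst R * h k ^+ 2) + 8 * e ^+ 2 * h k).
apply: (@fatou_le _ _ _ P f _ c).
- move=> k; apply: measurable_funM; first exact: measurable_indic.
  apply: measurable_funX.
  exact: (measurable_grid_compensated_sum hW rho (h0 k) _ stau).
- by move=> k w; rewrite mulr_ge0// sqr_ge0.
- exact: f_cvg.
- by move=> k; exact: (grid_compensated_sum_sqr hW hrho (h0 k)).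
- have C0 := increment_cst_ge0 R.
  apply: (@cvgn_harmonic_dist _ _ _ (2 * K%:R * increment_cst R) 0).
    by rewrite !mulr_ge0.
  move=> k _; rewrite /c natrM -/(h k).
  have kh : k.+1%:R * h k = 1 by rewrite mulfV// pnatr_eq0.
  have -> : K%:R * k.+1%:R * (2 * (increment_cst R * h k ^+ 2) + 8 * e ^+ 2 * h k)
      = 2 * K%:R * increment_cst R * (k.+1%:R * h k) * h k
        + 8 * K%:R * e ^+ 2 * (k.+1%:R * h k).
    by move: (k.+1%:R) (h k) (increment_cst R) K%:R => ? ? ? ?; ring.
  rewrite kh !mulr1 opprD addrCA subrr addr0 normrN ger0_norm//.
  by rewrite mulr_ge0// ?mulr_ge0// ltW.
Qed.

(** Chebyshev's inequality, restricted to [G]. *)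
Lemma compensated_sum_tail (a : R) : 0 < a ->
  measurable_fun setT (fun w => \sum_(i < n) compensated_square i w) ->
  (P (G `&` [set w | (a <= `|\sum_(i < n) compensated_square i w|)%R])
    <= (8 * K%:R * e ^+ 2 / a ^+ 2)%:E)%E.
Proof.
move=> a0 mS; have a2 : 0 < a ^+ 2 by rewrite exprn_gt0.
pose g w : R := \1_G w * (\sum_(i < n) compensated_square i w) ^+ 2.
have mg : measurable_fun setT (EFin \o g).
  apply/measurable_EFinP/measurable_funM; first exact: measurable_indic.
  exact: measurable_funX.
have := @le_integral_abse _ _ _ P setT measurableT (EFin \o g) (a ^+ 2) mg a2.
rewrite setTI => H.
have g0 w : 0 <= g w by rewrite mulr_ge0// sqr_ge0.
rewrite EFinM lee_pdivlMr// muleC; apply: le_trans (le_trans H _); last first.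
  under eq_integral do rewrite /= ger0_norm//.
  exact: compensated_sum_sqr.
apply: lee_wpmul2l; first by rewrite lee_fin ltW.
apply: le_measure; rewrite ?inE.
- apply: measurableI => //; apply: measurable_set_le => //.
  exact: measurableT_comp.
- rewrite -[X in measurable X]setTI; apply: emeasurable_fun_c_infty => //.
  exact: measurableT_comp.
- move=> w [Gw /= aS]; rewrite lee_fin ger0_norm// /g indicE mem_set// mul1r.
  by rewrite -(real_normK (num_real (\sum_(_ < _) _))) lerXn2r// ?nnegrE// ltW.
Qed.

End stopped_squares.

Variable X : R -> T -> R.
Hypotheses (sX : forall t, 0 <= t -> stopping_time F (X t))
  (X0 : forall w, X 0 w = 0)
  (X_le : forall w s t, 0 <= s -> s <= t -> X s w <= X t w)
  (X_cont : forall w, {within Rplus, continuous (fun t => X t w)}).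

Let X_ge0 t w : 0 <= t -> 0 <= X t w.
Proof. by move=> /sX[]. Qed.

Let mX t : 0 <= t -> measurable_fun setT (X t).
Proof. by move=> /sX[]. Qed.

Let VX t w := V (X t w) w.

Let mVX t : 0 <= t -> measurable_fun setT (VX t).
Proof.
move=> t0; apply: measurable_subordinate.
- by move=> w; exact: (Wrho_continuous hW rho w).
- exact: mX.
- by move=> w; exact: X_ge0.
- by move=> y y0 _; exact: (measurable_Wrho hW).
Qed.

Let VX_cont w : {within Rplus, continuous (fun t => VX t w)}.
Proof.
apply: (@Rplus_continuous_comp _ (fun x => V x w) (fun t => X t w)) => //.
- exact: (Wrho_continuous hW rho w).
- by move=> t; exact: X_ge0.
Qed.

Let Z t w := VX t w - X t w / 2.

Let mZ t : 0 <= t -> measurable_fun setT (Z t).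
Proof.
move=> t0; apply: measurable_funB; first exact: mVX.
by apply: measurable_funM => //; exact: mX.
Qed.

Section partition.
Variables (t e : R) (K : nat) (s : seq R) (G : set T).
Hypotheses (t_ge0 : 0 <= t) (s_part : itv_partition 0 t s) (e0 : 0 <= e)
  (mG : measurable G) (GK : forall w, G w -> X t w <= K%:R)
  (oscV : forall w u v, G w -> 0 <= u <= t -> 0 <= v <= t ->
     `|u - v| <= mesh 0 s -> `|VX u w - VX v w| <= e)
  (oscX : forall w u v, G w -> 0 <= u <= t -> 0 <= v <= t ->
     `|u - v| <= mesh 0 s -> `|X u w - X v w| <= e).

Let p i := nth 0 (0 :: s) i.
Let n := size s.
Let tau i := X (p i).

Let p_ge0 i : 0 <= p i. Proof. exact: partition_ge0 s_part. Qed.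

Let p_lt i : (i < n)%N -> p i < p i.+1.
Proof. by move=> ilt; case: (partition_increasing s_part ilt). Qed.

Let p_le_t i : (i < n)%N -> p i.+1 <= t.
Proof. by move=> ilt; case: (partition_increasing s_part ilt). Qed.

Let p_mesh i : (i < n)%N -> p i.+1 - p i <= mesh 0 s.
Proof. by move=> ilt; case: (partition_increasing s_part ilt). Qed.

Let tau_le i w : (i < n)%N -> tau i w <= tau i.+1 w.
Proof. by move=> ilt; apply: X_le; [exact: p_ge0|rewrite ltW// p_lt]. Qed.

Let stau i : stopping_time F (tau i).
Proof. by apply: sX; exact: p_ge0. Qed.

Let p_n : p n = t.
Proof. exact: itv_partition_nth_size s_part. Qed.

Let p_i_t i : (i <= n)%N -> p i <= t.
Proof.
rewrite leq_eqVlt => /predU1P[->|ilt]; first by rewrite p_n.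
by rewrite (le_trans (ltW (p_lt ilt)))// p_le_t.
Qed.

Let tauK w i : G w -> (i <= n)%N -> tau i w <= K%:R.
Proof.
move=> Gw ilt; apply: le_trans (GK Gw); apply: X_le; first exact: p_ge0.
exact: p_i_t.
Qed.

(** Every level crossed by [X] is attained, so a small oscillation of [VX] over a time step is one
    of [V] over the range of [X], the form required by the discrete estimate. *)
Let X_onto w a b u : 0 <= a -> a <= b -> X a w <= u <= X b w ->
  exists2 r, a <= r <= b & X r w = u.
Proof.
move=> a0 ab /andP[au ub].
have cX : {within `[a, b], continuous (fun r => X r w)}.
  apply: continuous_subspaceW (@X_cont w) => r /=.
  by rewrite in_itv/= => /andP[ar _]; rewrite /Rplus/=; lra.
have := @IVT R (fun r => X r w) a b u ab cX.
rewrite min_l ?X_le// max_r ?X_le// au ub => /(_ isT)[r].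
by rewrite in_itv/=; exists r.
Qed.

Let osc w i u v : G w -> (i < n)%N -> tau i w <= u <= tau i.+1 w ->
  tau i w <= v <= tau i.+1 w -> `|V u w - V v w| <= e.
Proof.
move=> Gw ilt /(X_onto (p_ge0 i) (ltW (p_lt ilt)))[r /andP[r1 r2] <-].
move=> /(X_onto (p_ge0 i) (ltW (p_lt ilt)))[r' /andP[r1' r2'] <-].
have := p_ge0 i; have := p_le_t ilt; have := p_mesh ilt => pm pt p0.
apply: oscV => //; try by apply/andP; split; lra.
by rewrite ler_norml; apply/andP; split; lra.
Qed.

Let S w := \sum_(i < n) compensated_square tau i w.

Let mS : measurable_fun setT S.
Proof.
apply: measurable_sum => i; apply: measurable_funB.
  by apply: measurable_funX; apply: measurable_funB; apply: mVX; exact: p_ge0.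
by apply: measurable_funB; apply: mX; exact: p_ge0.
Qed.

(** With [D] and [del] the increments of [V] and [X], the drift changes a squared increment by [(D -
    del / 2)^2 - D^2 = del^2 / 4 - D del]. Each of the two terms is at most [e del] in size, and the
    [del] add up to [X t <= K]. *)
Let squared_increments_le w : G w ->
  `|squared_increments Z 0 s w - X t w| <= `|S w| + 2 * e * K%:R.
Proof.
move=> Gw; pose D i := V (tau i.+1 w) w - V (tau i w) w.
pose del i := tau i.+1 w - tau i w.
have sum_del : \sum_(i < n) del i = X t w.
  rewrite -(big_mkord xpredT del) telescope_sumr//.
  by rewrite /tau p_n /p/= X0 subr0.
have -> : squared_increments Z 0 s w - X t w =
    S w + \sum_(i < n) (del i ^+ 2 / 4 - D i * del i).
  rewrite -{1}sum_del /squared_increments big_mkord -sumrB -big_split/=.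
  apply: eq_bigr => i _; rewrite /compensated_square /Z /VX -/(p i.+1) -/(p i).
  by rewrite -/(tau i.+1 w) -/(tau i w) /D /del -/(tau i.+1) -/(tau i); field.
apply: (le_trans (ler_normD _ _)); rewrite lerD2l.
apply: (le_trans (ler_norm_sum _ _ _)).
apply: (@le_trans _ _ (\sum_(i < n) 2 * e * del i)).
  apply: ler_sum => i _; have ilt := ltn_ord i.
  have del0 : 0 <= del i by rewrite subr_ge0 tau_le.
  have dele : del i <= e.
    rewrite -(ger0_norm del0); apply: oscX => //.
    - by rewrite p_ge0 p_le_t.
    - by rewrite p_ge0 p_i_t ?(ltnW ilt).
    - by rewrite ger0_norm ?p_mesh// subr_ge0 ltW// p_lt.
  have De : `|D i| <= e.
    by apply: (osc Gw ilt); rewrite lexx tau_le.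
  apply: (le_trans (ler_normB _ _)).
  rewrite (normrM (D i)) (ger0_norm del0) (ger0_norm (x := _ / 4)); last first.
    by rewrite divr_ge0// sqr_ge0.
  have : `|D i| * del i <= e * del i by rewrite ler_wpM2r.
  have : del i ^+ 2 <= e * del i by rewrite expr2 ler_wpM2r.
  have : 0 <= e * del i by rewrite mulr_ge0.
  by rewrite -mulrA; lra.
by rewrite -mulr_sumr sum_del ler_wpM2l ?GK// mulr_ge0.
Qed.

Lemma squared_increments_tail (a : R) : 0 < a -> 2 * e * K%:R <= a ->
  (P (G `&` [set w | (2 * a <= `|squared_increments Z 0 s w - X t w|)%R])
    <= (8 * K%:R * e ^+ 2 / a ^+ 2)%:E)%E.
Proof.
move=> a0 eKa; apply: le_trans (compensated_sum_tail stau tau_le mG e0 tauK osc a0 mS).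
apply: le_measure; rewrite ?inE.
- apply: measurableI => //; apply: measurable_set_le => //.
  apply: measurableT_comp => //; apply: measurable_funB; last exact: mX.
  exact: (measurable_squared_increments mZ t_ge0 s_part).
- apply: measurableI => //; apply: measurable_set_le => //.
  exact: measurableT_comp.
- move=> w [Gw /= aw]; split => //=; have := squared_increments_le Gw; rewrite /S.
  by move: aw eKa; lra.
Qed.

End partition.

Theorem subordinated_quadratic_variation t eps eta : 0 <= t -> 0 < eps ->
  0 < eta -> exists2 delta, 0 < delta &
  forall s, itv_partition 0 t s -> mesh 0 s < delta ->
  (P [set w | (eps <= `|squared_increments Z 0 s w - X t w|)%R] < eta%:E)%E.
Proof.
move=> t0 eps0 eta0; have eta4 : 0 < eta / 4 by lra.
have [m Pm] : exists m, (P [set w | (m%:R < X t w)%R] < (eta / 4)%:E)%E.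
  apply: (@decreasing_events_small _ _ _ P (fun m => [set w | m%:R < X t w])) => //.
  - by move=> m; apply: measurable_set_lt => //; exact: mX.
  - by move=> m m' mm' w /=; apply: le_lt_trans; rewrite ler_nat.
  - rewrite -subset0 => w /(_ (Num.truncn (X t w)).+1 I)/=.
    by apply/negP; rewrite -leNgt ltW// truncnS_gt.
(* The successor makes [K] positive, for the divisions below. *)
pose K := m.+1; have K0 : (0 : R) < K%:R by rewrite ltr0n.
(* [e <= 1] gives [e ^+ 2 <= e]; the second bound makes the drift error [2 e K] at most [eps / 2];
   the third brings the Chebyshev bound at level [eps / 2] down to [eta / 8]. *)
pose e := Num.min 1 (Num.min (eps / (4 * K%:R)) (eta * eps ^+ 2 / (256 * K%:R))).
have e0 : 0 < e by rewrite !lt_min ltr01 !divr_gt0// ?mulr_gt0// exprn_gt0.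
have e1 : e <= 1 by rewrite /e ge_min lexx.
have e2 : 2 * e * K%:R <= eps / 2.
  have : e <= eps / (4 * K%:R) by rewrite /e !ge_min lexx ?orbT.
  by rewrite ler_pdivlMr ?mulr_gt0//; lra.
have e3 : 8 * K%:R * e ^+ 2 / (eps / 2) ^+ 2 < eta / 4.
  have : e <= eta * eps ^+ 2 / (256 * K%:R) by rewrite /e !ge_min lexx ?orbT.
  rewrite ler_pdivlMr ?mulr_gt0// => He.
  have eps2 : 0 < eps ^+ 2 by rewrite exprn_gt0.
  rewrite ltr_pdivrMr ?exprn_gt0 ?divr_gt0//.
  have : K%:R * e ^+ 2 <= K%:R * e by rewrite ler_pM2l// expr2 ler_piMl// ltW.
  have : 0 < eta * eps ^+ 2 by rewrite mulr_gt0.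
  rewrite (_ : (eps / 2) ^+ 2 = eps ^+ 2 / 4); last by field.
  lra.
have [r1 r10 [B1 [mB1 PB1 H1]]] :=
  uniform_continuity_event P mVX VX_cont t0 e0 eta4.
have [r2 r20 [B2 [mB2 PB2 H2]]] :=
  uniform_continuity_event P mX X_cont t0 e0 eta4.
exists (Num.min r1 r2); first by rewrite lt_min r10.
move=> s sp; rewrite lt_min => /andP[sr1 sr2].
pose G := ~` B1 `&` ~` B2 `&` [set w | X t w <= K%:R].
have mG : measurable G.
  apply: measurableI; first by apply: measurableI; exact: measurableC.
  by apply: measurable_set_le => //; exact: mX.
have tail := @squared_increments_tail t e K s G t0 sp (ltW e0) mG
  (fun w Gw => Gw.2)
  (fun w u v Gw ut vt uv => H1 w u v Gw.1.1 ut vt (le_lt_trans uv sr1))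
  (fun w u v Gw ut vt uv => H2 w u v Gw.1.2 ut vt (le_lt_trans uv sr2))
  (eps / 2) (ltac:(lra)) e2.
rewrite (_ : 2 * (eps / 2) = eps) in tail; last by field.
set A := [set w | _] in tail *.
have mA : measurable A.
  apply: measurable_set_le => //; apply: measurableT_comp => //.
  by apply: measurable_funB; [exact: (measurable_squared_increments mZ t0 sp)|exact: mX].
have mC : measurable [set w | m%:R < X t w].
  by apply: measurable_set_lt => //; exact: mX.
(* Four exceptional events, each of probability below [eta / 4]: rough paths of [VX], rough paths of
   [X], large [X t], and a large deviation on the good event. *)
have sub : A `<=` ((B1 `|` B2) `|` [set w | m%:R < X t w]) `|` (G `&` A).
  move=> w Aw; have [B1w|nB1] := pselect (B1 w); first by left; left; left.
  have [B2w|nB2] := pselect (B2 w); first by left; left; right.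
  have [Xm|mX'] := leP (X t w) m%:R; last by left; right.
  right; split => //; split => //=; apply: (le_trans Xm).
  by rewrite ler_nat.
apply: (@le_lt_trans _ _ (P (((B1 `|` B2) `|` [set w | m%:R < X t w]) `|` (G `&` A)))).
  apply: le_measure; rewrite ?inE//.
  by apply: measurableU; [apply: measurableU => //; exact: measurableU|exact: measurableI].
have -> : eta%:E = ((eta / 4)%:E + (eta / 4)%:E + (eta / 4)%:E + (eta / 4)%:E)%E.
  by rewrite -!EFinD; congr EFin; field.
have U2 (C D : set T) : measurable C -> measurable D -> (P (C `|` D) <= P C + P D)%E.
  by move=> mC' mD'; exact: measureU2.
have mU : measurable (B1 `|` B2) by exact: measurableU.
apply: (le_lt_trans (U2 _ _ (measurableU _ _ mU mC) (measurableI _ _ mG mA))).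
apply: lteD; last by apply: (le_lt_trans tail); rewrite lte_fin.
apply: (le_lt_trans (U2 _ _ mU mC)); apply: lteD => //.
by apply: (le_lt_trans (U2 _ _ mB1 mB2)); exact: lteD.
Qed.

End quadratic_variation.

(** The integral of a nonnegative function is a supremum over the simple functions below it, hence
    monotone for arbitrary integrands. This serves for [Xbar], an infimum over uncountably many
    heights whose measurability is not established here. *)
Lemma ge0_le_integral_nonmeasurable d (T : measurableType d) (R : realType)
    (mu : {measure set T -> \bar R}) (f g : T -> \bar R) :
  (forall w, 0 <= f w)%E -> (forall w, f w <= g w)%E ->
  (\int[mu]_w f w <= \int[mu]_w g w)%E.
Proof.
move=> f0 fg.
rewrite !ge0_integralTE//; last by move=> w; exact: le_trans (fg w).
apply: le_ereal_sup => _ [h hf <-]; exists h => // w.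
exact: le_trans (hf w) (fg w).
Qed.

Section quantified_events.
Context d (T : measurableType d).

Lemma measurable_forall_nat (Q : nat -> T -> Prop) :
  (forall i, measurable [set w | Q i w]) -> measurable [set w | forall i, Q i w].
Proof.
move=> mQ; rewrite (_ : [set w | _] = \bigcap_i [set w | Q i w]).
  exact: bigcapT_measurable.
by apply/seteqP; split => [w Qw i _|w Qw i]; [exact: Qw|exact: (Qw i I)].
Qed.

Lemma measurable_forall_rat (Q : rat -> T -> Prop) :
  (forall i, measurable [set w | Q i w]) -> measurable [set w | forall i, Q i w].
Proof.
move=> mQ; rewrite (_ : [set w | _] = ~` \bigcup_i ~` [set w | Q i w]).
  by apply/measurableC/bigcupT_measurable_rat => i; exact: measurableC.
apply/seteqP; split => [w Qw [i _]|w nQ i]; first exact.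
by apply: contrapT => nQi; apply: nQ; exists i.
Qed.

Lemma measurable_imply (A : Prop) (Q : T -> Prop) :
  (A -> measurable [set w | Q w]) -> measurable [set w | A -> Q w].
Proof.
move=> mQ; have [a|na] := pselect A.
  rewrite (_ : [set w | _] = [set w | Q w]); first exact: mQ.
  by apply/seteqP; split => w /=; [exact|move=> + _].
rewrite (_ : [set w | _] = setT)//.
by apply/seteqP; split => w //= _ /na.
Qed.

End quantified_events.

(** * Events prior to a stopping time *)

Section prior_events.
Context d (T : measurableType d) (R : realType) (P : probability T R).
Variable W : R -> T -> R * R.
Hypothesis hW : brownian_motion2 P W.

Local Notation F := (natural_filtration P W).
Local Notation FT x := (g_sigma_algebraType (raw_natural_filtration W x `|`
  [set N | measurable N /\ P N = 0%E])).

Lemma prior_events_sigma_algebra tau : stopping_time F tau ->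
  sigma_algebra setT (prior_events F tau).
Proof.
move=> [_ _ Ftau]; split.
- split => // x x0; rewrite set0I.
  by apply: natural_filtration_null => //; rewrite measure0.
- move=> A [mA FA]; split; first exact: measurableD.
  move=> x x0.
  rewrite (_ : _ `&` _ = [set w | tau w <= x] `\` (A `&` [set w | tau w <= x])).
    by apply: natural_filtrationD; [exact: Ftau|exact: FA].
  apply/seteqP; split => w /=.
    by move=> [[_ nA] tx]; split => // -[].
  by move=> [tx nA]; split => //; split => // Aw; apply: nA.
- move=> A FA; split; first by apply: bigcupT_measurable => n; case: (FA n).
  move=> x x0; rewrite setI_bigcupl.
  apply: (@bigcupT_measurable _ (FT x)) => n.
  by case: (FA n) => _; exact.
Qed.

(** Up to a null event, cutting [A] by [tau <= x] amounts to cutting it by both [sigma <= x] and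
    [tau <= x]; completeness lets the almost sure order suffice. *)
Lemma prior_events_le sigma tau : stopping_time F tau ->
  {ae P, forall w, sigma w <= tau w} ->
  prior_events F sigma `<=` prior_events F tau.
Proof.
move=> [mtau _ Ftau] st A [mA FA]; split => // x x0.
have m1 : measurable [set w | tau w <= x] by exact: measurable_set_le.
have := natural_filtrationI (FA x x0) (Ftau x x0).
move=> /(natural_filtration_negligible hW); apply.
- exact: measurableI.
- by apply: negligibleS st => w [[[Aw sx] tx]] /(_ (conj Aw tx)).
- apply: negligibleS st => w [[Aw /= tx] nn] st; apply: nn; split => //; split => //.
  exact: le_trans tx.
Qed.

Lemma stopping_time_if sigma tau A : stopping_time F sigma ->
  stopping_time F tau -> prior_events F sigma A -> prior_events F tau A ->
  stopping_time F (fun w => if w \in A then tau w else sigma w).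
Proof.
move=> ssg stau [mA FsA] [_ FtA].
have [ms s0 Fs] := ssg; have [mt t0 Ft] := stau; split.
- apply: measurable_fun_ifT => //.
  apply: (@measurable_fun_bool _ _ _ _ true).
  rewrite setTI (_ : _ @^-1` _ = A)//.
  by apply/seteqP; split => w /= => [/set_mem|/mem_set].
- by move=> w; case: ifP.
- move=> x x0; have [_ FAC _] := prior_events_sigma_algebra ssg.
  have [_ FsAC] := FAC A (conj mA FsA).
  have := natural_filtrationU (FtA x x0) (FsAC x x0).
  congr (natural_filtration P W x); apply/seteqP; split => w /=.
    case: ifPn => [/set_mem Aw|/negP nA]; first by move=> [[]|[[_ nA]]].
    by move=> [[Aw _]|[]]//; case: nA; exact: mem_set.
  case: ifPn => [/set_mem Aw ?|/negP nA ?]; [by left|right; split => //].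
  by split => // Aw; apply: nA; exact: mem_set.
Qed.

Lemma stopping_time_min_measurable tau x : stopping_time F tau -> 0 <= x ->
  measurable_fun [set: FT x] ((fun w => Num.min (tau w) x) : FT x -> R).
Proof.
move=> [_ tau0 Ftau] x0.
apply: (measurability _ (RGenOInfty.measurableE R)) => _ [_ [r ->] <-].
rewrite setTI; have [xr|rx] := leP x r.
  rewrite (_ : _ @^-1` _ = set0)//.
  rewrite -subset0 => w /=; rewrite in_itv/= andbT lt_min => /andP[_].
  by rewrite ltNge xr.
have [r0|r0] := leP 0 r.
  rewrite (_ : _ @^-1` _ = ~` [set w | tau w <= r]).
    apply: (@measurableC _ (FT x)).
    exact: (natural_filtration_nondecreasing (ltW rx) (Ftau r r0)).
  by apply/seteqP; split => w /=; rewrite in_itv/= andbT lt_min rx andbT ltNge => /negP.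
rewrite (_ : _ @^-1` _ = setT)//.
apply/seteqP; split => w //= _; rewrite in_itv/= andbT lt_min rx andbT.
exact: lt_le_trans (tau0 w).
Qed.

(** On [tau <= x] the value at [tau] is the value at the minimum of [tau] and [x], which samples the
    martingale up to [x] only and is therefore measurable for [F x]. *)
Lemma expmart_stopped_adapted rho l tau B : stopping_time F tau ->
  measurable B ->
  prior_events F tau ((fun w => expmart W rho l (tau w) w) @^-1` B).
Proof.
move=> stau mB; have [mtau tau0 Ftau] := stau; split.
  rewrite -[X in measurable X]setTI.
  by apply: (measurable_expmart_subordinate hW rho l mtau tau0).
move=> x x0; pose tx w := Num.min (tau w) x.
have mtx : measurable_fun [set: FT x] (tx : FT x -> R).
  exact: stopping_time_min_measurable.
have mf : measurable_fun [set: FT x] ((fun w => expmart W rho l (tx w) w) : FT x -> R).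
  apply: measurable_subordinate => //.
  - by move=> w; exact: (expmart_continuous hW rho l w).
  - by move=> w; rewrite le_min tau0.
  - move=> y y0 [w yt]; apply: expmart_adapted => //.
    by apply: (le_trans yt); rewrite ge_min lexx orbT.
rewrite (_ : _ `&` _ = ((fun w => expmart W rho l (tx w) w) @^-1` B)
    `&` [set w | tau w <= x]).
  apply: natural_filtrationI; last exact: Ftau.
  by rewrite -[X in natural_filtration _ _ _ X]setTI; exact: mf.
by apply/seteqP; split => w /= [+ tx']; rewrite /tx min_l.
Qed.

End prior_events.

(** * Optional stopping and the martingale property *)

Section subordinated_martingale.
Context d (T : measurableType d) (R : realType) (P : probability T R).
Variable W : R -> T -> R * R.
Hypothesis hW : brownian_motion2 P W.
Variable rho : R.
Hypothesis hrho : -1 <= rho <= 1.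

Local Notation F := (natural_filtration P W).
Local Notation M := (expmart W rho 1).
Local Notation integrable f := (P.-integrable setT (EFin \o f)).

Lemma expmart_optional_stopping sigma tau A :
  stopping_time F sigma -> stopping_time F tau ->
  {ae P, forall w, sigma w <= tau w} ->
  (\int[P]_w (expR (sigma w / 2))%:E < +oo)%E ->
  (\int[P]_w (expR (tau w / 2))%:E < +oo)%E ->
  prior_events F sigma A ->
  (\int[P]_(w in A) (M (sigma w) w)%:E = \int[P]_(w in A) (M (tau w) w)%:E)%E.
Proof.
move=> ssg stau st isg itau FA; have [mA _] := FA.
have FtA := prior_events_le hW stau st FA.
have sif := stopping_time_if ssg stau FA FtA.
pose kappa w := if w \in A then tau w else sigma w.
have mexp (theta : T -> R) : measurable_fun setT theta ->
    measurable_fun setT (fun w => (expR (theta w / 2))%:E).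
  move=> mt; apply/measurable_EFinP/measurableT_comp => //.
  exact: measurable_funM.
have ikappa : (\int[P]_w (expR (kappa w / 2))%:E < +oo)%E.
  have [msg _ _] := ssg; have [mtau _ _] := stau.
  apply: (@le_lt_trans _ _
    (\int[P]_w ((expR (tau w / 2))%:E + (expR (sigma w / 2))%:E))%E).
    apply: ge0_le_integral_nonmeasurable => w; first by rewrite lee_fin expR_ge0.
    rewrite -EFinD lee_fin /kappa.
    by case: ifP => _; rewrite ?lerDl ?lerDr expR_ge0.
  rewrite ge0_integralD//; [exact: lte_add_pinfty|..].
  - exact: mexp.
  - exact: mexp.
have [iM EM] := novikov hW hrho ssg isg.
have [iK EK] := novikov hW hrho sif ikappa.
have [iN EN] := novikov hW hrho stau itau.
have split_int (f : T -> R) : integrable f ->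
    \int[P]_w f w = \int[P]_(w in A) f w + \int[P]_(w in ~` A) f w.
  move=> fi; rewrite -(setUv A) Rintegral_setU ?setUv//; first exact: measurableC.
  by apply/disj_setPCl.
have : \int[P]_w M (sigma w) w = \int[P]_w M (kappa w) w by rewrite EM EK.
rewrite (split_int _ iM) (split_int _ iK).
have -> : \int[P]_(w in ~` A) M (kappa w) w = \int[P]_(w in ~` A) M (sigma w) w.
  apply: eq_Rintegral => w; rewrite inE/= => nA.
  by rewrite /kappa ifF//; apply/negP => /set_mem.
have -> : \int[P]_(w in A) M (kappa w) w = \int[P]_(w in A) M (tau w) w.
  by apply: eq_Rintegral => w wA; rewrite /kappa wA.
move=> /addIr E.
have fin f : integrable f -> ((\int[P]_(w in A) f w)%:E = \int[P]_(w in A) (f w)%:E)%E.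
  move=> fi; rewrite fineK//; apply: integrable_fin_num => //.
  exact: integrableS fi.
by rewrite -(fin _ iM) -(fin _ iN) E.
Qed.

Variable X : R -> T -> R.
Hypotheses (sX : forall t, 0 <= t -> stopping_time F (X t))
  (X_le : forall s t, 0 <= s -> s <= t -> {ae P, forall w, X s w <= X t w})
  (X_exp : forall t, 0 <= t -> (\int[P]_w (expR (X t w / 2))%:E < +oo)%E).

Theorem price_martingale :
  martingale P (fun t => prior_events F (X t)) (price rho W X).
Proof.
have priceE t : price rho W X t = fun w => M (X t w) w.
  by apply/funext => w; rewrite /price /expmart; congr expR; field.
have integrable_price t : 0 <= t -> integrable (fun w => M (X t w) w).
  by move=> t0; have [] := novikov hW hrho (sX t0) (X_exp t0).
have adapted t : 0 <= t -> forall B, measurable B ->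
    prior_events F (X t) (price rho W X t @^-1` B).
  by move=> t0 B mB; rewrite priceE; exact: (expmart_stopped_adapted hW rho 1 (sX t0) mB).
split.
- split.
  + by move=> t t0; exact: (prior_events_sigma_algebra (sX t0)).
  + by move=> t t0 A [].
  + move=> s t s0 st; apply: prior_events_le => //; last exact: X_le.
    by apply: sX; exact: le_trans st.
- by move=> t t0 B; exact: adapted.
- by move=> t t0; rewrite priceE; exact: integrable_price.
- move=> s t s0 st; have t0 : 0 <= t := le_trans s0 st.
  split; [exact: adapted|by rewrite priceE; exact: integrable_price|].
  move=> A FA; rewrite !priceE.
  by apply: expmart_optional_stopping => //; [exact: sX|exact: sX|exact: X_le|exact: X_exp|exact: X_exp].
Qed.

End subordinated_martingale.

(** * The solution as a family of stopping times *)

Section solution.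
Context d (T : measurableType d) (R : realType) (P : probability T R).
Variable W : R -> T -> R * R.
Hypothesis hW : brownian_motion2 P W.
Variable Y : T -> R * R -> R.
Hypothesis hYadapted : spatially_adapted (natural_filtration P W) Y.

Local Notation F := (natural_filtration P W).
Local Notation FT x := (g_sigma_algebraType (raw_natural_filtration W x `|`
  [set N | measurable N /\ P N = 0%E])).

(** A staircase reads the field at heights up to [b], so spatial adaptedness places each of its
    conditions in [F b]; staircases and fractions range over countable sets. *)
Lemma staircase_event b t : 0 < b ->
  F b [set w | exists q, staircase (Y w) b t q].
Proof.
move=> b0; rewrite (_ : [set w | _] = \bigcup_q [set w | staircase (Y w) b t q]).
  apply: (@countable_bigcupT_measurable _ (FT b)) => [|q]; first exact: countableP.
  pose n := (size q).-1; pose s i : R := ratr (nth 0 q i).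
  (* The requirements on the times [s] are deterministic: when they fail, no [w] has this
     staircase. *)
  have [[n0 s0 snt sS]|nH] := pselect [/\ (0 < n)%N, 0 <= s 0%N, s n < t &
      forall i, (i < n)%N -> s i < s i.+1]; last first.
    rewrite (_ : [set w | staircase _ _ _ _] = set0); first exact: measurable0.
    rewrite -subset0 => w [n0 s0 snt H]; apply: nH; split => //.
    by move=> i /H[].
  have si0 i : (i < n)%N -> 0 <= s i.
    elim: i => // i IH ilt.
    by have := sS i (ltnW ilt); have := IH (ltnW ilt); lra.
  rewrite (_ : [set w | staircase _ _ _ _] = [set w | forall i, (i < n)%N -> forall l : rat,
      0 <= l <= 1 ->
      b / n%:R <= (s i.+1 - s i) * Y w (s i, (i%:R + ratr l) * (b / n%:R))]).
    apply: (@measurable_forall_nat _ (FT b)) => i.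
    apply: (@measurable_imply _ (FT b)) => ilt.
    apply: (@measurable_forall_rat _ (FT b)) => l.
    apply: (@measurable_imply _ (FT b)) => /andP[l0 l1].
    set u := (i%:R + ratr l) * (b / n%:R).
    have nR0 : (0 : R) < n%:R by rewrite ltr0n.
    have lr0 : (0 : R) <= ratr l by rewrite ler0q.
    have lr1 : ratr l <= 1 :> R by rewrite -(rmorph1 (@ratr R)) ler_rat.
    have u0 : 0 <= u by rewrite mulr_ge0 ?addr_ge0// divr_ge0// ltW.
    have ub : u <= b.
      rewrite /u mulrA ler_pdivrMr// mulrC ler_pM2l//.
      have : i.+1%:R <= n%:R :> R by rewrite ler_nat.
      by rewrite -natr1; lra.
    have mB : measurable [set y : R | b / n%:R <= (s i.+1 - s i) * y].
      by apply: measurable_set_le => //; exact: measurable_funM.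
    apply: (natural_filtration_nondecreasing ub).
    exact: (hYadapted (si0 i ilt) u0 mB).
  apply/seteqP; split => w.
    by case=> _ _ _ H i ilt l l01; case: (H i ilt) => _; exact.
  by move=> H; split => // i ilt; split; [exact: sS|exact: H].
by apply/seteqP; split => w [q Hq]; [exists q|exists q; case: Hq].
Qed.

Variable X : R -> T -> R.
Hypotheses (hYG : {ae P, forall w, classG (Y w)}) (hX : solves_rivp P Y X).

Definition solves_at w : Prop := [/\ classG (Y w), X 0 w = 0 &
  forall t, Rplus t -> has_derivative_Rplus (fun s => X s w) t (Y w (t, X t w))].

Lemma solves_ae : {ae P, forall w, solves_at w}.
Proof.
case: hX => _ _; apply: filterS2 hYG => w G [X0 Xd]; split=> //.
Qed.

Lemma solution_ge0 t w : 0 <= t -> 0 <= X t w.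
Proof. by case: hX => _ + _; exact. Qed.

Lemma solution_stopping_time t : 0 <= t -> stopping_time F (X t).
Proof.
move=> t0; have [mX _ _] := hX.
have mXt := mX t t0.
split => // [w|b]; first exact: solution_ge0.
have mle : measurable [set w | X t w <= b] by exact: measurable_set_le.
(* The staircase criterion is for [b > 0]. At [b = 0], the event [X t <= 0] is almost surely true
   for [t = 0], and almost surely false for [t > 0] because the solution strictly increases. *)
rewrite le_eqVlt => /predU1P[b0|b0].
- have [t_eq0|tn0] := eqVneq t 0.
  + apply: (@natural_filtration_negligible _ _ _ _ _ hW _ setT) => //.
    * exact: (@measurableT _ (FT b)).
    * apply: negligibleS solves_ae => w [_ nX] [_ X0 _]; apply: nX.
      by rewrite /= t_eq0 X0 -b0.
    * by rewrite setDT; exact: negligible_set0.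
  + have {tn0}t0' : 0 < t by rewrite lt_neqAle eq_sym tn0.
    apply: (@natural_filtration_negligible _ _ _ _ _ hW _ set0) => //.
    * exact: (@measurable0 _ (FT b)).
    * by rewrite set0D; exact: negligible_set0.
    * apply: negligibleS solves_ae => w [/= Xb _] [G X0 Xd].
      have := ivp_increasing G (fun s s0 => solution_ge0 w s0) X0 Xd (lexx 0) t0'.
      by rewrite X0; lra.
- have key w : solves_at w -> b < X t w <-> exists q, staircase (Y w) b t q.
    move=> [G X0 Xd].
    exact: (ivp_lt_staircaseP G (fun s s0 => solution_ge0 w s0) X0 Xd).
  apply: (@natural_filtration_negligible _ _ _ _ _ hW _
      (~` [set w | exists q, staircase (Y w) b t q])) => //.
  + apply: (@measurableC _ (FT b)); exact: staircase_event.
  + apply: negligibleS solves_ae => w [nst /= nX] /key[kl _].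
    by apply: nst; apply: kl; rewrite ltNge; exact/negP.
  + apply: negligibleS solves_ae => w [/= Xb nnst] /key[_ kr].
    by apply: nnst => /kr; rewrite ltNge Xb.
Qed.

Lemma solution_nondecreasing w s t : solves_at w -> 0 <= s -> s <= t ->
  X s w <= X t w.
Proof.
move=> [G X0 Xd].
exact: (ivp_nondecreasing G (fun s s0 => solution_ge0 w s0) X0 Xd).
Qed.

Lemma solution_continuous w : solves_at w ->
  {within Rplus, continuous (fun t => X t w)}.
Proof. by move=> [G X0 Xd]; exact: ivp_continuous Xd. Qed.

Lemma solution_le_Xbar w t : solves_at w -> 0 <= t -> ((X t w)%:E <= Xbar Y t w)%E.
Proof.
move=> [G X0 Xd] t0; apply: le_ereal_inf_tmp => _ [x [x0 Yx] <-].
rewrite lee_fin.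
exact: (ivp_le G X0 Xd x0 t0 (lexx t)).
Qed.

Lemma solution_exp_moment t : 0 <= t ->
  (\int[P]_w expeR ((2^-1)%:E * Xbar Y t w) < +oo)%E ->
  (\int[P]_w (expR (X t w / 2))%:E < +oo)%E.
Proof.
move=> t0; have [mX _ _] := hX; have mXt := mX t t0.
have [N [mN N0 subN]] := solves_ae.
have mexp : measurable_fun setT (fun w => expR (X t w / 2)).
  by apply: measurableT_comp => //; exact: measurable_funM.
apply: le_lt_trans.
(* The comparison with [Xbar] has to be made at every [w], so the exponential is first set to zero
   on the null event [N]; being measurable, it keeps its integral. *)
apply: (@le_trans _ _ (\int[P]_w (\1_(~` N) w * expR (X t w / 2))%:E)%E).
  rewrite le_eqVlt; apply/orP; left; apply/eqP.
  apply: ge0_ae_eq_integral => //.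
  - exact/measurable_EFinP.
  - apply/measurable_EFinP/measurable_funM => //.
    by apply: measurable_indic; exact: measurableC.
  - exists N; split => // w /= nw; apply: contrapT => nN; apply: nw => _.
    by rewrite indicE mem_set// mul1r.
apply: ge0_le_integral_nonmeasurable => w; first by rewrite lee_fin mulr_ge0 ?expR_ge0.
rewrite indicE; have [/set_mem nN|_] := boolP (w \in ~` N); last first.
  by rewrite mul0r expeR_ge0.
have Xw : solves_at w by apply: contrapT => nX; apply: nN; exact: subN.
rewrite mul1r -[(expR _)%:E]/(expeR (X t w / 2)%:E) lee_expeR mulrC EFinM.
by rewrite lee_pmul2l ?lte_fin// solution_le_Xbar.
Qed.

End solution.

(** * Martingale property and quadratic variation of the price *)

Unset Implicit Arguments.

Theorem mainTheorem13 (R : realType) (d : measure_display)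
    (T : measurableType d) (P : probability T R)
    (W : R -> T -> R * R) (hW : brownian_motion2 P W)
    (Y : T -> R * R -> R)
    (hY : continuous_random_field Y)
    (hYadapted : spatially_adapted (natural_filtration P W) Y)
    (hYG : {ae P, forall w, classG (Y w)})
    (hXbar : forall t, Rplus t ->
       (\int[P]_w expeR ((2^-1)%:E * Xbar Y t w) < +oo)%E)
    (X : R -> T -> R) (hX : solves_rivp P Y X)
    (rho : R) (hrho : -1 <= rho <= 1) :
  let S := price rho W X in
  let G := fun t => prior_events (natural_filtration P W) (X t) in
  martingale P G S /\
  is_quadratic_variation P (fun t w => ln (S t w)) X.
Proof.
move=> S G.
have sX t := solution_stopping_time hW hYadapted hYG hX (t := t).
have solves := solves_ae hYG hX.
have X_exp t (t0 : 0 <= t) := solution_exp_moment hYG hX t0 (hXbar t t0).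
split.
  apply: price_martingale => // s t s0 st.
  by apply: filterS solves => w Xw; exact: (solution_nondecreasing hX Xw s0 st).
have lnS t w : ln (S t w) = Wrho rho W (X t w) w - X t w / 2.
  by rewrite /S /price expRK.
split.
  apply: filterS solves => w Xw; split.
  - by case: Xw.
  - exact: solution_continuous Xw.
  - by move=> s t; exact: (solution_nondecreasing hX Xw).
have [N [mN N0 subN]] := solves.
have solvesN w : ~ N w -> solves_at Y X w.
  by move=> nN; apply: contrapT => nX; apply: nN; exact: subN.
(* Off the exceptional null set [X'] is [X]; on it [X'] is frozen at [0]. *)
pose X' t w : R := \1_(~` N) w * X t w.
have X'E t w : ~ N w -> X' t w = X t w.
  by move=> nN; rewrite /X' indicE mem_set// mul1r.
have X'N t w : N w -> X' t w = 0.
  by move=> Nw; rewrite /X' indicE memNset ?mul0r// => /(_ Nw).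
have X'_ge0 t w : 0 <= t -> 0 <= X' t w.
  by move=> t0; rewrite mulr_ge0//; exact: (solution_ge0 hX).
(* Modification on a null event preserves stopping times, as the filtration is completed. *)
have sX' t : 0 <= t -> stopping_time (natural_filtration P W) (X' t).
  move=> t0; have [mX _ FX] := sX t t0.
  have mX' : measurable_fun setT (X' t).
    apply: measurable_funM => //; apply: measurable_indic; exact: measurableC.
  split => // [w|x x0]; first exact: X'_ge0.
  have nN : P.-negligible N by exists N; split.
  apply: (natural_filtration_negligible hW (FX x x0)).
  - exact: measurable_set_le.
  - apply: negligibleS nN => w [/= Xx nX']; apply: contrapT => nNw.
    by apply: nX'; rewrite X'E.
  - apply: negligibleS nN => w [/= Xx nX]; apply: contrapT => nNw.
    by apply: nX; rewrite -X'E.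
have X'0 w : X' 0 w = 0.
  have [Nw|nN] := pselect (N w); first exact: X'N.
  by rewrite X'E//; case: (solvesN w nN).
have X'_le w s t : 0 <= s -> s <= t -> X' s w <= X' t w.
  move=> s0 st; have [Nw|nN] := pselect (N w); first by rewrite !X'N.
  by rewrite !X'E//; exact: (solution_nondecreasing hX (solvesN w nN)).
have X'_cont w : {within Rplus, continuous (fun t => X' t w)}.
  have [Nw|nN] := pselect (N w).
    rewrite (_ : (fun t => X' t w) = cst 0); last by apply/funext => t; exact: X'N.
    by apply: continuous_subspaceT; exact: cst_continuous.
  rewrite (_ : (fun t => X' t w) = (fun t => X t w)).
    exact: (solution_continuous (solvesN w nN)).
  by apply/funext => t; exact: X'E.
move=> t t0 eps eta eps0 eta0.
have [delta delta0 H] := subordinated_quadratic_variation hW hrho sX' X'0 X'_le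
  X'_cont t0 eps0 eta0.
exists delta => // s sp sdelta; have := H s sp sdelta.
set A' := [set w | _]; set A := [set w | _] => PA'.
have mlnS r : 0 <= r -> measurable_fun setT (fun w => ln (S r w)).
  move=> r0; have [mX X0 _] := sX r r0; under eq_fun do rewrite lnS.
  apply: measurable_funB; last exact: measurable_funM.
  apply: measurable_subordinate => //.
  - by move=> w; exact: (Wrho_continuous hW rho w).
  - by move=> y y0 _; exact: (measurable_Wrho hW).
have mA : measurable A.
  apply: measurable_set_le => //; apply: measurableT_comp => //.
  apply: measurable_funB; last by case: (sX t t0).
  exact: (measurable_squared_increments mlnS t0 sp).
have mA' : measurable A'.
  have mX' r : 0 <= r -> measurable_fun setT (X' r) by move=> /sX'[].
  apply: measurable_set_le => //; apply: measurableT_comp => //.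
  apply: measurable_funB; last exact: mX'.
  apply: (measurable_squared_increments _ t0 sp) => r r0.
  apply: measurable_funB; last by apply: measurable_funM => //; exact: mX'.
  apply: measurable_subordinate => //.
  - by move=> w; exact: (Wrho_continuous hW rho w).
  - exact: mX'.
  - by move=> w; exact: X'_ge0.
  - by move=> y y0 _; exact: (measurable_Wrho hW).
apply: le_lt_trans PA'.
have nN : P.-negligible N by exists N; split.
have AA' w : ~ N w -> A w = A' w.
  move=> nNw; rewrite /A /A' /= X'E//; congr (is_true (_ <= `|_ - _|)).
  by apply: eq_bigr => i _; rewrite !lnS !X'E.
rewrite le_eqVlt; apply/orP; left; apply/eqP.
apply: measure_eq_negligible => //.
- apply: negligibleS nN => w [Aw nA']; apply: contrapT => nNw.
  by apply: nA'; rewrite -AA'.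
- apply: negligibleS nN => w [Aw nA']; apply: contrapT => nNw.
  by apply: nA'; rewrite AA'.
Qed.
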